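(* Let $\mathfrak g$ be a semisimple complex Lie algebra, let $\theta\in\operatorname{Aut}\mathfrak g$ be an element of order $2$ with $\mathfrak k=\{x\in\mathfrak g\mid\theta(x)=x\}$ and $\mathfrak p=\{x\in\mathfrak g\mid\theta(x)=-x\}$, and let $\mathfrak g_{\mathbb R}$ be a $\theta$-stable real form of $\mathfrak g$ such that $\mathfrak g_{\mathbb R}=(\mathfrak g_{\mathbb R}\cap\mathfrak k)\oplus(\mathfrak g_{\mathbb R}\cap\mathfrak p)$ is a Cartan decomposition of $\mathfrak g_{\mathbb R}$. Then for every $K$-orbit $\mathcal O$ in $\mathcal N(\mathfrak p)_{\rm pr}$, the elements of the $\operatorname{Ad}(\mathfrak g_{\mathbb R})$-orbit in $\mathcal N(\mathfrak g_{\mathbb R})$ corresponding to $\mathcal O$ via the Kostant–Sekiguchi bijection are compact.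
   Context: $G$ is the adjoint group of $\mathfrak g$, and $K$ is the connected (reductive algebraic) subgroup of $G$ with Lie algebra $\mathfrak k$. $\mathcal N(\mathfrak g)$ is the set of nilpotent elements of $\mathfrak g$ (those $x$ with $\operatorname{ad}x$ nilpotent), $\mathcal N(\mathfrak p)=\mathcal N(\mathfrak g)\cap\mathfrak p$, $\mathcal N(\mathfrak g_{\mathbb R})=\mathcal N(\mathfrak g)\cap\mathfrak g_{\mathbb R}$. There are only finitely many $K$-orbits in $\mathcal N(\mathfrak p)$, so every irreducible component of $\mathcal N(\mathfrak p)$ contains an open $K$-orbit; $\mathcal N(\mathfrak p)_{\rm pr}$ is the union of these open orbits (the set of principal nilpotent elements of $\mathfrak p$). The real form $\mathfrak g_{\mathbb R}$ defines an $\mathbb R$-structure on $G$; $\operatorname{Ad}(\mathfrak g_{\mathbb R})$, the adjoint group of $\mathfrak g_{\mathbb R}$, is the identity component of the Lie group of $\mathbb R$-points of $G$. Compact elements: for an algebraic Lie algebra $\mathfrak h$, $\operatorname{rad}_u\mathfrak h$ denotes its unipotent radical and $\mathfrak h/\operatorname{rad}_u\mathfrak h$ is called its reductive Levi factor. An element $x\in\mathcal N(\mathfrak g_{\mathbb R})$ is called compact if the reductive Levi factor of the centralizer $\mathfrak g_{\mathbb R}^x=\{y\in\mathfrak g_{\mathbb R}\mid[x,y]=0\}$ is a compact Lie algebra. Here compactness is in the sense of real algebraic Lie algebras: the reductive Levi factor is the Lie algebra of a reductive real algebraic group whose group of real points is compact (equivalently, for a reductive Levi subalgebra $\mathfrak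 r$ of $\mathfrak g_{\mathbb R}^x$ that is the Lie algebra of a reductive algebraic subgroup, every $\operatorname{ad}y$, $y\in\mathfrak r$, is semisimple on $\mathfrak g$ with purely imaginary eigenvalues). Kostant–Sekiguchi bijection: an $\mathfrak{sl}_2$-triple is an ordered triple $\{e,h,f\}$ with $[h,e]=2e$, $[h,f]=-2f$, $[e,f]=h$. Let $\sigma(a+ib)=a-ib$ for $a,b\in\mathfrak g_{\mathbb R}$. An $\mathfrak{sl}_2$-triple $\{e,h,f\}$ in $\mathfrak g$ with $h\in\mathfrak k$ and $e,f\in\mathfrak p$ is called a complex Cayley triple if $\sigma(e)=f$. For such a triple put $e'=\tfrac{i}{2}(-h+e-f)$, $h'=e+f$, $f'=\tfrac{i}{2}(h+e-f)$; then $\{e',h',f'\}$ is an $\mathfrak{sl}_2$-triple in $\mathfrak g_{\mathbb R}$ with $\theta(e')=-f'$. For every nonzero $K$-orbit $\mathcal O$ in $\mathcal N(\mathfrak p)$ there is a complex Cayley triple $\{e,h,f\}$ with $e\in\mathcal O$; the $\operatorname{Ad}(\mathfrak g_{\mathbb R})$-orbit $\mathcal O'=\operatorname{Ad}(\mathfrak g_{\mathbb R})\cdot e'$ depends only on $\mathcal O$, and $\mathcal O\mapsto\mathcal O'$ is a bijection (the Kostant–Sekiguchi bijection) from the set of nonzero $K$-orbits in $\mathcal N(\mathfrak p)$ to the set of nonzero $\operatorname{Ad}(\mathfrak g_{\mathbb R})$-orbits in $\mathcal N(\mathfrak g_{\mathbb R})$. *)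

(* Defs.v *)
From HB Require Import structures.
From mathcomp Require Import all_boot all_order all_algebra.
From mathcomp Require Import complex.
From mathcomp Require Import boolp classical_sets reals topology normedtype sequences.
From mathcomp Require mpoly.
Import numFieldNormedType.Exports.

Set Implicit Arguments.
Unset Strict Implicit.
Unset Printing Implicit Defensive.

Import Order.TTheory GRing.Theory Num.Theory passmx.

Local Open Scope classical_set_scope.
Local Open Scope ring_scope.

HB.mixin Record Vector_isLieAlgebra (F : fieldType) (L : Type)
    of Vector F L := {
  lie : L -> L -> L;
  lie_linearl : forall (a : F) (x y z : L),
    lie (a *: x + y) z = a *: lie x z + lie y z;
  lie_linearr : forall (a : F) (x y z : L),
    lie z (a *: x + y) = a *: lie z x + lie z y;
  liexx : forall x : L, lie x x = 0;
  lie_jacobi : forall x y z : L,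
    lie x (lie y z) + lie y (lie z x) + lie z (lie x y) = 0
}.

#[short(type="lieAlgType")]
HB.structure Definition LieAlgebra (F : fieldType) :=
  { L of Vector_isLieAlgebra F L & Vector F L }.

Section LieAlgebra.
Variables (F : fieldType) (g : lieAlgType F).

HB.instance Definition _ (x : g) :=
  GRing.isLinear.Build F g g *:%R (lie x) (fun a y z => lie_linearr a y z x).

Definition ad (x : g) : 'End(g) := linfun (lie x).

Definition killing (x y : g) : F :=
  \tr (mxof (vbasis {:g}) (vbasis {:g}) (ad x \o ad y)%VF).

Definition derived (U : {vspace g}) : {vspace g} :=
  <<[seq lie x y | x <- vbasis U, y <- vbasis U]>>%VS.

Definition lie_solvable (U : {vspace g}) : Prop :=
  exists n : nat, iter n derived U = 0%VS.

Definition lie_ideal (U : {vspace g}) : Prop :=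
  forall x y : g, y \in U -> lie x y \in U.

Definition lie_semisimple : Prop :=
  forall U : {vspace g}, lie_ideal U -> lie_solvable U -> U = 0%VS.

Definition lie_automorphism (theta : 'End(g)) : Prop :=
  bijective theta /\ forall x y : g, theta (lie x y) = lie (theta x) (theta y).

Definition order_two (theta : 'End(g)) : Prop :=
  (theta \o theta)%VF = \1%VF /\ theta <> \1%VF.

Definition fixed_part (theta : 'End(g)) : set g := [set x | theta x = x].

Definition antifixed_part (theta : 'End(g)) : set g := [set x | theta x = - x].

Definition nilpotent_elt : set g :=
  [set x | exists n : nat, forall y : g, iter n (lie x) y = 0].

Definition sl2_triple (e h f : g) : Prop :=
  [/\ lie h e = 2 *: e, lie h f = - (2 *: f) & lie e f = h].

End LieAlgebra.
Arguments nilpotent_elt {F} g.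
Arguments lie_semisimple {F} g.

Section Zariski.
Variables (F : fieldType) (V : vectType F).

(* Polynomial functions on [V] are those of the coordinates in a fixed basis *)
Definition zariski_closed (A : set V) : Prop :=
  exists P : set (mpoly.mpoly (\dim {:V}) F),
    A = [set v | forall p, P p -> mpoly.meval (rVof (vbasis {:V}) v 0) p = 0].

Definition zariski_irreducible (Z : set V) : Prop :=
  Z !=set0 /\
  forall A B : set V, zariski_closed A -> zariski_closed B ->
    Z `<=` A `|` B -> Z `<=` A \/ Z `<=` B.

Definition irreducible_component (X Z : set V) : Prop :=
  [/\ Z `<=` X, zariski_irreducible Z &
      forall Z' : set V, Z' `<=` X -> zariski_irreducible Z' ->
        Z `<=` Z' -> Z' = Z].

Definition zariski_open_in (Z U : set V) : Prop :=
  exists2 A : set V, zariski_closed A & U = Z `\` A.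

End Zariski.

Section Complex.
Variable R : realType.
Local Notation C := (R[i]).

Section Euclidean.
Variable V : vectType C.

(* Coordinates in a fixed basis; the ascription selects the topology of [C]
   as a [numFieldType]. *)
Definition coords (v : V) : 'rV[C : numFieldType]_(\dim {:V}) :=
  rVof (vbasis {:V}) v.

(* The limit is meaningful only for convergent [u]; the partial sums of the
   exponential series below always converge. *)
Definition vlim (u : nat -> V) : V :=
  vecof (vbasis {:V}) (limn (fun n => coords (u n))).

Definition euclidean_compact (A : set V) : Prop := compact (coords @` A).

End Euclidean.

Definition lfun_exp (V : vectType C) (D : 'End(V)) : 'End(V) :=
  vlim (fun n : nat =>
    \sum_(k < n) (k`!%:R^-1 *: iter k (fun E => (D \o E)%VF) \1%VF)).

Section Adjoint.
Variable g : lieAlgType C.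

(* For a (real or complex) Lie subalgebra [S], the group generated by
   [exp (ad x)], [x] in [S], i.e. the connected Lie subgroup of GL(g) with Lie
   algebra [ad S]. No closure under inverses is needed since the inverse of
   [exp (ad x)] is [exp (ad (- x))]. *)
Inductive adgroup (S : set g) : 'End(g) -> Prop :=
| adgroup1 : adgroup S \1%VF
| adgroupM (x : g) (phi : 'End(g)) :
    S x -> adgroup S phi -> adgroup S (lfun_exp (ad x) \o phi)%VF.

Definition adorbit (S : set g) (x : g) : set g :=
  [set phi x | phi in adgroup S].

Definition nilp_p (theta : 'End(g)) : set g :=
  nilpotent_elt g `&` antifixed_part theta.

(* [K] is [adgroup (fixed_part theta)]; the adjoint groups of [g] and of a real
   form [gR] are [adgroup setT] and [adgroup gR]. *)
Definition K_orbit_nilp_p (theta : 'End(g)) (O : set g) : Prop :=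
  exists2 x : g, nilp_p theta x & O = adorbit (fixed_part theta) x.

Definition principal_nilp_p (theta : 'End(g)) : set g :=
  [set x | exists Z O : set g,
     [/\ irreducible_component (nilp_p theta) Z, K_orbit_nilp_p theta O,
         zariski_open_in Z O & O x]].

Definition real_subspace (S : set g) : Prop :=
  [/\ S 0, forall x y, S x -> S y -> S (x + y) &
      forall (a : R) x, S x -> S (a%:C%C *: x)].

Definition real_subalgebra (S : set g) : Prop :=
  real_subspace S /\ forall x y, S x -> S y -> S (lie x y).

Definition direct_sum (S A B : set g) : Prop :=
  S = [set a + b | a in A & b in B] /\ A `&` B = [set 0].

Definition real_form (gR : set g) : Prop :=
  real_subalgebra gR /\ direct_sum setT gR [set 'i%C *: x | x in gR].

(* The Killing form of a real form is the restriction of that of [g]. In the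
   order of [R[i]], [z < 0] (resp. [0 < z]) says that [z] is real and negative
   (resp. positive). *)
Definition cartan_decomposition (gR kR pR : set g) : Prop :=
  [/\ real_subspace kR /\ real_subspace pR,
      direct_sum gR kR pR,
      [/\ forall x y, kR x -> kR y -> kR (lie x y),
          forall x y, kR x -> pR y -> pR (lie x y) &
          forall x y, pR x -> pR y -> kR (lie x y)],
      forall x, kR x -> x <> 0 -> killing x x < 0 &
      forall x, pR x -> x <> 0 -> 0 < killing x x].

(* [y] is the image of [x] under the conjugation of [g] with respect to [gR] *)
Definition conjugate_wrt (gR : set g) (x y : g) : Prop :=
  exists a b : g, [/\ gR a, gR b, x = a + 'i%C *: b & y = a - 'i%C *: b].

Definition complex_cayley_triple (theta : 'End(g)) (gR : set g)
    (e h f : g) : Prop :=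
  [/\ sl2_triple e h f, fixed_part theta h, antifixed_part theta e,
      antifixed_part theta f & conjugate_wrt gR e f].

(* First member [e'] of the Cayley transform of the triple [{e, h, f}] *)
Definition cayley_nilp (e h f : g) : g := ('i%C / 2) *: (- h + e - f).

Definition kostant_sekiguchi (theta : 'End(g)) (gR : set g)
    (O O' : set g) : Prop :=
  [/\ K_orbit_nilp_p theta O, O <> [set 0] &
      exists e h f : g, [/\ complex_cayley_triple theta gR e h f, O e &
        O' = adorbit gR (cayley_nilp e h f)]].

Definition nil_ideal (h I : set g) : Prop :=
  [/\ real_subspace I, I `<=` h, I `<=` nilpotent_elt g &
      forall x y, h x -> I y -> I (lie x y)].

(* Unipotent radical of the algebraic subalgebra [h]: the largest ideal of [h]
   consisting of nilpotent elements. It is the union of all such ideals because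
   a sum of two of them is again one. *)
Definition rad_u (h : set g) : set g :=
  [set x | exists2 I : set g, nil_ideal h I & I x].

(* The group of real points of the adjoint group, for the real structure
   defined by [gR] *)
Definition adjoint_real_points (gR : set g) : set 'End(g) :=
  [set phi | adgroup setT phi /\ forall x, gR x -> gR (phi x)].

(* [H] is the group of real points of an algebraic subgroup, defined over [R],
   of the adjoint group. On the real points a complex polynomial equation
   amounts to two real ones, so complex equations may be used. *)
Definition real_algebraic_subgroup (gR : set g) (H : set 'End(g)) : Prop :=
  [/\ H \1%VF,
      forall phi psi, H phi -> H psi -> H (phi \o psi)%VF,
      forall phi, H phi -> H (phi^-1)%VF &
      exists2 A : set 'End(g), zariski_closed A &
        H = adjoint_real_points gR `&` A].

Definition lie_of_group (gR : set g) (H : set 'End(g)) : set g :=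
  [set y | gR y /\ forall t : R, H (lfun_exp (ad (t%:C%C *: y)))].

(* If moreover [r] is the Lie algebra of an algebraic group, then the projection
   identifies [r] with the reductive Levi factor [h / rad_u h] as algebraic Lie
   algebras. *)
Definition reductive_levi (h r : set g) : Prop :=
  [/\ real_subalgebra r, direct_sum h r (rad_u h) & rad_u r = [set 0]].

Definition centralizer_in (gR : set g) (x : g) : set g :=
  [set y | gR y /\ lie x y = 0].

(* The elements of [End g] preserving [gR] form a real form of [End g], so that
   compactness of [H] in [End g] is its compactness in [GL(gR)]. *)
Definition compact_nilp (gR : set g) (x : g) : Prop :=
  [/\ gR x, nilpotent_elt g x &
      exists (r : set g) (H : set 'End(g)),
        [/\ reductive_levi (centralizer_in gR x) r,
            real_algebraic_subgroup gR H,
            r = lie_of_group gR H &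
            euclidean_compact H]].

End Adjoint.
End Complex.

(* Main.v *)
(** Let tau be the conjugation of g with respect to the compact real form
    attached to theta, so that <x, y> = - killing x (tau y) is a hermitian inner
    product for which (ad u)^* = - ad (tau u).

    Call a Cayley triple (e, h, f) distinguished if no nonzero z in p commutes
    with e, h and f.  If it is, the centralizer r of the transformed real triple
    lies in k; r is a Levi factor of the centralizer of e' (the elements of that
    centralizer in the image of ad e' form its unipotent radical, by Jacobson's
    lemma), and the group of real points fixing e, h, f and commuting with theta
    is unitary, hence compact.

    It remains to see that e principal forces the triple to be distinguished.
    Put S = e + V with V = ker (ad f) in p.  The map exp (ad h), suitably scaled,
    contracts S to e.  A nonzero z in p commuting with the triple provides a
    nonzero polynomial vector field on S that is pointwise tangent to the adjoint
    orbits, so it kills the functions x |-> tr (ad x)^i.  If e were the only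
    nilpotent element of S, the contraction would make the common level sets of
    these functions compact; at a point of such a level set where a component of
    the field has maximal modulus, the maximum principle along the complex flow
    makes that component constant, and its flow line leaves every bounded set
    unless the component vanishes.  Hence S contains a nilpotent x <> e.  The
    Zariski closure of the cone over K x is irreducible and contains K e, so by
    principality points of S near e, other than e, lie in K e; this contradicts
    the transversality of S to the K-orbits at e. *)
Require Import Defs.
From HB Require Import structures.
From mathcomp Require Import all_boot all_order all_algebra.
From mathcomp Require Import complex.
From mathcomp Require Import boolp classical_sets functions reals topology normedtype.
From mathcomp Require Import sequences derive exp trigo.
From mathcomp Require mpoly.
Import (canonicals) mpoly.
From mathcomp Require Import interval_inference ring lra zify.
Import numFieldNormedType.Exports.

Set Implicit Arguments.
Unset Strict Implicit.
Unset Printing Implicit Defensive.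

Import Order.TTheory GRing.Theory Num.Theory passmx.

Local Open Scope classical_set_scope.
Local Open Scope ring_scope.

(** * Absolutely convergent series *)

(** Three points carry the weight. The group [adgroup] is generated by exponentials and has no
    closedness built in, so for the stabilizer of the triple boundedness is not enough: a limit of
    its elements must again be a product of exponentials. Such a limit differs from a nearby member
    by a unitary automorphism close to 1, whose logarithm is a derivation and hence inner. The
    vector field comes from a vector u in ker (ad e) on which z acts by a nonzero scalar: u + theta
    u commutes with e but not with z, and Cramer's rule spreads it to a polynomial map into k whose
    bracket with the points of S is tangent to S. If that bracket vanished at e + s z, the generator
    would commute with both e and z. Transversality at e is a dimension count for the kernel of (ad
    f)(ad x), combined with the grading: if x = chi e lies in S, then chi h scales x by 2, while h
    does so only if x = e. The analysis rests on absolutely convergent power series; the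
    coefficients of a flow are the iterated derivatives along the field. *)

Section AbsSum.
Variable C : numFieldType.

(** Over an arbitrary [numFieldType] bounded sums of norms need not yield a limit, so convergence to
    [s] is required separately. *)
Definition abs_sum (u : nat -> C) (s : C) : Prop :=
  (exists B : C, forall n, \sum_(k < n) `|u k| <= B) /\
  (fun n => \sum_(k < n) u k) @ \oo --> s.

Lemma abs_sum_unique u s t : abs_sum u s -> abs_sum u t -> s = t.
Proof.
move=> [_ us] [_ ut]; exact: (cvg_unique (@norm_hausdorff _ C) us ut).
Qed.

Lemma abs_sumD u v s t :
  abs_sum u s -> abs_sum v t -> abs_sum (fun n => u n + v n) (s + t).
Proof.
move=> [[B uB] us] [[B' vB] vt]; split.
  exists (B + B') => n; rewrite (le_trans _ (lerD (uB n) (vB n)))//.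
  by rewrite -big_split ler_sum// => k _; exact: ler_normD.
rewrite (_ : (fun n => _) =
    (fun n => \sum_(k < n) u k) + (fun n => \sum_(k < n) v k)); first exact: cvgD.
by apply/funext => n; rewrite big_split.
Qed.

Lemma abs_sumZ c u s : abs_sum u s -> abs_sum (fun n => c * u n) (c * s).
Proof.
move=> [[B uB] us]; split.
  exists (`|c| * B) => n; under eq_bigr do rewrite normrM.
  by rewrite -mulr_sumr ler_wpM2l.
rewrite (_ : (fun n => _) = (fun=> c) * (fun n => \sum_(k < n) u k)).
  by apply: cvgM => //; exact: cvg_cst.
by apply/funext => n; rewrite -mulr_sumr.
Qed.

Lemma abs_sum_finite u N :
  (forall n, (N <= n)%N -> u n = 0) -> abs_sum u (\sum_(k < N) u k).
Proof.
move=> u0; have e (v : nat -> C) n : (forall n, (N <= n)%N -> v n = 0) ->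
    (N <= n)%N -> \sum_(k < n) v k = \sum_(k < N) v k.
  move=> v0 Nn; rewrite -!(big_mkord xpredT v) (big_cat_nat (n := N))//=.
  rewrite [X in _ + X]big_nat [X in _ + X]big1 ?addr0// => i /andP[Ni _].
  exact: v0.
split.
  exists (\sum_(k < N) `|u k|) => n.
  have [Nn|/ltnW nN] := leqP N n.
    by rewrite (e (fun k => `|u k|))// => k /u0 ->; rewrite normr0.
  rewrite -!(big_mkord xpredT (fun k => `|u k|)).
  rewrite (big_cat_nat (n := n) (p := N))//= lerDl.
  by apply: sumr_ge0.
apply: cvg_near_cst; near=> n; apply: (e u) => //.
by near: n; exact: nbhs_infty_ge.
Unshelve. all: by end_near. Qed.

Lemma abs_sum_sum (I : Type) (r : seq I) (u : I -> nat -> C) (s : I -> C) :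
  (forall i, abs_sum (u i) (s i)) ->
  abs_sum (fun n => \sum_(i <- r) u i n) (\sum_(i <- r) s i).
Proof.
move=> us; elim: r => [|i r IH].
  rewrite big_nil (_ : (fun n => _) = fun=> 0); last first.
    by apply/funext => n; rewrite big_nil.
  by have := @abs_sum_finite (fun=> 0) 0%N (fun _ _ => erefl); rewrite big_ord0.
rewrite big_cons; under eq_fun do rewrite big_cons.
exact: abs_sumD.
Qed.

End AbsSum.

Section ComplexLimits.
Variable R : realType.
Local Notation C := (R[i] : numFieldType).

Lemma cvg_real_complex (u : nat -> R) (l : R) :
  u @ \oo --> l -> (fun n => (u n)%:C%C : C) @ \oo --> (l%:C%C : C).
Proof.
move=> /cvgrPdist_lt ul; apply/cvgrPdist_lt => -[e e'].
rewrite ltcE /= => /andP[/eqP -> e0].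
near=> n; rewrite -rmorphB normc_def /= expr0n addr0 sqrtr_sqr ltcR.
by near: n; exact: ul.
Unshelve. all: by end_near. Qed.

Lemma cvg_complexP (u : nat -> C) (l : C) :
  (u @ \oo --> l) <->
  ((fun n => complex.Re (u n)) @ \oo --> complex.Re l /\
   (fun n => complex.Im (u n)) @ \oo --> complex.Im l).
Proof.
split=> [/cvgrPdist_lt ul|[ur ui]].
  split; apply/cvgrPdist_lt => e e0.
    near=> n; rewrite -ltcR -raddfB (le_lt_trans (normc_ge_Re _))//.
    by near: n; apply: ul; rewrite ltcR.
  near=> n; rewrite -ltcR -raddfB.
  have -> : `|complex.Im (l - u n)| = `|complex.Re ((l - u n) * 'i%C)|.
    by rewrite ReiNIm normrN.
  rewrite (le_lt_trans (normc_ge_Re _))// normrM (_ : `|'i%C| = 1) ?mulr1.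
    by near: n; apply: ul; rewrite ltcR.
  by rewrite normc_def /= expr0n expr1n add0r sqrtr1.
rewrite (_ : u = fun n => ((complex.Re (u n))%:C%C : C) +
    ('i%C : C) * ((complex.Im (u n))%:C%C : C)); last first.
  by apply/funext => n; exact: complexE.
rewrite [l in _ --> l]complexE; apply: cvgD; first exact: cvg_real_complex.
by apply: cvgM; [exact: cvg_cst|exact: cvg_real_complex].
Unshelve. all: by end_near. Qed.

Lemma bounded_series_cvg (u : nat -> R) (B : R) :
  (forall n, \sum_(k < n) `|u k| <= B) ->
  exists s : R, (fun n => \sum_(k < n) u k) @ \oo --> s.
Proof.
move=> uB; have eqs (v : nat -> R) : (fun n => \sum_(k < n) v k) = series v.
  by apply/funext => n; rewrite /series /= big_mkord.
exists (limn (series u)); rewrite eqs; apply: normed_cvg.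
rewrite /normed_series_of; apply: nondecreasing_is_cvgn.
  by apply: nondecreasing_series => i _ _ /=.
by exists B => _ [n _ <-]; rewrite -eqs.
Qed.

Lemma Re_sum n (u : nat -> C) :
  complex.Re (\sum_(k < n) u k) = \sum_(k < n) complex.Re (u k).
Proof. exact: (raddf_sum (@complex.Re R : {additive C -> R})). Qed.

Lemma Im_sum n (u : nat -> C) :
  complex.Im (\sum_(k < n) u k) = \sum_(k < n) complex.Im (u k).
Proof. exact: (raddf_sum (@complex.Im R : {additive C -> R})). Qed.

Lemma normc_ge_Im (x : R[i]) : `|complex.Im x|%:C%C <= `|x|.
Proof.
rewrite -normrN -ReiNIm (le_trans (normc_ge_Re _))// normrM.
by rewrite [X in _ * X]normc_def /= expr0n expr1n add0r sqrtr1 mulr1.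
Qed.

Lemma abs_bounded_sum (u : nat -> C) (B : C) :
  (forall n, \sum_(k < n) `|u k| <= B) -> exists s, abs_sum u s.
Proof.
move=> uB.
(* The bound dominates the empty sum, so it is nonnegative in the order of [R[i]], hence real. *)
have B0 : B = (complex.Re B)%:C%C.
  by rewrite RRe_real // ger0_real // (le_trans _ (uB 0%N)) ?big_ord0.
have [a ua] : exists s : R, (fun n => \sum_(k < n) complex.Re (u k)) @ \oo --> s.
  apply: (@bounded_series_cvg (fun k => complex.Re (u k)) (complex.Re B)) => n.
  rewrite -lecR -B0 (le_trans _ (uB n))// rmorph_sum ler_sum// => k _.
  exact: normc_ge_Re.
have [b ub] : exists s : R, (fun n => \sum_(k < n) complex.Im (u k)) @ \oo --> s.
  apply: (@bounded_series_cvg (fun k => complex.Im (u k)) (complex.Re B)) => n.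
  rewrite -lecR -B0 (le_trans _ (uB n))// rmorph_sum ler_sum// => k _.
  exact: normc_ge_Im.
exists (a +i* b)%C; split; first by exists B.
apply/cvg_complexP; split => /=.
  by under eq_fun do rewrite Re_sum.
by under eq_fun do rewrite Im_sum.
Qed.

End ComplexLimits.

(** * Cauchy products *)

Section CauchyProduct.
Variable C : numFieldType.

Definition convol (u v : nat -> C) (n : nat) : C :=
  \sum_(k < n.+1) u k * v (n - k)%N.

Lemma norm_convol (u v : nat -> C) n :
  `|convol u v n| <= convol (fun k => `|u k|) (fun k => `|v k|) n.
Proof.
rewrite (le_trans (ler_norm_sum _ _ _))// ler_sum// => i _.
by rewrite normrM.
Qed.

(** Multiply the truncations as polynomials and evaluate at 1: the degrees below [N] give full
    convolutions, those from [N] to [2 N - 1] a truncated remainder. *)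
Lemma partial_sums_mul (u v : nat -> C) N :
  (\sum_(k < N) u k) * (\sum_(k < N) v k) =
  \sum_(k < N) convol u v k +
  \sum_(N <= n < N.*2) \sum_(k < n.+1 | (k < N)%N && (n - k < N)%N)
     u k * v (n - k)%N.
Proof.
pose p (w : nat -> C) := \poly_(i < N) w i.
have p1 w : (p w).[1] = \sum_(k < N) w k.
  by rewrite horner_poly; apply: eq_bigr => i _; rewrite expr1n mulr1.
rewrite -(p1 u) -(p1 v) -hornerM (horner_coef_wide (n := N.*2)); last first.
  rewrite (leq_trans (size_polyMleq _ _))//.
  rewrite (leq_trans (leq_pred _))// -addnn leq_add// size_poly //.
under eq_bigr do rewrite expr1n mulr1.
rewrite -(big_mkord xpredT (fun i => (p u * p v)`_i)).
rewrite (big_cat_nat (n := N))//=; last by rewrite -addnn leq_addr.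
congr +%R.
  rewrite big_mkord; apply: eq_bigr => i _; rewrite coefM /convol.
  apply: eq_bigr => k _; rewrite !coef_poly.
  rewrite (leq_ltn_trans (leq_subr _ _))// (leq_ltn_trans _ (ltn_ord i))//.
  by rewrite -ltnS.
apply: eq_bigr => n _; rewrite coefM [RHS]big_mkcond; apply: eq_bigr => k _.
by rewrite !coef_poly; case: ifP; case: ifP; rewrite ?mul0r ?mulr0.
Qed.

(** The only form in which completeness enters, so that power series and flows can be treated over
    an abstract field; [sum_completeC] provides it for [R[i]]. *)
Definition sum_complete : Prop := forall (u : nat -> C) (B : C),
  (forall n, \sum_(k < n) `|u k| <= B) -> exists s, abs_sum u s.

Hypothesis complete : sum_complete.

(** The error after n terms is dominated by the same error for the norms, which is at most the block
    from n to 2n of the convergent series [c]. *)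
Lemma abs_sumM (u v : nat -> C) (s t : C) :
  abs_sum u s -> abs_sum v t -> abs_sum (convol u v) (s * t).
Proof.
move=> [[A uA] us] [[B vB] vt].
pose c := convol (fun k => `|u k|) (fun k => `|v k|).
have c0 n : 0 <= c n by apply: sumr_ge0 => i _; exact: mulr_ge0.
have cE n : `|c n| = c n by rewrite ger0_norm.
have cAB n : \sum_(k < n) `|c k| <= A * B.
  under eq_bigr do rewrite cE.
  rewrite (@le_trans _ _ ((\sum_(k < n) `|u k|) * (\sum_(k < n) `|v k|)))//.
    rewrite (partial_sums_mul (fun k => `|u k|) (fun k => `|v k|)) lerDl sumr_ge0// => i _.
    by apply: sumr_ge0 => k _; exact: mulr_ge0.
  by apply: ler_pM => //; apply: sumr_ge0.
have [L [_ cL]] := complete cAB.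
split.
  exists (A * B) => n; rewrite (le_trans _ (cAB n))// ler_sum// => k _.
  by rewrite cE; exact: norm_convol.
have c2L : (fun n => \sum_(k < n.*2) c k) @ \oo --> L.
  apply: (cvg_comp (fun n => n.*2) (fun n => \sum_(k < n) c k) _ cL).
  move=> P [N _ NP]; exists N => // n /= Nn; apply: NP => /=.
  by rewrite (leq_trans Nn)// -addnn leq_addr.
have d0 : (fun n => \sum_(k < n.*2) c k - \sum_(k < n) c k) @ \oo --> (0 : C).
  have H := cvgB c2L cL; rewrite subrr in H. exact: H.
have e0 : (fun n => (\sum_(k < n) u k) * (\sum_(k < n) v k) -
    \sum_(k < n) convol u v k) @ \oo --> (0 : C).
  apply/cvgr0Pnorm_lt => e e0; move/cvgr0Pnorm_lt : d0 => /(_ e e0).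
  apply: filterS => n; apply: le_lt_trans.
  rewrite partial_sums_mul addrAC subrr add0r.
  have -> : \sum_(k < n.*2) c k - \sum_(k < n) c k = \sum_(n <= k < n.*2) c k.
    rewrite -!(big_mkord xpredT c).
    rewrite [X in X - _](big_cat_nat (n := n))//= -?addnn ?leq_addr//.
    by rewrite addrAC subrr add0r.
  rewrite (le_trans (ler_norm_sum _ _ _))//.
  rewrite [leRHS]ger0_norm ?sumr_ge0// ler_sum// => i _.
  rewrite (le_trans (ler_norm_sum _ _ _))// big_mkcond ler_sum//= => k _.
  by rewrite -normrM; case: ifP => // _; exact: normr_ge0.
have : (fun n => (\sum_(k < n) u k) * (\sum_(k < n) v k) -
   ((\sum_(k < n) u k) * (\sum_(k < n) v k) -
    \sum_(k < n) convol u v k)) @ \oo --> s * t.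
  have H := cvgB (cvgM us vt) e0; rewrite subr0 in H; exact: H.
by under eq_fun do rewrite subKr.
Qed.

End CauchyProduct.

Section PowerSeries.
Variable C : numFieldType.

Lemma cvg_norm_le (u : nat -> C) (l c K : C) (N : nat) :
  u @ \oo --> l -> (forall n, (N <= n)%N -> `|u n - c| <= K) -> `|l - c| <= K.
Proof.
move=> ul uK; have K0 : 0 <= K by exact: le_trans (uK N (leqnn N)).
rewrite real_leNgt ?normr_real ?ger0_real//; apply/negP => Kl.
have e0 : 0 < `|l - c| - K by rewrite subr_gt0.
move/cvgrPdist_lt : ul => /(_ _ e0) [M _ ulM].
have := ulM (maxn M N) (leq_maxl _ _); apply/negP.
rewrite -real_leNgt ?normr_real ?realB ?normr_real ?ger0_real//.
rewrite lerBlDr (le_trans (ler_distD (u (maxn M N)) _ _))// lerD2l.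
by rewrite uK// leq_maxr.
Qed.

Definition power_series (rho : C) (a : nat -> C) (f : C -> C) : Prop :=
  forall t, `|t| <= rho -> abs_sum (fun n => a n * t ^+ n) (f t).

(** At radius [rho] the norms of the terms sum to at most [B], and for k >= p the factor (|t| /
    rho)^k is at most (|t| / rho)^p. *)
Lemma taylor_bound rho a f p : 0 < rho -> power_series rho a f ->
  exists2 M, 0 <= M & forall t, `|t| <= rho ->
    `|f t - \sum_(k < p) a k * t ^+ k| <= M * `|t| ^+ p.
Proof.
move=> rho0 af; have [|[B aB] _] := af rho; first by rewrite gtr0_norm.
exists (B / rho ^+ p).
  by rewrite divr_ge0 ?exprn_ge0 ?(ltW rho0)// (le_trans _ (aB 0%N))// big_ord0.
move=> t trho; have [_ ft] := af t trho.
apply: (cvg_norm_le (N := p) ft) => n pn.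
rewrite -!(big_mkord xpredT (fun k => a k * t ^+ k)) (big_cat_nat (n := p))//=.
rewrite addrAC subrr add0r (le_trans (ler_norm_sum _ _ _))//.
rewrite mulrAC ler_pdivlMr ?exprn_gt0//.
rewrite (@le_trans _ _ ((\sum_(p <= k < n) `|a k * rho ^+ k|) * `|t| ^+ p))//.
  rewrite !mulr_suml big_nat [leRHS]big_nat ler_sum// => k /andP[pk kn].
  rewrite !normrM -!mulrA ler_wpM2l// !normrX (gtr0_norm rho0).
  rewrite -(subnK pk) !exprD mulrAC -!mulrA [rho ^+ p * _]mulrC !mulrA.
  rewrite !ler_wpM2r ?exprn_ge0 ?(ltW rho0)//.
  by rewrite lerXn2r ?nnegrE ?(ltW rho0).
rewrite ler_wpM2r ?exprn_ge0// (le_trans _ (aB n))//.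
rewrite -(big_mkord xpredT (fun k => `|a k * rho ^+ k|)).
by rewrite [leRHS](big_cat_nat (n := p))//= lerDr sumr_ge0.
Qed.
End PowerSeries.

(** * The maximum principle for power series *)

Section MaximumModulus.
Variable C : numClosedFieldType.

(** Let [a n.+1] be the first nonzero coefficient after [a 0]. Moving in the direction where its
    term has the phase of [a 0] raises the modulus by [al * r ^+ n.+1], more than the remainder
    [M * r ^+ n.+2] can take back when [M * r < al]. *)
Lemma maximum_modulus (rho : C) (a : nat -> C) f : 0 < rho ->
  power_series rho a f ->
  (forall t, `|t| <= rho -> `|f t| <= `|a 0%N|) ->
  forall n, a n.+1 = 0.
Proof.
move=> rho0 af fa n; elim/ltn_ind : n => n IH.
have [M M0 aM] := taylor_bound n.+2 rho0 af.
apply/eqP/negPn/negP => an0.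
pose al := `|a n.+1|; have al0 : 0 < al by rewrite normr_gt0.
have d0 : 0 < al + M * rho by rewrite ltr_wpDr// mulr_ge0// ltW.
(* This quotient gives both [r <= rho] and [M * r < al]. *)
pose r := rho * (al / (al + M * rho)).
have r0 : 0 < r by rewrite mulr_gt0// divr_gt0.
have rrho : r <= rho.
  by rewrite ger_pMr// ler_pdivrMr// mul1r lerDl mulr_ge0// ltW.
have Mr : M * r < al.
  have -> : M * r = al * (M * rho / (al + M * rho)) by rewrite /r; ring.
  by rewrite gtr_pMr// ltr_pdivrMr// mul1r ltrDr.
(* The phase of [a 0]; any phase will do when [a 0] is zero. *)
pose u := if a 0%N == 0 then 1 else a 0%N / `|a 0%N|.
have au : a 0%N = `|a 0%N| * u.
  rewrite /u; case: eqP => [->|/eqP a0]; first by rewrite normr0 mul0r.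
  by rewrite mulrCA divff ?mulr1// normr_eq0.
have u1 : `|u| = 1.
  rewrite /u; case: eqP => [_|/eqP a0]; first by rewrite normr1.
  by rewrite normrM normfV normr_id divff// normr_eq0.
pose w := al * r ^+ n.+1 * u / a n.+1.
pose t := n.+1.-root w.
have tw : t ^+ n.+1 = w by rewrite rootCK.
have tr : `|t| = r.
  apply/(pexpIrn (n := n.+1)); rewrite ?nnegrE ?(ltW r0)//.
  rewrite -normrX tw /w !normrM u1 mulr1 normfV -/al normr_id.
  by rewrite ger0_norm ?exprn_ge0 ?(ltW r0)// mulrAC divff ?mul1r// gt_eqF.
have trho : `|t| <= rho by rewrite tr.
have := aM t trho; rewrite big_ord_recr big_ord_recl /= big1 ?addr0; last first.
  by move=> k _; rewrite IH ?mul0r//= .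
rewrite expr0 mulr1 tw tr /w mulrCA divff// mulr1 [in X in X -> _]au.
rewrite -mulrDl => ftle.
have : `|(`|a 0%N| + al * r ^+ n.+1) * u| <= `|a 0%N| + M * r ^+ n.+2.
  rewrite -[X in `|X|](subKr (f t)) (le_trans (ler_normB _ _))// lerD// fa//.
rewrite normrM u1 mulr1 ger0_norm; last first.
  by rewrite addr_ge0// mulr_ge0 ?exprn_ge0 ?ltW.
rewrite lerD2l [r ^+ n.+2]exprS [M * _]mulrA ler_pM2r ?exprn_gt0// => /le_lt_trans/(_ Mr).
by rewrite ltxx.
Qed.
End MaximumModulus.

(** The pairing [B] is arbitrary so as to cover both the product of polynomials under [vfield] and
    the Lie bracket under a derivation. *)
Lemma leibniz_iter (U V : Type) (W : zmodType) (B : U -> V -> W)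
    (dU : U -> U) (dV : V -> V) (dW : {additive W -> W}) x y n :
  (forall x y, dW (B x y) = B (dU x) y + B x (dV y)) ->
  iter n dW (B x y) =
  \sum_(k < n.+1) B (iter k dU x) (iter (n - k) dV y) *+ 'C(n, k).
Proof.
move=> dB; elim: n => [|n IH]; first by rewrite big_ord1 bin0 mulr1n.
rewrite iterS IH raddf_sum /=.
under eq_bigr do rewrite raddfMn dB mulrnDl -iterS.
rewrite big_split /= [RHS]big_ord_recl /= bin0 mulr1n.
under [X in _ = _ + X]eq_bigr do rewrite /bump add1n binS mulrnDr subSS.
rewrite [in RHS]big_split addrA addrC; congr (_ + _).
  rewrite [in LHS]big_ord_recl bin0 mulr1n subn0 [in RHS]big_ord_recr /=.
  rewrite bin_small// mulr0n addr0; congr (_ + _); apply: eq_bigr => k _ /=.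
  by rewrite /bump add1n -(subnSK (ltn_ord k)).
Qed.

(** * Complex flows of polynomial vector fields *)

Section LieSeries.
Variables (C : numClosedFieldType) (d : nat).
Local Notation mpol := (mpoly.mpoly d C).
Local Notation mX j := (mpoly.mpolyX C (mpoly.mnm1 j)).
Local Notation meval := mpoly.meval.
Local Notation mderiv := mpoly.mderiv.
Hypothesis complete : sum_complete C.

Variable M : C.
Hypothesis M1 : 1 <= M.
Let M0 : 0 <= M. Proof. exact: le_trans ler01 M1. Qed.

(* [bounded k a p]: [p] is a sum of monomials of degree at most [k] whose
   values on the polydisc of radius [M] have norms with sum at most [a]. *)
Inductive bounded : nat -> C -> mpol -> Prop :=
| bounded0 k a : 0 <= a -> bounded k a 0
| bounded_monom k a c (l : seq 'I_d) : (size l <= k)%N ->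
    `|c| * M ^+ size l <= a -> bounded k a (c *: \prod_(j <- l) mX j)
| boundedD k a b p q :
    bounded k a p -> bounded k b q -> bounded k (a + b) (p + q).

Lemma bounded_ge0 k a p : bounded k a p -> 0 <= a.
Proof.
elim=> // [{}k {}a c l _|{}k {}a b {}p q _ a0 _ b0]; last exact: addr_ge0.
by apply: le_trans; rewrite mulr_ge0// exprn_ge0.
Qed.

Lemma bounded_le k k' a a' p :
  (k <= k')%N -> a <= a' -> bounded k a p -> bounded k' a' p.
Proof.
move=> kk' aa' kp; rewrite -[p]addr0 -(subrKC a a').
apply: boundedD; last by apply: bounded0; rewrite subr_ge0.
elim: kp k' kk' {aa'} => [{}k {}a a0 k' _|{}k {}a c l lk ca k' kk'|
  {}k {}a b {}p q _ IHp _ IHq k' kk'].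
- exact: bounded0.
- by apply: bounded_monom => //; exact: leq_trans kk'.
- by apply: boundedD; [exact: IHp|exact: IHq].
Qed.

Lemma bounded_eval k a p (y : 'I_d -> C) :
  (forall j, `|y j| <= M) -> bounded k a p -> `|meval y p| <= a.
Proof.
move=> yM; elim=> [{}k {}a a0|{}k {}a c l _ ca|{}k {}a b {}p q _ IHp _ IHq].
- by rewrite raddf0 normr0.
- rewrite mpoly.mevalZ normrM (le_trans _ ca)// ler_wpM2l// rmorph_prod normr_prod.
  elim: l {ca} => [|j l IH]; first by rewrite big_nil expr0.
  by rewrite big_cons /= exprS mpoly.mevalXU ler_pM // prodr_ge0.
- by rewrite raddfD (le_trans (ler_normD _ _))// lerD.
Qed.

Lemma boundedM k l a b p q :
  bounded k a p -> bounded l b q -> bounded (k + l) (a * b) (p * q).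
Proof.
move=> kp; have a0 := bounded_ge0 kp.
elim=> {l b q} [l b b0|l b c s sl cb|l b b1 q q1 _ IHq _ IHq1].
- by rewrite mulr0; apply: bounded0; exact: mulr_ge0.
- have b0 : 0 <= b by rewrite (le_trans _ cb)// mulr_ge0// exprn_ge0.
  elim: kp {a0} => [{}k {}a a0|{}k {}a c' s' sk ca|
    {}k {}a a' {}p p' _ IHp _ IHp'].
  + by rewrite mul0r; apply: bounded0; exact: mulr_ge0.
  + rewrite -scalerAl -scalerAr scalerA -big_cat.
    apply: bounded_monom; first by rewrite size_cat leq_add.
    rewrite size_cat normrM exprD mulrACA ler_pM// ?mulr_ge0// ?exprn_ge0//.
  + by rewrite !mulrDl; exact: boundedD.
- by rewrite !mulrDr; exact: boundedD.
Qed.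

Lemma boundedX j : bounded 1 M (mX j).
Proof.
rewrite -[mpoly.mpolyX _ _]scale1r -[mpoly.mpolyX _ _](big_seq1 *%R j (fun j => mX j)).
by apply: bounded_monom => //=; rewrite normr1 mul1r.
Qed.

Lemma boundedC c : bounded 0 `|c| (mpoly.mpolyC d c).
Proof.
rewrite (_ : mpoly.mpolyC d c = c *: \prod_(j <- [::]) mX j).
  by apply: bounded_monom => //=; rewrite mulr1.
by rewrite big_nil -[RHS]mpoly.mul_mpolyC mulr1.
Qed.

Lemma bounded_ex p : exists k a, bounded k a p.
Proof.
elim/mpoly.mpolyind : p => [|c m p _ _ [k [a kp]]].
  by exists 0%N, 0; exact: bounded0.
have [l [b lm]] : exists l b, bounded l b (mpoly.mpolyX C m).
  rewrite mpoly.mpolyXE_id; elim/big_ind : _ => [|q q'|i _].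
  - by exists 0%N, `|1|; exact: boundedC.
  - by move=> [l [b lq]] [l' [b' lq']]; exists (l + l')%N, (b * b'); exact: boundedM.
  - set e := (X in _ ^+ X); elim: e => [|n [l [b IH]]].
      by rewrite expr0; exists 0%N, `|1|; exact: boundedC.
    by rewrite exprS; exists (1 + l)%N, (M * b); apply: boundedM => //; exact: boundedX.
exists (maxn l k), (`|c| * b + a); apply: boundedD.
  rewrite -mpoly.mul_mpolyC; apply: bounded_le (boundedM (boundedC c) lm) => //.
  exact: leq_maxl.
by apply: bounded_le kp => //; exact: leq_maxr.
Qed.

Variable xi : 'I_d -> mpol.

Definition vfield (p : mpol) : mpol := \sum_(j < d) xi j * mderiv j p.

Lemma vfield_is_linear : linear vfield.
Proof.
move=> c p q; rewrite /vfield scaler_sumr -big_split; apply: eq_bigr => j _.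
by rewrite linearP mulrDr -scalerAr.
Qed.
HB.instance Definition _ := GRing.isLinear.Build C mpol mpol *:%R vfield vfield_is_linear.

Lemma vfieldM (p q : mpol) : vfield (p * q) = vfield p * q + p * vfield q.
Proof.
rewrite /vfield mulr_suml mulr_sumr -big_split; apply: eq_bigr => j _.
by rewrite mpoly.mderivM mulrDr !mulrA [p * xi j]mulrC.
Qed.

Lemma vfieldX j : vfield (mX j) = xi j.
Proof.
rewrite /vfield (bigD1 j)//= big1 ?addr0 => [|i ij].
  rewrite mpoly.mderivX mpoly.mnm1E eqxx scale1r.
  rewrite (_ : mpoly.mnm_sub _ _ = mpoly.mnm0) ?mpoly.mpolyX0 ?mulr1//.
  by apply/mpoly.mnmP => i; rewrite mpoly.mnmBE subnn mpoly.mnm0E.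
by rewrite mpoly.mderivX mpoly.mnm1E eq_sym (negPf ij) scale0r mulr0.
Qed.

Lemma vfieldC c : vfield (mpoly.mpolyC d c) = 0.
Proof. by rewrite /vfield big1// => j _; rewrite mpoly.mderivC mulr0. Qed.

Variables (q : nat) (Xi : C).
Hypothesis Xi0 : 0 <= Xi.
Hypothesis xi_bounded : forall j, bounded q Xi (xi j).

Lemma vfield1 : vfield 1 = 0.
Proof. by rewrite -[1]/(mpoly.mpolyC d 1) vfieldC. Qed.

Lemma bounded_vfield_monom (l : seq 'I_d) :
  bounded (size l + q) ((size l)%:R * Xi * M ^+ size l)
    (vfield (\prod_(j <- l) mX j)).
Proof.
have bl (s : seq 'I_d) : bounded (size s) (M ^+ size s) (\prod_(j <- s) mX j).
  rewrite -[\prod_(_ <- _) _]scale1r; apply: bounded_monom => //.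
  by rewrite normr1 mul1r.
elim: l => [|j l IH]; first by rewrite big_nil vfield1 !mul0r; exact: bounded0.
rewrite big_cons vfieldM vfieldX /=.
have -> : (size l).+1%:R * Xi * M ^+ (size l).+1 =
    Xi * M ^+ (size l).+1 + M * ((size l)%:R * Xi * M ^+ size l).
  by rewrite -natr1 exprS; ring.
apply: boundedD.
  apply: bounded_le (boundedM (xi_bounded j) (bl l)); first by lia.
  by rewrite ler_wpM2l// exprS ler_peMl// exprn_ge0.
by apply: bounded_le (boundedM (boundedX j) IH) => //; lia.
Qed.

Lemma bounded_vfield k a p :
  bounded k a p -> bounded (k + q) (k%:R * Xi * a) (vfield p).
Proof.
elim=> {k a p} [k a a0|k a c l lk ca|k a b p p' _ IHp _ IHp'].
- by rewrite linear0; apply: bounded0; rewrite !mulr_ge0.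
- rewrite linearZ /= -mpoly.mul_mpolyC.
  apply: bounded_le (boundedM (boundedC c) (bounded_vfield_monom l)).
    by rewrite add0n leq_add2r.
  rewrite [leLHS]mulrCA ler_pM ?mulr_ge0 ?exprn_ge0//.
  by rewrite ler_wpM2r// ler_nat.
- by rewrite linearD mulrDr; exact: boundedD.
Qed.

(** Each application multiplies the bound by the current degree times [Xi]. The degree [1 + n * q]
    is at most (q + 1)(n + 1), so the bounds grow like n! times a geometric sequence, and division
    by n! leaves a positive radius of convergence, uniform on the polydisc. *)
Lemma bounded_iter_vfield j n :
  bounded (1 + n * q) (M * ((q.+1)%:R * Xi) ^+ n * n`!%:R)
    (iter n vfield (mX j)).
Proof.
elim: n => [|n IH]; first by rewrite mulr1 mulr1; exact: boundedX.
rewrite iterS.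
apply: bounded_le (bounded_vfield IH) => //.
  by rewrite mulSn; lia.
rewrite factS natrM exprS.
have -> : M * (q.+1%:R * Xi * (q.+1%:R * Xi) ^+ n) * (n.+1%:R * n`!%:R) =
  (q.+1%:R * n.+1%:R) * Xi * (M * (q.+1%:R * Xi) ^+ n * n`!%:R) by ring.
rewrite ler_wpM2r// ?mulr_ge0 ?exprn_ge0 ?mulr_ge0//.
rewrite ler_wpM2r// -natrM ler_nat; nia.
Qed.

Lemma iter_vfieldM (p p' : mpol) n :
  iter n vfield (p * p') =
  \sum_(k < n.+1) iter k vfield p * iter (n - k) vfield p' *+ 'C(n, k).
Proof. by apply: (leibniz_iter (B := *%R)) => p1 p2; exact: vfieldM. Qed.

(** The Taylor coefficients of [p] along the integral curve of [xi] through [y]. *)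
Definition lie_coef (y : 'I_d -> C) (p : mpol) (n : nat) : C :=
  meval y (iter n vfield p) / n`!%:R.

Lemma lie_coefM y p p' : lie_coef y (p * p') =1 convol (lie_coef y p) (lie_coef y p').
Proof.
move=> n; rewrite /lie_coef iter_vfieldM raddf_sum mulr_suml; apply: eq_bigr => k _.
have kn : (k <= n)%N by rewrite -ltnS.
rewrite raddfMn /= rmorphM /= -[_ *+ 'C(n, k)]mulr_natr -(bin_fact kn) !natrM.
by field; rewrite !pnatr_eq0 -!lt0n !fact_gt0 bin_gt0 kn.
Qed.

Lemma lie_coefC y c n : lie_coef y (mpoly.mpolyC d c) n = if n is 0 then c else 0.
Proof.
rewrite /lie_coef; case: n => [|n]; first by rewrite mpoly.mevalC divr1.
rewrite iterSr vfieldC (_ : iter n vfield 0 = 0) ?raddf0 ?mul0r//.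
by elim: n => //= n ->; rewrite linear0.
Qed.

(** Half the inverse of the growth rate, so that the Lie series of a coordinate is dominated by [M]
    times the powers of 1/2; the added 1 covers [Xi = 0]. *)
Definition lie_radius : C := (2 * ((q.+1)%:R * Xi + 1))^-1.

Lemma lie_radius_gt0 : 0 < lie_radius.
Proof. by rewrite invr_gt0 mulr_gt0// ltr_wpDl// mulr_ge0. Qed.

(** The flow point [y'] is defined by summing the Lie series of the coordinates. As the derivation
    is multiplicative on Taylor coefficients ([lie_coefM]), Cauchy products extend the formula to
    every polynomial. *)
Theorem lie_flow (y : 'I_d -> C) t :
  (forall j, `|y j| <= M) -> `|t| <= lie_radius ->
  exists y' : 'I_d -> C, forall p,
    abs_sum (fun n => lie_coef y p n * t ^+ n) (meval y' p).
Proof.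
move=> yM tr; pose c := q.+1%:R * Xi + 1.
have c0 : 0 < c by rewrite ltr_wpDl// mulr_ge0.
have Xabs j : exists s, abs_sum (fun n => lie_coef y (mX j) n * t ^+ n) s.
  apply: (complete (B := M * 2)) => N.
  rewrite (@le_trans _ _ (\sum_(n < N) M * 2^-1 ^+ n))//.
    apply: ler_sum => n _; rewrite /lie_coef !normrM normrX normfV normr_nat.
    rewrite mulrAC ler_pdivrMr ?ltr0n ?fact_gt0//.
    have /(bounded_eval yM) := bounded_iter_vfield j n.
    move=> /(ler_wpM2r _)/le_trans -> //; rewrite ?exprn_ge0//.
    rewrite mulrAC ler_wpM2r// -mulrA ler_wpM2l// -exprMn.
    rewrite lerXn2r ?nnegrE ?mulr_ge0 ?invr_ge0//.
    rewrite (le_trans (ler_wpM2l _ tr)) ?mulr_ge0//.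
    rewrite /lie_radius -/c invfM mulrCA ler_piMr ?invr_ge0//.
    by rewrite ler_pdivrMr// mul1r lerDl.
  rewrite -mulr_sumr ler_wpM2l//.
  have h0 : 0 < 2^-1 :> C by rewrite invr_gt0.
  (* The exact value of the geometric sum, in a form fit for induction. *)
  rewrite (@le_trans _ _ (2 - 2 * 2^-1 ^+ N))//; last first.
    by rewrite gerBl mulr_ge0// exprn_ge0// ltW.
  elim: N => [|N IH]; first by rewrite big_ord0 expr0 mulr1 subrr.
  rewrite big_ord_recr /= exprS mulVKf ?pnatr_eq0//.
  rewrite (le_trans (lerD IH (lexx _)))// le_eqVlt; apply/orP; left; apply/eqP.
  by ring.
pose y' j := sval (cid (Xabs j)).
have y'P j : abs_sum (fun n => lie_coef y (mX j) n * t ^+ n) (y' j).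
  by rewrite /y'; case: cid.
exists y' => p.
pose S := fun p => abs_sum (fun n => lie_coef y p n * t ^+ n) (meval y' p).
have SC a : S (mpoly.mpolyC d a).
  have := @abs_sum_finite _ (fun n => lie_coef y (mpoly.mpolyC d a) n * t ^+ n) 1.
  rewrite big_ord1 lie_coefC expr0 mulr1 /S mpoly.mevalC; apply.
  by case=> // n _; rewrite lie_coefC mul0r.
have SM p1 p2 : S p1 -> S p2 -> S (p1 * p2).
  move=> S1 S2; rewrite /S rmorphM /=.
  have := abs_sumM complete S1 S2; congr abs_sum; apply/funext => n.
  rewrite lie_coefM /convol mulr_suml; apply: eq_bigr => k _.
  by rewrite mulrACA -exprD subnKC// -ltnS.
have SD p1 p2 : S p1 -> S p2 -> S (p1 + p2).
  move=> S1 S2; rewrite /S raddfD /=.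
  have := abs_sumD S1 S2; congr abs_sum; apply/funext => n.
  rewrite -mulrDl /lie_coef -mulrDl -raddfD; congr (meval _ _ / _ * _).
  by elim: n => //= n <-; rewrite linearD.
elim/mpoly.mpolyind : p => [|a m p _ _ Sp].
  by have := SC 0; rewrite /S mpoly.mpolyC0.
apply: SD => //; rewrite -mpoly.mul_mpolyC; apply: (SM); first exact: SC.
rewrite mpoly.mpolyXE_id; elim/big_ind : _ => [||i _]; [exact: (SC 1)|exact: SM|].
set e := (X in _ ^+ X); elim: e => [|e IH]; first by rewrite expr0; exact: (SC 1).
by rewrite exprS; apply: (SM) => //; rewrite /S mpoly.mevalXU.
Qed.

End LieSeries.

(** * Vector fields tangent to bounded level sets *)

Section BoundedLevelSets.
Variables (C : numClosedFieldType) (d : nat).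
Local Notation mpol := (mpoly.mpoly d C).
Local Notation mX j := (mpoly.mpolyX C (mpoly.mnm1 j)).
Local Notation meval := mpoly.meval.
Hypothesis complete : sum_complete C.

Lemma family_bounded M (xi : 'I_d -> mpol) : 1 <= M ->
  exists q Xi, 0 <= Xi /\ forall j, bounded M q Xi (xi j).
Proof.
move=> M1; have M0 : 0 <= M by rewrite (le_trans ler01).
have qX j : exists qa : nat * C, bounded M qa.1 qa.2 (xi j).
  by have [q [a b]] := bounded_ex M1 (xi j); exists (q, a).
have /choice[g gP] := qX.
have g0 j : 0 <= (g j).2 by exact: bounded_ge0 (gP j).
exists (\sum_j (g j).1), (\sum_j (g j).2); split; first exact: sumr_ge0.
move=> j; apply: bounded_le (gP j) => //.
  by rewrite (bigD1 j)//= leq_addr.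
by rewrite (bigD1 j)//= lerDl sumr_ge0.
Qed.

Lemma lie_flow_ex M (xi : 'I_d -> mpol) : 1 <= M ->
  exists2 rho : C, 0 < rho & forall (y : 'I_d -> C) t,
    (forall j, `|y j| <= M) -> `|t| <= rho ->
    exists y' : 'I_d -> C, forall p,
      abs_sum (fun n => lie_coef xi y p n * t ^+ n) (meval y' p).
Proof.
move=> M1; have [q [Xi [Xi0 b]]] := family_bounded xi M1.
exists (lie_radius q Xi); first exact: lie_radius_gt0.
by move=> y t; exact: (lie_flow complete M1 Xi0 b).
Qed.

(** Along every flow line [p] is the zero function, so all its Taylor coefficients vanish by
    [maximum_modulus]. This passes from the pointwise vanishing of one derivative of an invariant to
    that of all higher ones. *)
Lemma iter_vfield_vanish (xi : 'I_d -> mpol) (p : mpol) :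
  (forall y, meval y p = 0) ->
  forall n y, meval y (iter n (vfield xi) p) = 0.
Proof.
move=> p0 [|n] y; first exact: p0.
pose M := 1 + \sum_j `|y j|.
have M1 : 1 <= M by rewrite lerDl sumr_ge0.
have yM j : `|y j| <= M.
  by rewrite /M (bigD1 j)//= addrCA lerDl addr_ge0// sumr_ge0.
have [rho rho0 flow] := lie_flow_ex xi M1.
have ps : power_series rho (lie_coef xi y p) (fun=> 0).
  by move=> t /(flow _ _ yM)[y' /(_ p)]; rewrite p0.
have fa (t : C) : `|t| <= rho -> `|0 : C| <= `|lie_coef xi y p 0%N|.
  by rewrite normr0.
have /eqP := maximum_modulus rho0 ps fa n.
rewrite /lie_coef mulf_eq0 invr_eq0 pnatr_eq0.
by rewrite -[_`! == 0%N]negbK -lt0n fact_gt0 orbF => /eqP.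
Qed.

Lemma lie_coef0 xi (y : 'I_d -> C) p : lie_coef xi y p 0 = meval y p.
Proof. by rewrite /lie_coef /= fact0 divr1. Qed.

Lemma lie_coef1 xi (y : 'I_d -> C) p : lie_coef xi y p 1 = meval y (vfield xi p).
Proof. by rewrite /lie_coef /= divr1. Qed.

(* At a point of a bounded common level set where [|xi j0|] is maximal, the maximum
   principle makes [xi j0] constant along the flow, so the [j0]-th coordinate grows
   linearly inside the level set. *)
Lemma bounded_level_vfield0 (I : Type) (cs : I -> mpol) (b : I -> C)
    (xi : 'I_d -> mpol) (M : C) (j0 : 'I_d) (y1 : 'I_d -> C) :
  (forall x : C, exists n : nat, `|x| <= n%:R) ->
  (forall i y, meval y (vfield xi (cs i)) = 0) ->
  (forall y, (forall i, meval y (cs i) = b i) -> forall j, `|y j| <= M) ->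
  (forall i, meval y1 (cs i) = b i) ->
  (forall y, (forall i, meval y (cs i) = b i) ->
     `|meval y (xi j0)| <= `|meval y1 (xi j0)|) ->
  meval y1 (xi j0) = 0.
Proof.
move=> arch cs0 FM Fy1 maxy1; set v := meval y1 (xi j0).
have M0 : 0 <= M by exact: le_trans (FM _ Fy1 j0).
have M1 : 1 <= 1 + M by rewrite lerDl.
have [rho rho0 flow] := lie_flow_ex xi M1.
have cs0n i n y : meval y (iter n.+1 (vfield xi) (cs i)) = 0.
  by rewrite iterSr iter_vfield_vanish.
(* The value [v] itself is prescribed, not merely its modulus: the flow for time [rho] then
   preserves this set and shifts the [j0]-th coordinate by exactly [rho * v]. *)
pose F1 y := (forall i, meval y (cs i) = b i) /\ meval y (xi j0) = v.
have step y : F1 y -> exists2 y', F1 y' & y' j0 = y j0 + rho * v.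
  move=> [Fy vy].
  have yM j : `|y j| <= 1 + M by rewrite ler_wpDl// FM.
  have stay t y' : (forall p, abs_sum (fun n => lie_coef xi y p n * t ^+ n)
      (meval y' p)) -> forall i, meval y' (cs i) = b i.
    move=> fl i; have := fl (cs i).
    have := @abs_sum_finite _ (fun n => lie_coef xi y (cs i) n * t ^+ n) 1.
    rewrite big_ord1 lie_coef0 expr0 mulr1 Fy => fin.
    move=> /abs_sum_unique; apply; apply: fin.
    by case=> // n _; rewrite /lie_coef cs0n mul0r mul0r.
  (* The value of [xi j0] along the flow, with default 0 where no flow point exists, which does not
     happen for [|t| <= rho]. *)
  pose f t := if pselect (exists y' : 'I_d -> C, forall p,
      abs_sum (fun n => lie_coef xi y p n * t ^+ n) (meval y' p))
    is left H then meval (sval (cid H)) (xi j0) else 0.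
  have fP t : `|t| <= rho ->
      abs_sum (fun n => lie_coef xi y (xi j0) n * t ^+ n) (f t) /\
      `|f t| <= `|v|.
    move=> trho; rewrite /f; case: pselect => [H|]; last by case; exact: flow.
    case: cid => y' /= fl; split; first exact: fl.
    exact/maxy1/stay/fl.
  have coef0 n : lie_coef xi y (xi j0) n.+1 = 0.
    apply: (maximum_modulus rho0 (f := f)) => [t /fP[]//|t /fP[_]].
    by rewrite lie_coef0 vy.
  have rr : `|rho| <= rho by rewrite gtr0_norm.
  have [y' fl] := flow y rho yM rr; exists y'.
    split; first exact: stay fl.
    have := @abs_sum_finite _ (fun n => lie_coef xi y (xi j0) n * rho ^+ n) 1.
    rewrite big_ord1 lie_coef0 expr0 mulr1 vy => fin.
    have /abs_sum_unique := fl (xi j0); apply; apply: fin.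
    by case=> // n _; rewrite coef0 mul0r.
  have := @abs_sum_finite _ (fun n => lie_coef xi y (mX j0) n * rho ^+ n) 2.
  rewrite !big_ord_recl big_ord0 addr0 /=.
  rewrite lie_coef0 lie_coef1 vfieldX mpoly.mevalXU vy mulr1 expr1 [v * rho]mulrC => fin.
  have := fl (mX j0); rewrite mpoly.mevalXU => /abs_sum_unique; apply.
  apply: fin.
  case=> [|[|n]]// _; have := coef0 n; rewrite /lie_coef => /eqP.
  rewrite mulf_eq0 invr_eq0 pnatr_eq0 -[_`! == 0%N]negbK -lt0n fact_gt0 orbF.
  by rewrite !iterSr vfieldX => /eqP ->; rewrite !mul0r.
have far n : exists2 y, F1 y & y j0 = y1 j0 + n%:R * (rho * v).
  elim: n => [|n [y Fy yj]]; first by exists y1; rewrite ?mul0r ?addr0.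
  have [y' Fy' y'j] := step y Fy; exists y' => //.
  by rewrite y'j yj -natr1 mulrDl mul1r addrA.
apply/eqP/negPn/negP => v0.
(* Enough steps to travel farther than [M + M], the largest distance possible between coordinates of
   norm at most [M]. *)
have [n nM] := arch ((M + M + 1) / (rho * `|v|)).
have rv : 0 < rho * `|v| by rewrite mulr_gt0// normr_gt0.
have [y [Fy _] yj] := far n.
have : `|n%:R * (rho * v)| <= M + M.
  rewrite -[n%:R * _](addKr (y1 j0)) -yj addrC.
  by rewrite (le_trans (ler_normB _ _))// lerD// FM.
rewrite normrM normr_nat normrM (gtr0_norm rho0).
move: nM; rewrite [X in X <= _]ger0_norm; last by rewrite divr_ge0 ?addr_ge0 ?(ltW rv).
rewrite ler_pdivrMr// => /le_trans/[apply].
by rewrite gerDl ler10.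
Qed.

End BoundedLevelSets.

(** * Polynomial functions *)

Section PolynomialFunctions.
Variables (F : fieldType) (d : nat).
Local Notation mpol := (mpoly.mpoly d F).

(** Only the existence of a polynomial is recorded, so determinants, adjugates and traces are
    handled through closure properties. *)
Definition polyfun (phi : ('I_d -> F) -> F) : Prop :=
  exists p : mpol, forall y, phi y = mpoly.meval y p.

Lemma polyfun_cst c : polyfun (fun=> c).
Proof. by exists (mpoly.mpolyC d c) => y; rewrite mpoly.mevalC. Qed.

Lemma polyfun_coord j : polyfun (fun y => y j).
Proof. by exists (mpoly.mpolyX F (mpoly.mnm1 j)) => y; rewrite mpoly.mevalXU. Qed.

Lemma polyfunD phi psi : polyfun phi -> polyfun psi -> polyfun (fun y => phi y + psi y).
Proof. by move=> [p hp] [q hq]; exists (p + q) => y; rewrite raddfD /= hp hq. Qed.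

Lemma polyfunM phi psi : polyfun phi -> polyfun psi -> polyfun (fun y => phi y * psi y).
Proof. by move=> [p hp] [q hq]; exists (p * q) => y; rewrite rmorphM /= hp hq. Qed.

Lemma polyfunZ c phi : polyfun phi -> polyfun (fun y => c * phi y).
Proof. by apply: polyfunM; exact: polyfun_cst. Qed.

Lemma polyfun_ext phi psi : phi =1 psi -> polyfun phi -> polyfun psi.
Proof. by move=> e [p hp]; exists p => y; rewrite -e hp. Qed.

Lemma polyfun_sum (I : Type) (r : seq I) (P : pred I) phi :
  (forall i, polyfun (phi i)) -> polyfun (fun y => \sum_(i <- r | P i) phi i y).
Proof.
move=> h; elim: r => [|i r IH].
  by apply: polyfun_ext (polyfun_cst 0) => y; rewrite big_nil.
apply: (@polyfun_ext (fun y => (if P i then phi i y else 0) +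
    \sum_(i <- r | P i) phi i y)).
  by move=> y; rewrite big_cons; case: ifP; rewrite ?add0r.
by apply: polyfunD => //; case: (P i) => //; exact: polyfun_cst.
Qed.

Lemma polyfun_prod (I : Type) (r : seq I) (P : pred I) phi :
  (forall i, polyfun (phi i)) -> polyfun (fun y => \prod_(i <- r | P i) phi i y).
Proof.
move=> h; elim: r => [|i r IH].
  by apply: polyfun_ext (polyfun_cst 1) => y; rewrite big_nil.
apply: (@polyfun_ext (fun y => (if P i then phi i y else 1) *
    \prod_(i <- r | P i) phi i y)).
  by move=> y; rewrite big_cons; case: ifP; rewrite ?mul1r.
by apply: polyfunM => //; case: (P i) => //; exact: polyfun_cst.
Qed.

Definition polymx m n (A : ('I_d -> F) -> 'M[F]_(m, n)) : Prop :=
  forall i j, polyfun (fun y => A y i j).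

Lemma polymx_cst m n (A : 'M_(m, n)) : polymx (fun=> A).
Proof. by move=> i j; exact: polyfun_cst. Qed.

Lemma polymxD m n (A B : _ -> 'M_(m, n)) :
  polymx A -> polymx B -> polymx (fun y => A y + B y).
Proof.
move=> hA hB i j; apply: polyfun_ext (polyfunD (hA i j) (hB i j)) => y.
by rewrite mxE.
Qed.

Lemma polymxM m n p (A : _ -> 'M_(m, n)) (B : _ -> 'M_(n, p)) :
  polymx A -> polymx B -> polymx (fun y => A y *m B y).
Proof.
move=> hA hB i j; apply: polyfun_ext; last first.
  apply: (@polyfun_sum _ (index_enum 'I_n) xpredT) => k.
  exact: polyfunM (hA i k) (hB k j).
by move=> y; rewrite mxE.
Qed.

Lemma polymxZ m n phi (A : _ -> 'M_(m, n)) :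
  polyfun phi -> polymx A -> polymx (fun y => phi y *: A y).
Proof.
move=> hp hA i j; apply: polyfun_ext (polyfunM hp (hA i j)) => y.
by rewrite mxE.
Qed.

Lemma polymx_sum (I : Type) (r : seq I) m n (A : I -> _ -> 'M_(m, n)) :
  (forall i, polymx (A i)) -> polymx (fun y => \sum_(i <- r) A i y).
Proof.
move=> h i j; apply: polyfun_ext; last first.
  by apply: (@polyfun_sum _ r xpredT) => k; exact: (h k i j).
by move=> y; rewrite summxE.
Qed.

Lemma polyfun_det n (A : _ -> 'M_n) : polymx A -> polyfun (fun y => \det (A y)).
Proof.
move=> hA; apply: polyfun_sum => s; apply: polyfunZ.
by apply: polyfun_prod => i; exact: hA.
Qed.

Lemma polyfun_trace n (A : _ -> 'M_n) : polymx A -> polyfun (fun y => \tr (A y)).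
Proof. by move=> hA; apply: polyfun_sum => i; exact: hA. Qed.

Lemma polymx_adj n (A : _ -> 'M_n) : polymx A -> polymx (fun y => \adj (A y)).
Proof.
move=> hA i j; apply: (@polyfun_ext (fun y => cofactor (A y) j i)).
  by move=> y; rewrite mxE.
apply: polyfunZ; apply: polyfun_det => k l.
by apply: polyfun_ext (hA (lift j k) (lift i l)) => y; rewrite !mxE.
Qed.

Lemma polymxX n (A : _ -> 'M_n) k : polymx A -> polymx (fun y => A y ^+ k).
Proof.
move=> hA; elim: k => [|k IH]; first exact: polymx_cst.
move=> i j; apply: polyfun_ext (polymxM hA IH i j) => y.
by rewrite exprS.
Qed.
End PolynomialFunctions.

Section PolynomialContinuity.
Variables (C : numFieldType) (d : nat).

Lemma cvg_sum_seq (I : Type) (r : seq I) (u : I -> nat -> C) (l : I -> C) :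
  (forall i, u i @ \oo --> l i) ->
  (fun n => \sum_(i <- r) u i n) @ \oo --> \sum_(i <- r) l i.
Proof.
move=> ul; elim: r => [|i r IH].
  by under eq_fun do rewrite big_nil; rewrite big_nil; exact: cvg_cst.
rewrite big_cons (_ : (fun n => _) =
    (u i) + (fun n => \sum_(i <- r) u i n)); first exact: cvgD.
by apply/funext => n; rewrite big_cons.
Qed.

Lemma cvg_polyfun (T : Type) (G : set_system T) {GG : Filter G}
    (phi : ('I_d -> C) -> C) (u : T -> 'I_d -> C) (l : 'I_d -> C) :
  polyfun phi -> (forall j, (fun n => u n j) @ G --> l j) ->
  (fun n => phi (u n)) @ G --> phi l.
Proof.
move=> [p hp] ul; rewrite hp (_ : (fun n => _) = fun n => mpoly.meval (u n) p); last first.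
  by apply/funext => n.
pose S p := (fun n => mpoly.meval (u n) p) @ G --> mpoly.meval l p.
have SC a : S (mpoly.mpolyC d a).
  rewrite /S mpoly.mevalC; under eq_fun do rewrite mpoly.mevalC.
  exact: cvg_cst.
have SM p1 p2 : S p1 -> S p2 -> S (p1 * p2).
  move=> S1 S2; rewrite /S rmorphM /= (_ : (fun n => _) =
    (fun n => mpoly.meval (u n) p1) * (fun n => mpoly.meval (u n) p2)).
    exact: cvgM.
  by apply/funext => n; rewrite rmorphM.
have SD p1 p2 : S p1 -> S p2 -> S (p1 + p2).
  move=> S1 S2; rewrite /S raddfD /= (_ : (fun n => _) =
    (fun n => mpoly.meval (u n) p1) + (fun n => mpoly.meval (u n) p2)).
    exact: cvgD.
  by apply/funext => n; rewrite raddfD.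
rewrite -/(S p); elim/mpoly.mpolyind : {phi hp} p => [|a m p _ _ Sp].
  by have := SC 0; rewrite mpoly.mpolyC0.
apply: (SD) => //; rewrite -mpoly.mul_mpolyC; apply: (SM); first exact: SC.
rewrite mpoly.mpolyXE_id; elim/big_ind : _ => [||i _]; [exact: (SC 1)|exact: SM|].
set e := (X in _ ^+ X); elim: e => [|e IH]; first by rewrite expr0; exact: (SC 1).
rewrite exprS; apply: (SM) => //; rewrite /S mpoly.mevalXU.
by under eq_fun do rewrite mpoly.mevalXU; exact: ul.
Qed.

Lemma cvg_eventually_neq0 (u : nat -> C) l :
  u @ \oo --> l -> l != 0 -> exists N, forall n, (N <= n)%N -> u n != 0.
Proof.
move=> /cvgrPdist_lt ul l0; have l0' : 0 < `|l| by rewrite normr_gt0.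
have [N _ uN] := ul _ l0'; exists N => n /uN /=.
by apply: contraTneq => ->; rewrite subr0 ltxx.
Qed.

Lemma cvg_zero (u : nat -> C) l : u @ \oo --> l -> (forall n, u n = 0) -> l = 0.
Proof.
move=> ul u0; apply/eqP/negPn/negP => /(cvg_eventually_neq0 ul)[N /(_ N)].
by rewrite u0 eqxx => /(_ (leqnn N)).
Qed.
End PolynomialContinuity.

Lemma sum_completeC (R : realType) : sum_complete (R[i] : numFieldType).
Proof. by move=> u B; exact: abs_bounded_sum. Qed.

Lemma cvg_rV (K : numFieldType) n (u : nat -> 'rV[K]_n) (l : 'rV[K]_n) :
  (forall j, (fun k => u k 0 j) @ \oo --> l 0 j) -> u @ \oo --> l.
Proof.
move=> ul; apply/cvg_ballP => e e0.
have : \forall k \near \oo, forall j, ball (l 0 j) e (u k 0 j).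
  by apply: filter_forall => j; move/cvg_ballP : (ul j) => /(_ e e0).
by apply: filterS => k H; split => // i j; rewrite ord1.
Qed.

Lemma limn_rV (K : numFieldType) n (u : nat -> 'rV[K]_n) (l : 'rV[K]_n) :
  (forall j, (fun k => u k 0 j) @ \oo --> l 0 j) -> limn u = l.
Proof. by move=> /cvg_rV ul; apply: cvg_lim => //; exact: norm_hausdorff. Qed.

(** * Exponentials of endomorphisms *)

Section VectorCoordinates.
Variables (F : fieldType) (V : vectType F).

Definition vcoord (j : 'I_(\dim {:V})) (v : V) : F := coord (vbasis {:V}) j v.

Lemma vcoord_is_linear j : linear_for *%R (vcoord j).
Proof. by move=> a x y; rewrite /vcoord linearP. Qed.
HB.instance Definition _ j := GRing.isLinear.Build F V F *%R (vcoord j) (vcoord_is_linear j).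

Lemma vcoordD j (v w : V) : vcoord j (v + w) = vcoord j v + vcoord j w.
Proof. exact: linearD. Qed.
Lemma vcoordN j (v : V) : vcoord j (- v) = - vcoord j v.
Proof. exact: linearN. Qed.
Lemma vcoord0 j : vcoord j (0 : V) = 0.
Proof. exact: linear0. Qed.
Lemma vcoordZ j a (v : V) : vcoord j (a *: v) = a * vcoord j v.
Proof. exact: scalarZ. Qed.

Lemma vcoord_sum v : v = \sum_j vcoord j v *: (vbasis {:V})`_j.
Proof. exact: coord_vbasis (memvf v). Qed.

Lemma scalar_vcoord (ell : {scalar V}) v :
  ell v = \sum_j vcoord j v * ell (vbasis {:V})`_j.
Proof.
rewrite {1}[v]vcoord_sum linear_sum; apply: eq_bigr => j _.
by rewrite scalarZ.
Qed.

Lemma vcoordP (v w : V) : (forall j, vcoord j v = vcoord j w) -> v = w.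
Proof.
by move=> h; rewrite [v]vcoord_sum [w]vcoord_sum; apply: eq_bigr => j _; rewrite h.
Qed.
End VectorCoordinates.

Section Exponential.
Variable R : realType.
Local Notation C := (R[i] : numFieldType).

Lemma exp_series_bounded (K : C) : 0 <= K ->
  exists B : C, forall n, \sum_(k < n) K ^+ k / k`!%:R <= B.
Proof.
move=> K0; have KE : K = (complex.Re K)%:C%C by rewrite RRe_real// ger0_real.
have K0' : 0 <= complex.Re K by rewrite -ler0c -KE.
exists (expR (complex.Re K))%:C%C => n.
rewrite KE (_ : \sum_(_ < _) _ =
    (\sum_(k < n) exp_coeff (complex.Re K) k)%:C%C); last first.
  rewrite rmorph_sum; apply: eq_bigr => k _.
  by rewrite /exp_coeff /= rmorphM rmorphXn fmorphV rmorph_nat.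
rewrite lecR -(big_mkord xpredT) -/(series _ _).
apply: nondecreasing_cvgn_le; last exact: is_cvg_series_exp_coeff.
apply: nondecreasing_series => k _ _.
by rewrite /exp_coeff /= divr_ge0 ?exprn_ge0.
Qed.

Lemma iter_linear_bound (W : vectType R[i]) (T : W -> W) (ell : {scalar W}) w :
  linear T ->
  exists A K : C, [/\ 0 <= A, 0 <= K & forall k, `|ell (iter k T w)| <= A * K ^+ k].
Proof.
move=> lT.
pose T' : {linear W -> W} := HB.pack T (GRing.isLinear.Build _ _ _ _ T lT).
pose N (v : W) : C := \sum_j `|vcoord j v|.
pose K : C := \sum_(i < \dim {:W}) \sum_j `|vcoord j (T (vbasis {:W})`_i)|.
pose L : C := \sum_(j < \dim {:W}) `|ell (vbasis {:W})`_j|.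
have N0 v : 0 <= N v by apply: sumr_ge0.
have K0 : 0 <= K by apply: sumr_ge0 => i _; apply: sumr_ge0.
have le1 (I : finType) (f : I -> C) j : (forall i, 0 <= f i) -> f j <= \sum_i f i.
  by move=> f0; rewrite (bigD1 j)//= lerDl sumr_ge0.
have NT v : N (T v) <= K * N v.
  rewrite /N /K exchange_big /= mulr_suml ler_sum// => j _.
  rewrite {1}[v]vcoord_sum -[T _]/(T' _) !linear_sum.
  rewrite (le_trans (ler_norm_sum _ _ _))// mulr_suml ler_sum// => i _.
  rewrite linearZ scalarZ normrM mulrC ler_wpM2l//.
  by apply: (le1 _ (fun i => `|vcoord i v|)).
have Nell v : `|ell v| <= L * N v.
  rewrite (scalar_vcoord ell v) (le_trans (ler_norm_sum _ _ _))// /L mulr_suml.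
  rewrite ler_sum// => j _; rewrite normrM mulrC ler_wpM2l//.
  by apply: (le1 _ (fun i => `|vcoord i v|)).
have L0 : 0 <= L by apply: sumr_ge0.
exists (L * N w), K; split => //; first exact: mulr_ge0.
move=> k; rewrite (le_trans (Nell _))// -mulrA ler_wpM2l//.
elim: k => [|k IH]; first by rewrite expr0 mulr1.
by rewrite iterS (le_trans (NT _))// exprS mulrCA ler_wpM2l// mulrC.
Qed.

Lemma iter_linear_abs_sum (W : vectType R[i]) (T : W -> W) (ell : {scalar W}) w :
  linear T -> exists s : C, abs_sum (fun k => ell (iter k T w) / k`!%:R) s.
Proof.
move=> lT; have [A [K [A0 K0 AK]]] := iter_linear_bound ell w lT.
have [B KB] := exp_series_bounded K0.
apply: (@sum_completeC R _ (A * B)) => n.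
rewrite (le_trans _ (ler_wpM2l A0 (KB n)))// mulr_sumr ler_sum// => k _.
by rewrite normrM normfV normr_nat mulrA ler_wpM2r// invr_ge0.
Qed.

Lemma vlim_scalar (W : vectType R[i]) (u : nat -> W) :
  (forall ell : {scalar W}, exists s : C, (fun n => ell (u n) : C) @ \oo --> s) ->
  forall ell : {scalar W}, (fun n => ell (u n) : C) @ \oo --> (ell (vlim u) : C).
Proof.
move=> ucvg.
have /choice[l ul] : forall j, exists s : C,
    (fun n => vcoord j (u n) : C) @ \oo --> s by move=> j; exact: ucvg.
have lE : limn (fun n => coords (u n)) = \row_j l j.
  apply: limn_rV => j; rewrite mxE.
  by under eq_fun do rewrite /coords mxE; exact: ul.
move=> ell; rewrite (scalar_vcoord ell) (_ : (fun n => _) =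
    fun n => \sum_j (vcoord j (u n) * ell (vbasis {:W})`_j : C)); last first.
  by apply/funext => n; exact: scalar_vcoord.
apply: cvg_sum_seq => j.
rewrite (_ : (fun n => _) = (fun n => vcoord j (u n) : C) *
   (fun=> ell (vbasis {:W})`_j : C)); last by apply/funext.
apply: cvgM; last exact: cvg_cst.
rewrite /vcoord /vlim lE coord_vecof ?mxE; first exact: ul.
exact: vbasisP.
Qed.

(** Tested against linear functionals, the exponential becomes a scalar series, to which the
    calculus of [abs_sum] applies. With its converse [lfun_expP], this is how exponentials are
    handled throughout. *)
Lemma lfun_exp_sum (V : vectType R[i]) (D : 'End(V)) (v : V) (ell : {scalar V}) :
  abs_sum (fun k => ell (iter k D v) / k`!%:R : C) (ell (lfun_exp D v)).
Proof.
have [s Ds] := iter_linear_abs_sum ell v (@linearP _ _ _ _ D).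
have lT : linear (fun E : 'End(V) => (D \o E)%VF).
  by move=> a E E'; rewrite comp_lfunDr comp_lfunZr.
pose S (n : nat) : 'End(V) :=
  \sum_(k < n) (k`!%:R^-1 *: iter k (fun E => (D \o E)%VF) \1%VF).
have SE (lam : {scalar 'End(V)}) : (fun n => lam (S n) : C) =
    fun n => \sum_(k < n) (lam (iter k (fun E => (D \o E)%VF) \1%VF) / k`!%:R : C).
  apply/funext => n; rewrite /S linear_sum; apply: eq_bigr => k _.
  by rewrite scalarZ mulrC.
(* Evaluation at [v] followed by [ell] is a functional on ['End(V)], so the limit defining the
   exponential can be tested through it. *)
have evl : linear_for *%R (fun E : 'End(V) => ell (E v)).
  by move=> a E E'; rewrite lfunE /= lfunE /= linearP.
pose ev : {scalar 'End(V)} := HB.pack (fun E : 'End(V) => ell (E v))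
  (GRing.isLinear.Build _ _ _ _ (fun E : 'End(V) => ell (E v)) evl).
have iterE k : iter k (fun E => (D \o E)%VF) \1%VF v = iter k D v.
  elim: k => [|k IH]; first by rewrite /= lfunE.
  by rewrite !iterS lfunE /= IH.
have := @vlim_scalar _ S _ ev; rewrite SE => Sev.
have {Sev} Sev : (fun n => \sum_(k < n) (ell (iter k D v) / k`!%:R : C)) @ \oo
    --> (ell (lfun_exp D v) : C).
  rewrite (_ : (fun n => _) = fun n => \sum_(k < n)
      (ev (iter k (fun E => (D \o E)%VF) \1%VF) / k`!%:R : C)); last first.
    by apply/funext => n; apply: eq_bigr => k _ /=; rewrite iterE.
  apply: Sev => lam; rewrite SE.
  by have [t [_ ts]] := iter_linear_abs_sum lam \1%VF lT; exists t.
by split => //; case: Ds.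
Qed.
End Exponential.

(** * Identities for the exponential *)

Section ExponentialProperties.
Variable R : realType.
Local Notation C := (R[i] : numFieldType).

Lemma cexp_ex (z : C) : exists s : C, abs_sum (fun k => z ^+ k / k`!%:R) s.
Proof.
have [B zB] := exp_series_bounded (normr_ge0 z).
apply: (@sum_completeC R _ B) => n; rewrite (le_trans _ (zB n))// ler_sum// => k _.
by rewrite normrM normrX normfV normr_nat.
Qed.

Definition cexp (z : C) : C := sval (cid (cexp_ex z)).

Lemma cexp_sum z : abs_sum (fun k => z ^+ k / k`!%:R) (cexp z).
Proof. by rewrite /cexp; case: cid. Qed.

Lemma cexp_real (x : R) : cexp x%:C%C = (expR x)%:C%C.
Proof.
have [_ h] := cexp_sum x%:C%C.
have hx : (fun n => (\sum_(k < n) exp_coeff x k)%:C%C : C) @ \oo --> ((expR x)%:C%C : C).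
  apply: cvg_real_complex; rewrite (_ : (fun n => _) = series (exp_coeff x)).
    exact: is_cvg_series_exp_coeff.
  by apply/funext => n; rewrite /series /= big_mkord.
apply: (cvg_unique (@norm_hausdorff _ C) h).
rewrite (_ : (fun n => _) = (fun n => (\sum_(k < n) exp_coeff x k)%:C%C : C))//.
apply/funext => n; rewrite rmorph_sum; apply: eq_bigr => k _.
by rewrite /exp_coeff /= rmorphM rmorphXn fmorphV rmorph_nat.
Qed.

Lemma iterZ (V : vectType R[i]) (s : R[i]) (D : 'End(V)) v k :
  iter k (s *: D) v = s ^+ k *: iter k D v.
Proof.
elim: k => [|k IH]; first by rewrite expr0 scale1r.
by rewrite !iterS IH lfunE /= linearZ scalerA exprS.
Qed.

Lemma lfun_exp_scaled_sum (V : vectType R[i]) (D : 'End(V)) v t (ell : {scalar V}) :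
  abs_sum (fun k => ell (iter k D v) / k`!%:R * t ^+ k : C) (ell (lfun_exp (t *: D) v)).
Proof.
have := lfun_exp_sum (t *: D) v ell; congr abs_sum; apply/funext => k.
by rewrite iterZ scalarZ -mulrA mulrC.
Qed.

Lemma lfun_expP (V : vectType R[i]) (D : 'End(V)) v w :
  (forall ell : {scalar V}, abs_sum (fun k => ell (iter k D v) / k`!%:R : C) (ell w)) ->
  lfun_exp D v = w.
Proof.
move=> h; apply: vcoordP => j.
exact: abs_sum_unique (lfun_exp_sum D v (vcoord j)) (h (vcoord j)).
Qed.

Lemma lfun_exp_eigen (V : vectType R[i]) (D : 'End(V)) v a :
  D v = a *: v -> lfun_exp D v = cexp a *: v.
Proof.
move=> Dv; apply: lfun_expP => ell; rewrite scalarZ mulrC.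
have := abs_sumZ (ell v : C) (cexp_sum a); congr abs_sum; apply/funext => k.
rewrite (_ : iter k D v = a ^+ k *: v) ?scalarZ; first by rewrite mulrA [_ * ell v]mulrC.
elim: k => [|k IH]; first by rewrite expr0 scale1r.
by rewrite iterS IH linearZ /= Dv scalerA exprSr.
Qed.

Lemma lfun_exp0 (V : vectType R[i]) : lfun_exp (0 : 'End(V)) = \1%VF.
Proof.
apply/lfunP => v; apply: lfun_expP => ell; rewrite lfunE /=.
have := @abs_sum_finite _ (fun k => ell (iter k (0 : 'End(V)) v) / k`!%:R : C) 1.
rewrite big_ord1 /= fact0 divr1; apply=> -[//|n] _.
by rewrite iterS lfunE /= linear0 mul0r.
Qed.

Lemma lfun_exp_comm (V W : vectType R[i]) (D : 'End(V)) (E : 'End(W)) (T : 'Hom(V, W)) v :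
  (forall v, T (D v) = E (T v)) -> T (lfun_exp D v) = lfun_exp E (T v).
Proof.
move=> TD; apply/esym/lfun_expP => ell.
have lT : linear_for *%R (fun v => ell (T v)) by move=> a x y; rewrite !linearP.
pose ell' : {scalar V} := HB.pack (fun v => ell (T v))
  (GRing.isLinear.Build _ _ _ _ (fun v => ell (T v)) lT).
have := lfun_exp_sum D v ell'; congr abs_sum; apply/funext => k /=.
by congr (ell _ / _); elim: k => //= k IH; rewrite TD IH.
Qed.

Lemma iter_sumZ (V : vectType R[i]) (D : 'End(V)) (I : Type) (r : seq I)
    (c : I -> R[i]) (w : I -> V) k :
  iter k D (\sum_(i <- r) c i *: w i) = \sum_(i <- r) c i *: iter k D (w i).
Proof.
elim: k => //= k ->; rewrite linear_sum; apply: eq_bigr => i _.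
by rewrite linearZ.
Qed.

Lemma lfun_expD (V : vectType R[i]) (D : 'End(V)) (s t : C) :
  (lfun_exp (s *: D) \o lfun_exp (t *: D))%VF = lfun_exp ((s + t) *: D).
Proof.
apply/lfunP => v; rewrite lfunE /=; apply/esym/lfun_expP => ell.
(* Expanding the inner exponential in the basis turns the composite into a finite sum of products of
   scalar series. *)
rewrite [X in ell (_ X)]vcoord_sum linear_sum linear_sum.
have h (j : 'I_(\dim {:V})) := abs_sumM (@sum_completeC R)
  (lfun_exp_scaled_sum D (vbasis {:V})`_j s ell)
  (lfun_exp_scaled_sum D v t (vcoord j)).
have := abs_sum_sum (index_enum 'I_(\dim {:V})) h.
congr abs_sum; last by apply: eq_bigr => j _; rewrite linearZ scalarZ mulrC.
apply/funext => n; rewrite iterZ scalarZ /convol exchange_big /= addrC exprDn.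
rewrite !mulr_suml; apply: eq_bigr => k _.
have kn : (k <= n)%N by rewrite -ltnS.
have -> : iter n D v = iter k D (iter (n - k) D v) by rewrite -iterD subnKC.
have -> : ell (iter k D (iter (n - k) D v)) =
    \sum_j vcoord j (iter (n - k) D v) * ell (iter k D (vbasis {:V})`_j).
  rewrite [X in iter k D X]vcoord_sum.
  rewrite iter_sumZ.
  by rewrite linear_sum; apply: eq_bigr => j _; rewrite scalarZ.
rewrite mulr_sumr mulr_suml; apply: eq_bigr => j _.
rewrite -[_ *+ 'C(n, k)]mulr_natr -(bin_fact kn) !natrM.
by field; rewrite !pnatr_eq0 -!lt0n !fact_gt0 bin_gt0 kn.
Qed.

Lemma conjc_abs_sum (u : nat -> C) (s : C) :
  abs_sum u s -> abs_sum (fun n => (u n)^*%C : C) (s^*%C : C).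
Proof.
move=> [[B uB] us]; split.
  by exists B => n; under eq_bigr do rewrite normcJ.
have /cvg_complexP[ur ui] := us; apply/cvg_complexP; split.
  have <- : (fun n => complex.Re (\sum_(k < n) u k)) =
      (fun n => complex.Re (\sum_(k < n) (u k)^*%C)).
    apply/funext => n; rewrite Re_sum (Re_sum n (fun k => (u k)^*%C)); apply: eq_bigr => k _.
    by case: (u k).
  by case: (s) ur.
have <- : (fun n => - complex.Im (\sum_(k < n) u k)) =
    (fun n => complex.Im (\sum_(k < n) (u k)^*%C)).
  apply/funext => n; rewrite Im_sum (Im_sum n (fun k => (u k)^*%C)) -sumrN; apply: eq_bigr => k _.
  by case: (u k).
have -> : complex.Im s^*%C = - complex.Im s by case: (s).
exact: cvgN.
Qed.

(** The conjugate of [ell] composed with [T] is linear, and the coefficients 1/k! are real. It makes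
    the adjoint group of a real form commute with the conjugation. *)
Lemma lfun_exp_antilinear (V : vectType R[i]) (D : 'End(V)) (T : V -> V) v :
  (forall a x y, T (a *: x + y) = a^*%C *: T x + T y) ->
  (forall v, T (D v) = D (T v)) -> T (lfun_exp D v) = lfun_exp D (T v).
Proof.
move=> aT TD; apply/esym/lfun_expP => ell.
have lT : linear_for *%R (fun v => (ell (T v))^*%C).
  by move=> a x y; rewrite aT linearP /= rmorphD rmorphM /= conjcK.
pose ell' : {scalar V} := HB.pack (fun v => (ell (T v))^*%C)
  (GRing.isLinear.Build _ _ _ _ (fun v => (ell (T v))^*%C) lT).
have := conjc_abs_sum (lfun_exp_sum D v ell'); rewrite /= conjcK.
congr abs_sum; apply/funext => k /=.
rewrite rmorphM fmorphV /= conjcK conjc_nat; congr (ell _ / _).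
by elim: k => //= k IH; rewrite TD IH.
Qed.

(** Differentiation at 0: [taylor_bound] of order 2 gives |D v| t <= M t^2 in each coordinate, which
    fails for a small real t unless that coordinate is zero. *)
Lemma lfun_exp_deriv0 (V : vectType R[i]) (D : 'End(V)) v :
  (forall t : R, lfun_exp (t%:C%C *: D) v = v) -> D v = 0.
Proof.
move=> Dv; apply: vcoordP => j; rewrite linear0.
pose f t := vcoord j (lfun_exp (t *: D) v).
have ps : power_series (1 : C) (fun k => vcoord j (iter k D v) / k`!%:R : C) f.
  by move=> t _; exact: lfun_exp_scaled_sum.
have [M M0 tb] := taylor_bound 2 ltr01 ps.
have [//|Dv0] := eqVneq (vcoord j (D v)) 0.
pose a := `|vcoord j (D v)|; have a0 : 0 < a by rewrite normr_gt0.
have Ma : 0 < M + a by rewrite ltr_wpDl.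
pose t := a / (2 * (M + a)).
have t0 : 0 < t by rewrite divr_gt0// mulr_gt0.
have t1 : t <= 1.
  rewrite ler_pdivrMr ?mulr_gt0// mul1r mulrDr (le_trans (y := 2 * a))//.
    by rewrite mulr_natl mulr2n lerDl ltW.
  by rewrite lerDr mulr_ge0.
have tR : t = (complex.Re t)%:C%C by rewrite RRe_real// gtr0_real.
have := tb t; rewrite gtr0_norm// => /(_ t1).
rewrite /f {1}tR Dv !big_ord_recl big_ord0 /= expr0 expr1 !divr1 mulr1 addr0.
rewrite opprD addrA subrr add0r normrN normrM -/a (gtr0_norm t0).
rewrite expr2 [M * (_ * _)]mulrA ler_pM2r// => aM.
have Mt : M * t < a.
  have -> : M * t = a * (M / (2 * (M + a))) by rewrite /t; ring.
  rewrite gtr_pMr// ltr_pdivrMr ?mulr_gt0// mul1r mulr_natl mulr2n.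
  by rewrite -addrA ltrDl addr_gt0// ltr_wpDl.
by have := le_lt_trans aM Mt; rewrite ltxx.
Qed.
End ExponentialProperties.

(** * Lie algebras and their adjoint groups *)

Section TraceNilpotency.
Variable F : numClosedFieldType.

Lemma idempotent_trace (n : nat) (P : 'M[F]_n) : P *m P = P -> \tr P = (\rank P)%:R.
Proof.
move=> PP; have gen r (B : 'M_(r, n)) (K : 'M_(n, r)) (D : 'M_(r, n)) (E : 'M_(n, r)) :
    K *m B = P -> D *m K = 1%:M -> B *m E = 1%:M -> B *m K = 1%:M.
  move=> KB DK BE; have -> : B *m K = D *m (K *m B *m (K *m B)) *m E.
    by rewrite !mulmxA DK mul1mx -!mulmxA BE mulmx1.
  by rewrite KB PP -KB mulmxA DK mul1mx.
have /row_fullP[D DK] : row_full (col_base P) by exact: col_base_full.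
have /row_freeP[E BE] : row_free (row_base P) by exact: row_base_free.
have RC := gen _ _ _ D E (mulmx_base P) DK BE.
by rewrite -{1}(mulmx_base P) mxtrace_mulC RC mxtrace1.
Qed.

Lemma trace_horner_mx n (A : 'M[F]_n.+1) (p : {poly F}) :
  \tr (horner_mx A p) = \sum_(i < size p) p`_i * \tr (A ^+ i).
Proof.
rewrite -{1}[p]coefK poly_def rmorph_sum raddf_sum; apply: eq_bigr => i _ /=.
by rewrite horner_mxZ linearZ rmorphXn /= horner_mx_X.
Qed.

(** Write the characteristic polynomial as q X^m with q(0) nonzero. A Bezout relation yields the
    projector [P] onto the generalized eigenspaces of nonzero eigenvalues as a polynomial in A. Its
    trace is its rank, and by hypothesis it is 0. *)
Lemma trace_nilpotent (n : nat) (A : 'M[F]_n) :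
  (forall i, (0 < i <= n)%N -> \tr (A ^+ i) = 0) -> A ^+ n = 0.
Proof.
case: n A => [|n] A trA; first by apply/matrixP => -[].
have [m [q q0 cpE]] := multiplicity_XsubC (char_poly A) 0.
rewrite subr0 in cpE; have cp0 := monic_neq0 (char_poly_monic A).
rewrite cp0 /= in q0.
have qn0 : q != 0 by apply: contraNneq q0 => ->; rewrite root0.
have size_q : (size q + m = n.+2)%N.
  have := size_char_poly A; rewrite cpE size_Mmonic ?monicXn// size_polyXn.
  by rewrite addnS.
(* The exponent is m + 1 rather than m so that [A ^+ 0], whose trace is not controlled, does not
   occur in [P]. *)
have /Bezout_eq1_coprimepP[[u v] /= uv] : coprimep ('X^(m.+1) : {poly F}) q.
  rewrite coprimep_expl// coprimep_sym (_ : 'X = 'X - 0%:P) ?coprimep_XsubC //; by rewrite subr0.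
(* Reducing u modulo q keeps the degree of [pi] at most the size of [A], the range in which the
   traces are known to vanish. *)
pose u' := modp u q; pose v' := v + divp u q * 'X^(m.+1).
have uv' : u' * 'X^(m.+1) + v' * q = 1.
  by rewrite -uv [in RHS](divp_eq u q) /u' /v'; ring.
pose pi := u' * 'X^(m.+1); pose P := horner_mx A pi.
have PP : P *m P = P.
  have -> : P *m P = horner_mx A (pi * pi) by rewrite rmorphM.
  have -> : pi * pi = pi - u' * v' * 'X * char_poly A.
    rewrite cpE -{3}[pi]mulr1 -[1]uv' /pi exprS; ring.
  by rewrite rmorphB [X in _ - X]rmorphM /= Cayley_Hamilton mulr0 subr0.
have P0 : P = 0.
  apply/eqP; rewrite -mxrank_eq0 -(pnatr_eq0 F) -idempotent_trace//.
  rewrite trace_horner_mx big1// => -[i ilt] _ /=.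
  have [im|mi] := ltnP i m.+1; first by rewrite coefMXn im mul0r.
  rewrite trA ?mulr0//; apply/andP; split; first by exact: leq_trans mi.
  rewrite -ltnS -size_q (leq_trans ilt)//.
  have [u0|u0] := eqVneq u' 0; first by rewrite /pi u0 mul0r size_poly0.
  rewrite size_Mmonic ?monicXn// size_polyXn addnS /= addnS -addSn leq_add2r.
  by rewrite ltn_modp.
have Am : A ^+ m = 0.
  have -> : A ^+ m = horner_mx A ('X^m * pi + v' * char_poly A).
    rewrite cpE [v' * _]mulrA [v' * q * _]mulrC -mulrDr uv' mulr1.
    by rewrite rmorphXn /= horner_mx_X.
  by rewrite rmorphD [X in X + _]rmorphM [X in _ + X]rmorphM /= Cayley_Hamilton -/P P0 !mulr0 addr0.
have mn : (m <= n.+1)%N.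
  by rewrite -ltnS -size_q -[X in (X < _)%N]add0n ltn_add2r size_poly_gt0.
have Ek j : A ^+ (j + m) = 0 by rewrite exprD Am mulr0.
by have := Ek (n.+1 - m)%N; rewrite subnK.
Qed.

Lemma nilpotent_trace n (A : 'M[F]_n) k : A ^+ k = 0 -> \tr A = 0.
Proof.
case: n A => [|n] A Ak; first by rewrite /mxtrace big_ord0.
have [r cpE] := closed_field_poly_normal (char_poly A).
rewrite (eqP (char_poly_monic A)) scale1r in cpE.
have r0 z : z \in r -> z = 0.
  move=> zr; have : root (char_poly A) z by rewrite cpE root_prod_XsubC.
  rewrite -eigenvalue_root_char => /eigenvalueP[v vA v0].
  have vAk j : v *m A ^+ j = z ^+ j *: v.
    elim: j => [|j IH]; first by rewrite expr0 mulmx1 scale1r.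
    by rewrite exprSr mulmxA IH -scalemxAl vA scalerA exprSr.
  have := vAk k; rewrite Ak mulmx0 => /esym/eqP.
  by rewrite scaler_eq0 (negPf v0) orbF expf_eq0 => /andP[_ /eqP].
have cpX : char_poly A = 'X^(size r).
  rewrite cpE; elim: r r0 {cpE} => [|z r IH] r0; first by rewrite big_nil.
  rewrite big_cons IH => [|y yr]; last by apply: r0; rewrite in_cons yr orbT.
  by rewrite (r0 z) ?mem_head// subr0 exprS.
have sr : size r = n.+1.
  by have := size_char_poly A; rewrite cpX size_polyXn => -[].
have := char_poly_trace A (ltn0Sn n).
by rewrite cpX sr coefXn /= ltn_eqF// => /esym/eqP; rewrite oppr_eq0 => /eqP.
Qed.
End TraceNilpotency.

Section LinearFunctions.
Variables (F : fieldType) (V W : vectType F).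
Implicit Types (f h : 'Hom(V, W)) (x : V).
Lemma lfunD_E f h x : (f + h) x = f x + h x. Proof. by rewrite lfunE. Qed.
Lemma lfunN_E f x : (- f) x = - f x. Proof. by rewrite lfunE. Qed.
Lemma lfunZ_E a f x : (a *: f) x = a *: f x. Proof. by rewrite lfunE. Qed.

End LinearFunctions.

Section LieBasics.
Variables (F : fieldType) (g : lieAlgType F).
Implicit Types (x y z u : g) (f h : 'End(g)).

Lemma lieDr x y z : lie x (y + z) = lie x y + lie x z.
Proof. exact: linearD. Qed.
Lemma lieZr a x y : lie x (a *: y) = a *: lie x y.
Proof. exact: linearZ. Qed.
Lemma lieDl x y z : lie (x + y) z = lie x z + lie y z.
Proof. by have := lie_linearl 1 x y z; rewrite !scale1r. Qed.
Lemma lie0l x : lie 0 x = 0.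
Proof. by apply: (addrI (lie 0 x)); rewrite -lieDl !addr0. Qed.
Lemma lieZl a x y : lie (a *: x) y = a *: lie x y.
Proof. by have := lie_linearl a x 0 y; rewrite lie0l !addr0. Qed.
Lemma lie0r x : lie x 0 = 0.
Proof. exact: linear0. Qed.
Lemma lieNl x y : lie (- x) y = - lie x y.
Proof. by rewrite -scaleN1r lieZl scaleN1r. Qed.
Lemma lieNr x y : lie x (- y) = - lie x y.
Proof. exact: linearN. Qed.
Lemma lieBl x y z : lie (x - y) z = lie x z - lie y z.
Proof. by rewrite lieDl lieNl. Qed.
Lemma lieBr x y z : lie x (y - z) = lie x y - lie x z.
Proof. by rewrite lieDr lieNr. Qed.

Lemma lie_antisym x y : lie x y = - lie y x.
Proof.
have := liexx (x + y); rewrite lieDl !lieDr !liexx add0r addr0 => /eqP.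
by rewrite addr_eq0 => /eqP.
Qed.

Lemma lie_leibniz x y z : lie x (lie y z) = lie (lie x y) z + lie y (lie x z).
Proof.
have := lie_jacobi x y z; rewrite (lie_antisym z (lie x y)) (lie_antisym z x) lieNr.
by move=> /eqP; rewrite subr_eq0 => /eqP <-; rewrite subrK.
Qed.

Lemma lie_suml (I : Type) (r : seq I) (w : I -> g) z :
  lie (\sum_(i <- r) w i) z = \sum_(i <- r) lie (w i) z.
Proof.
by elim: r => [|i r IH]; rewrite ?big_nil ?lie0l// !big_cons lieDl IH.
Qed.

Lemma adE x y : ad x y = lie x y. Proof. by rewrite lfunE. Qed.

Lemma adD x y : ad (x + y) = ad x + ad y.
Proof. by apply/lfunP => z; rewrite !lfunE /= !lfunE /= lieDl. Qed.

Lemma adZ a x : ad (a *: x) = a *: ad x.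
Proof. by apply/lfunP => z; rewrite !lfunE /= !lfunE /= lieZl. Qed.

Lemma ad0 : ad (0 : g) = 0.
Proof. by apply/lfunP => z; rewrite adE lie0l lfunE. Qed.

Lemma ad_lie x y : ad (lie x y) = ((ad x \o ad y) - (ad y \o ad x))%VF.
Proof.
apply/lfunP => z; rewrite adE lfunD_E lfunN_E !comp_lfunE !adE.
by rewrite lie_leibniz addrK.
Qed.

Local Notation e := (vbasis {:g}).
Let eB : basis_of {:g} e. Proof. exact: vbasisP. Qed.
Let eF : free e. Proof. exact: basis_free eB. Qed.

(** Matrices act on row vectors, so composition reverses the order of the factors and commutators
    change sign. *)
Definition opmx f : 'M[F]_(\dim {:g}) := mxof e e f.

Lemma opmx_comp f h : opmx (f \o h)%VF = opmx h *m opmx f.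
Proof. exact: mxof_comp. Qed.

Lemma opmxD f h : opmx (f + h) = opmx f + opmx h.
Proof. exact: raddfD. Qed.

Lemma opmxN f : opmx (- f) = - opmx f.
Proof. exact: raddfN. Qed.

Lemma opmxZ a f : opmx (a *: f) = a *: opmx f.
Proof. exact: linearZ. Qed.

Lemma opmx1 : opmx \1%VF = 1%:M.
Proof. exact: mxof1. Qed.

Lemma opmx_inj f h : opmx f = opmx h -> f = h.
Proof. exact: (can_inj (mxofK eB eB)). Qed.

Lemma opmx_iter f k y : rVof e (iter k f y) = rVof e y *m opmx f ^+ k.
Proof.
elim: k => [|k IH]; first by rewrite expr0 mulmx1.
by rewrite iterS (rVof_app _ eB) IH exprSr mulmxA.
Qed.

Lemma opmx_pow_eq0 f k : (forall y, iter k f y = 0) <-> opmx f ^+ k = 0.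
Proof.
split=> [h|h y]; last first.
  by apply: (can_inj (rVofK eB)); rewrite opmx_iter h mulmx0 linear0.
apply/row_matrixP => i; rewrite rowE row0.
have -> : delta_mx 0 i = rVof e (vecof e (delta_mx 0 i)) by rewrite vecofK.
by rewrite -opmx_iter h linear0.
Qed.

Lemma killingE x y : killing x y = \tr (opmx (ad y) *m opmx (ad x)).
Proof. by rewrite -opmx_comp. Qed.

Lemma killingC x y : killing x y = killing y x.
Proof. by rewrite !killingE mxtrace_mulC. Qed.

Lemma killingDl x y z : killing (x + y) z = killing x z + killing y z.
Proof. by rewrite !killingE adD opmxD mulmxDr raddfD. Qed.

Lemma killingZl a x y : killing (a *: x) y = a * killing x y.
Proof. by rewrite !killingE adZ opmxZ -scalemxAr linearZ. Qed.

Lemma killingDr x y z : killing z (x + y) = killing z x + killing z y.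
Proof. by rewrite killingC killingDl !(killingC z). Qed.

Lemma killingZr a x y : killing y (a *: x) = a * killing y x.
Proof. by rewrite killingC killingZl (killingC y). Qed.

Lemma killingNl x y : killing (- x) y = - killing x y.
Proof. by rewrite -scaleN1r killingZl mulN1r. Qed.

Lemma killingNr x y : killing x (- y) = - killing x y.
Proof. by rewrite -scaleN1r killingZr mulN1r. Qed.

Lemma killing_lie u x y : killing (lie u x) y = - killing x (lie u y).
Proof.
rewrite !killingE !ad_lie !opmxD !opmxN !opmx_comp.
rewrite mulmxBr mulmxBl !raddfB /= opprK [RHS]addrC mulmxA mxtrace_mulC !mulmxA //.
Qed.

Definition lie_morph (phi : 'End(g)) : Prop :=
  forall x y, phi (lie x y) = lie (phi x) (phi y).

Lemma ad_morph phi x : lie_morph phi -> (phi \o ad x = ad (phi x) \o phi)%VF.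
Proof. by move=> h; apply/lfunP => y; rewrite !comp_lfunE !adE h. Qed.

Lemma opmx_ad_morph (phi psi : 'End(g)) x :
  lie_morph phi -> (phi \o psi = \1)%VF ->
  opmx (ad (phi x)) = opmx psi *m opmx (ad x) *m opmx phi.
Proof.
move=> h pp; rewrite -mulmxA -opmx_comp ad_morph// opmx_comp mulmxA.
by rewrite -opmx_comp pp opmx1 mul1mx.
Qed.

Lemma comp_inv_sym (phi psi : 'End(g)) : (phi \o psi = \1 -> psi \o phi = \1)%VF.
Proof.
move=> pp; apply: opmx_inj; rewrite opmx_comp opmx1; apply/mulmx1C.
by rewrite -opmx_comp pp opmx1.
Qed.

Lemma trace_pow_morph (phi psi : 'End(g)) x k :
  lie_morph phi -> (phi \o psi = \1)%VF ->
  \tr (opmx (ad (phi x)) ^+ k) = \tr (opmx (ad x) ^+ k).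
Proof.
move=> h pp; rewrite (opmx_ad_morph x h pp).
have P1 : opmx phi *m opmx psi = 1%:M by rewrite -opmx_comp (comp_inv_sym pp) opmx1.
have -> : (opmx psi *m opmx (ad x) *m opmx phi) ^+ k =
    opmx psi *m opmx (ad x) ^+ k *m opmx phi.
  elim: k => [|k IH].
    by rewrite !expr0 mulmx1 -opmx_comp pp opmx1.
  rewrite exprS IH -[_ * _]/(_ *m _) !mulmxA -[_ *m opmx phi *m opmx psi]mulmxA.
  by rewrite P1 mulmx1 exprS -[_ * _]/(_ *m _) !mulmxA.
by rewrite mxtrace_mulC mulmxA P1 mul1mx.
Qed.

Lemma killing_morph (phi psi : 'End(g)) x y :
  lie_morph phi -> (phi \o psi = \1)%VF ->
  killing (phi x) (phi y) = killing x y.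
Proof.
move=> h pp; rewrite !killingE !(opmx_ad_morph _ h pp).
have P1 : opmx phi *m opmx psi = 1%:M by rewrite -opmx_comp (comp_inv_sym pp) opmx1.
rewrite mxtrace_mulC !mulmxA -[_ *m opmx phi *m opmx psi]mulmxA P1 mulmx1.
by rewrite mxtrace_mulC !mulmxA P1 mul1mx mxtrace_mulC.
Qed.

Lemma nilpotent_eltP x : nilpotent_elt g x <-> exists k, opmx (ad x) ^+ k = 0.
Proof.
have E k y : iter k (ad x) y = iter k (lie x) y.
  by elim: k => //= k ->; rewrite adE.
split=> -[k h]; exists k; first by apply/opmx_pow_eq0 => y; rewrite E.
by move=> y; rewrite -E; move: y; apply/opmx_pow_eq0.
Qed.
End LieBasics.

Section LieClosedField.
Variables (F : numClosedFieldType) (g : lieAlgType F).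
Implicit Types (x y z u w : g).

Lemma nilpotent_traceP x : nilpotent_elt g x <->
  forall i, (0 < i <= \dim {:g})%N -> \tr (opmx (ad x) ^+ i) = 0.
Proof.
rewrite nilpotent_eltP; split=> [[k xk] i /andP[i0 _]|h]; last first.
  by exists (\dim {:g}); exact: trace_nilpotent.
apply: (nilpotent_trace (k := k)); rewrite -exprM mulnC exprM xk.
by case: i i0 => // i _; rewrite exprS mul0r.
Qed.

Lemma killing_nilpotent x : nilpotent_elt g x -> killing x x = 0.
Proof.
move=> /nilpotent_eltP[k xk]; rewrite killingE; apply: (nilpotent_trace (k := k)).
by rewrite -[_ *m _]/(_ ^+ 2) -exprM mulnC exprM xk expr0n.
Qed.

(* Jacobson's lemma: [tr (c ^ i.+1) = tr ((a b - b a) c ^ i) = 0] as [c = a b - b a]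
   commutes with [a]. *)
Lemma jacobson_nilpotent x w : lie x (lie x w) = 0 -> nilpotent_elt g (lie x w).
Proof.
move=> xxw; apply/nilpotent_traceP => -[//|i] _.
set A := opmx (ad x); set B := opmx (ad w).
have cE : opmx (ad (lie x w)) = B *m A - A *m B.
  by rewrite ad_lie opmxD opmxN !opmx_comp.
have cA : opmx (ad (lie x w)) *m A = A *m opmx (ad (lie x w)).
  apply/eqP; rewrite -subr_eq0 -!opmx_comp -opmxN -opmxD -ad_lie xxw ad0.
  by rewrite [opmx 0]raddf0.
have cAi : opmx (ad (lie x w)) ^+ i *m A = A *m opmx (ad (lie x w)) ^+ i.
  elim: i => [|i IH]; first by rewrite expr0 mul1mx mulmx1.
  by rewrite exprSr -mulmxA cA mulmxA IH -mulmxA.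
rewrite exprS -[_ * _]/(_ *m _) {1}cE mulmxBl raddfB /= -!mulmxA -cAi.
rewrite mulmxA mxtrace_mulC. by rewrite -[X in \tr X - _]mulmxA [X in X - _]mxtrace_mulC subrr.
Qed.

(** Nondegeneracy gives d with killing d x = tr (D (ad x)) for all x. For B = D - ad d, invariance
    of the trace gives killing (B x) y = tr (B (ad [x, y])) = 0, whence B = 0. *)
Lemma derivation_inner (D : 'End(g)) :
  (forall x, (forall y, killing x y = 0) -> x = 0) ->
  (forall x y, D (lie x y) = lie (D x) y + lie x (D y)) ->
  exists d, D = ad d.
Proof.
move=> nondeg der; pose e := vbasis {:g}.
have eB : basis_of {:g} e by exact: vbasisP.
have eF : free e by exact: basis_free eB.
pose G := \matrix_(i, j < \dim {:g}) killing e`_i e`_j.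
have GE v j : (rVof e v *m G) 0 j = killing v e`_j.
  rewrite mxE {2}[v](coord_basis eB (memvf v)).
  elim/big_ind2 : _ => [|a b c d -> ->|i _].
  - by rewrite -[0 in RHS](scale0r v) killingZl mul0r.
  - by rewrite killingDl.
  - by rewrite !mxE killingZl.
have Gfree : row_free G.
  rewrite -kermx_eq0; apply/rowV0P => v /sub_kermxP vG.
  rewrite -[v](vecofK eB); set x := vecof e v; have -> : x = 0; last by rewrite linear0.
  apply: nondeg => y; rewrite [y](coord_basis eB (memvf y)).
  rewrite killingC; elim/big_ind : _ => [|a b|j _].
  - by rewrite -[0 in LHS](scale0r x) killingZl mul0r.
  - by rewrite killingDl => -> ->; rewrite addr0.
  - by rewrite killingZl killingC -GE /x vecofK// vG mxE mulr0.
have [E GE1] := row_freeP Gfree.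
pose t := \row_(j < \dim {:g}) \tr (opmx (ad e`_j) *m opmx D).
have tG : t *m E *m G = t by rewrite -mulmxA (mulmx1C GE1) mulmx1.
pose d := vecof e (t *m E); exists d.
have trd x : \tr (opmx (ad x) *m opmx (D - ad d)) = 0.
  rewrite [x](coord_basis eB (memvf x)).
  elim/big_ind : _ => [|a b ha hb|j _].
  - by rewrite ad0 [opmx 0]raddf0 mul0mx raddf0.
  - by rewrite adD opmxD mulmxDl raddfD /= ha hb addr0.
  rewrite adZ opmxZ -scalemxAl linearZ /= opmxD opmxN mulmxDr mulmxN raddfB /=.
  rewrite -(killingE d e`_j) -GE /d vecofK// tG mxE subrr mulr0 //.
apply/eqP; rewrite -subr_eq0; apply/eqP/lfunP => x; rewrite zero_lfunE.
set B := D - ad d in trd *.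
have Bad y : ad (B y) = ((B \o ad y) - (ad y \o B))%VF.
  apply/lfunP => z; rewrite adE /B !(lfunD_E, lfunN_E, comp_lfunE) !adE.
  by rewrite der lie_leibniz lieBl !lieBr [in RHS]opprD addrACA addrK.
apply: nondeg => y; rewrite killingE Bad.
rewrite opmxD opmxN !opmx_comp -(trd (lie x y)) ad_lie opmxD opmxN !opmx_comp.
rewrite mulmxBr mulmxBl !raddfB /= !mulmxA; congr (_ - _).
by rewrite mxtrace_mulC !mulmxA.
Qed.
End LieClosedField.

(** * Entire functions of one variable *)

Section Entire.
Variable C : numClosedFieldType.
Hypothesis complete : sum_complete C.

Definition entire (f : C -> C) : Prop :=
  exists a, forall t, abs_sum (fun n => a n * t ^+ n) (f t).

Lemma entire_ext f f' : f =1 f' -> entire f -> entire f'.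
Proof. by move=> e [a af]; exists a => t; rewrite -e. Qed.

Lemma entire_affine c b : entire (fun t => c + t * b).
Proof.
exists (fun n => if n is 0 then c else if n is 1 then b else 0) => t.
have := @abs_sum_finite _
  (fun n => (if n is 0 then c else if n is 1 then b else 0) * t ^+ n) 2.
rewrite !big_ord_recl big_ord0 /= addr0 expr0 expr1 mulr1 mulrC; apply.
by case=> [|[|n]]// _; rewrite mul0r.
Qed.

Lemma entire_cst c : entire (fun=> c).
Proof. by apply: entire_ext (entire_affine c 0) => t; rewrite mulr0 addr0. Qed.

Lemma entireD f h : entire f -> entire h -> entire (fun t => f t + h t).
Proof.
move=> [a af] [b bh]; exists (fun n => a n + b n) => t.
have := abs_sumD (af t) (bh t); congr abs_sum.
by apply/funext => n; rewrite mulrDl.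
Qed.

Lemma convol_scaled (a b : nat -> C) t n :
  convol (fun n => a n * t ^+ n) (fun n => b n * t ^+ n) n = convol a b n * t ^+ n.
Proof.
rewrite /convol mulr_suml; apply: eq_bigr => k _.
by rewrite mulrACA -exprD subnKC// -ltnS.
Qed.

Lemma entireM f h : entire f -> entire h -> entire (fun t => f t * h t).
Proof.
move=> [a af] [b bh]; exists (convol a b) => t.
have := abs_sumM complete (af t) (bh t); congr abs_sum.
by apply/funext => n; rewrite convol_scaled.
Qed.

Lemma entire_sum (I : Type) (r : seq I) f :
  (forall i, entire (f i)) -> entire (fun t => \sum_(i <- r) f i t).
Proof.
move=> h; elim: r => [|i r IH].
  by apply: entire_ext (entire_cst 0) => t; rewrite big_nil.
by apply: entire_ext (entireD (h i) IH) => t; rewrite big_cons.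
Qed.

Lemma entire_poly d (phi : ('I_d -> C) -> C) (f : 'I_d -> C -> C) :
  polyfun phi -> (forall j, entire (f j)) -> entire (fun t => phi (fun j => f j t)).
Proof.
move=> [p pp] fe; apply: (@entire_ext (fun t => mpoly.meval (fun j => f j t) p)).
  by move=> t; rewrite pp.
pose S p := entire (fun t => mpoly.meval (fun j => f j t) p).
have SC a : S (mpoly.mpolyC d a).
  by apply: entire_ext (entire_cst a) => t; rewrite mpoly.mevalC.
have SM p1 p2 : S p1 -> S p2 -> S (p1 * p2).
  by move=> S1 S2; apply: entire_ext (entireM S1 S2) => t; rewrite rmorphM.
have SD p1 p2 : S p1 -> S p2 -> S (p1 + p2).
  by move=> S1 S2; apply: entire_ext (entireD S1 S2) => t; rewrite raddfD.
rewrite -/(S p); elim/mpoly.mpolyind : {pp} p => [|a m p _ _ Sp].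
  by have := SC 0; rewrite mpoly.mpolyC0.
apply: (SD) => //; rewrite -mpoly.mul_mpolyC; apply: (SM); first exact: SC.
rewrite mpoly.mpolyXE_id; elim/big_ind : _ => [||i _]; [exact: (SC 1)|exact: SM|].
set e := (X in _ ^+ X); elim: e => [|e IH]; first by rewrite expr0; exact: (SC 1).
rewrite exprS; apply: (SM) => //.
by apply: entire_ext (fe i) => t; rewrite mpoly.mevalXU.
Qed.

Lemma entire0_coef (a : nat -> C) :
  (forall t, abs_sum (fun n => a n * t ^+ n) 0) -> forall n, a n = 0.
Proof.
move=> a0 [|n].
  have := @abs_sum_finite _ (fun n => a n * 0 ^+ n) 1.
  rewrite big_ord1 expr0 mulr1 => h; apply: (abs_sum_unique (h _) (a0 0)).
  by case=> // n _; rewrite exprS mul0r mulr0.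
apply: (@maximum_modulus _ 1 a (fun=> 0)) => // t _.
by rewrite normr0.
Qed.

(** Entire functions form an integral domain; this yields the irreducibility of closures of sets
    connected by entire curves. *)
Lemma entire_mul_eq0 f h : entire f -> entire h ->
  (forall t, f t * h t = 0) -> (forall t, f t = 0) \/ (forall t, h t = 0).
Proof.
move=> [a af] [b bh] fh.
have ab n : convol a b n = 0.
  move: n; apply: entire0_coef => t; rewrite -(fh t).
  have := abs_sumM complete (af t) (bh t); congr abs_sum.
  by apply/funext => n; rewrite convol_scaled.
have zero (c : nat -> C) k : (forall t, abs_sum (fun n => c n * t ^+ n) (k t)) ->
    (forall n, c n = 0) -> forall t, k t = 0.
  move=> ck c0 t; apply: (abs_sum_unique (ck t)).
  have := @abs_sum_finite _ (fun n => c n * t ^+ n) 0; rewrite big_ord0; apply.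
  by move=> n _; rewrite c0 mul0r.
have [a0|/existsNP[p0 ap0]] := pselect (forall n, a n = 0); first by left; exact: zero a0.
have [b0|/existsNP[q0 bq0]] := pselect (forall n, b n = 0); first by right; exact: zero b0.
have exa : exists n, a n != 0 by exists p0; apply/eqP.
have exb : exists n, b n != 0 by exists q0; apply/eqP.
case: (ex_minnP exa) (ex_minnP exb) => p ap minp [q bq minq].
(* With p and q the lowest indices of nonzero coefficients, the coefficient of index p + q of the
   product reduces to [a p * b q]. *)
have := ab (p + q)%N; rewrite /convol (bigD1 (inord p))//= inordK ?ltnS ?leq_addr//.
rewrite addKn big1 ?addr0 => [/eqP|k kp]; first by rewrite mulf_eq0 (negPf ap) (negPf bq).
have [klt|kge] := ltnP k p.
  suff -> : a k = 0 by rewrite mul0r.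
  by apply/eqP; apply: contraTT klt => /minp; rewrite leqNgt.
suff -> : b (p + q - k)%N = 0 by rewrite mulr0.
have pk : (p < k)%N.
  rewrite ltn_neqAle kge andbT; apply: contraNneq kp => kE.
  by apply/eqP/val_inj; rewrite /= inordK ?ltnS ?leq_addr.
have := ltn_ord k; move=> kpq; apply/eqP; apply: contraTT pk => /minq; lia.
Qed.
End Entire.

(** * Groups generated by exponentials of inner derivations *)

Section AdjointGroup.
Variables (R : realType) (g : lieAlgType R[i]).
Local Notation C := (R[i] : numFieldType).
Implicit Types (S : set g) (phi psi D : 'End(g)).

(** Expanding the bracket by structure constants [c] reduces the claim to Cauchy products, matched
    with the Leibniz formula for the iterates of [D]. *)
Lemma lfun_exp_lie D : (forall x y, D (lie x y) = lie (D x) y + lie x (D y)) ->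
  lie_morph (lfun_exp D).
Proof.
move=> der x y; apply: lfun_expP => ell; pose e := vbasis {:g}.
pose c a b : C := ell (lie e`_a e`_b).
have lieE u v : ell (lie u v) =
    \sum_(a < \dim {:g}) \sum_(b < \dim {:g}) c a b * (vcoord a u * vcoord b v).
  rewrite {1}[u]vcoord_sum lie_suml linear_sum; apply: eq_bigr => a _.
  rewrite lieZl scalarZ {1}[v]vcoord_sum (linear_sum (lie e`_a)) linear_sum mulr_sumr.
  by apply: eq_bigr => b _; rewrite /= lieZr scalarZ mulrA mulrC.
rewrite lieE.
have h (a b : 'I_(\dim {:g})) := abs_sumZ (c a b) (abs_sumM (@sum_completeC R)
  (lfun_exp_sum D x (vcoord a)) (lfun_exp_sum D y (vcoord b))).
have := abs_sum_sum (index_enum _) (fun a => abs_sum_sum (index_enum _) (h a)).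
congr abs_sum; apply/funext => n.
rewrite (leibniz_iter (B := @lie _ g) (dW := D) x y n der) linear_sum mulr_suml.
under eq_bigr do under eq_bigr do rewrite /convol mulr_sumr.
under eq_bigr do rewrite exchange_big /=.
rewrite exchange_big /=; apply: eq_bigr => k _.
have kn : (k <= n)%N by rewrite -ltnS.
rewrite raddfMn /= lieE -[_ *+ 'C(n, k)]mulr_natr -mulrA mulr_suml; apply: eq_bigr => a _.
rewrite mulr_suml; apply: eq_bigr => b _.
rewrite -(bin_fact kn) !natrM.
by field; rewrite !pnatr_eq0 -!lt0n !fact_gt0 bin_gt0 kn.
Qed.

Lemma lfun_exp_ad_morph (x : g) : lie_morph (lfun_exp (ad x)).
Proof. by apply: lfun_exp_lie => y z; rewrite !adE lie_leibniz. Qed.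

Lemma lfun_exp_adN (x : g) : (lfun_exp (ad x) \o lfun_exp (ad (- x)) = \1)%VF.
Proof.
have := lfun_expD (ad x) 1 (-1); rewrite subrr scale0r lfun_exp0 -!adZ.
by rewrite scale1r scaleN1r.
Qed.

Lemma adgroup_morph S phi : adgroup S phi -> lie_morph phi.
Proof.
elim=> [x y|x {}phi _ _ IH y z]; first by rewrite !lfunE.
by rewrite !comp_lfunE IH lfun_exp_ad_morph.
Qed.

Lemma adgroup_comp S phi psi :
  adgroup S phi -> adgroup S psi -> adgroup S (phi \o psi)%VF.
Proof.
elim=> [|x {}phi Sx _ IH] Spsi; first by rewrite comp_lfun1l.
by rewrite -comp_lfunA; apply: adgroupM => //; exact: IH.
Qed.

Lemma adgroup_exp S (x : g) : S x -> adgroup S (lfun_exp (ad x)).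
Proof. by move=> Sx; rewrite -[lfun_exp _]comp_lfun1r; apply: adgroupM => //; exact: adgroup1. Qed.

Lemma adgroup_inv S phi : (forall x, S x -> S (- x)) -> adgroup S phi ->
  exists2 psi, adgroup S psi & (phi \o psi = \1)%VF.
Proof.
move=> SN; elim=> [|x {}phi Sx _ [psi Spsi pp]].
  by exists \1%VF; [exact: adgroup1|rewrite comp_lfun1l].
exists (psi \o lfun_exp (ad (- x)))%VF.
  by apply: adgroup_comp => //; apply: adgroup_exp; exact: SN.
by rewrite comp_lfunA -[((_ \o phi) \o psi)%VF]comp_lfunA pp comp_lfun1r lfun_exp_adN.
Qed.

Lemma adgroup_fix S phi (T : 'End(g)) v : (forall x v, S x -> T (lie x v) = lie x (T v)) ->
  adgroup S phi -> T (phi v) = phi (T v).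
Proof.
move=> TS h; elim: h v => [|x {}phi Sx _ IH] v; first by rewrite !lfunE.
rewrite !comp_lfunE -IH; apply: lfun_exp_comm => w.
by rewrite !adE TS.
Qed.

Lemma adgroup_antilinear S phi (T : g -> g) v :
  (forall a x y, T (a *: x + y) = a^*%C *: T x + T y) ->
  (forall x v, S x -> T (lie x v) = lie x (T v)) ->
  adgroup S phi -> T (phi v) = phi (T v).
Proof.
move=> aT TS h; elim: h v => [|x {}phi Sx _ IH] v; first by rewrite !lfunE.
rewrite !comp_lfunE -IH; apply: lfun_exp_antilinear => // w.
by rewrite !adE TS.
Qed.

(** Scale every exponent in a factorization of [phi] by the complex parameter t. Stability of [S]
    under complex scalars keeps the path in the group. *)
Lemma adgroup_path S phi : (forall t x, S x -> S (t *: x)) -> adgroup S phi ->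
  exists Phi : R[i] -> 'End(g), [/\ Phi 0 = \1%VF, Phi 1 = phi,
    forall t, adgroup S (Phi t) &
    forall v j, @entire R[i] (fun t => vcoord j (Phi t v))].
Proof.
move=> SZ; elim=> [|x {}phi Sx _ [Phi [P0 P1 SP eP]]].
  exists (fun=> \1%VF); split => //; first by move=> _; exact: adgroup1.
  by move=> v j; exact: entire_cst.
exists (fun t => lfun_exp (ad (t *: x)) \o Phi t)%VF; split.
- by rewrite scale0r ad0 lfun_exp0 P0 comp_lfun1l.
- by rewrite scale1r P1.
- by move=> t; apply: adgroupM => //; exact: SZ.
move=> v j; apply: (@entire_ext _ (fun t => \sum_k vcoord k (Phi t v) *
    vcoord j (lfun_exp (t *: ad x) (vbasis {:g})`_k))).
  move=> t; rewrite comp_lfunE adZ [X in _ = vcoord j (_ X)]vcoord_sum !linear_sum.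
  by apply: eq_bigr => k _; rewrite linearZ scalarZ.
apply: entire_sum => k; apply: entireM; [exact: sum_completeC|exact: eP|].
exists (fun n => vcoord j (iter n (ad x) (vbasis {:g})`_k) / n`!%:R) => t.
exact: lfun_exp_scaled_sum.
Qed.

End AdjointGroup.

(** * Hermitian forms and the Cartan involution *)

Section HermitianForm.
Variables (R : realType) (V : vectType R[i]).
Local Notation C := R[i].
Implicit Types (x y z b : V) (f : 'End(V)) (U : {vspace V}).

Definition hermitian_posdef (h : V -> V -> C) : Prop :=
  [/\ forall a x y z, h (a *: x + y) z = a * h x z + h y z,
      forall x y, h y x = (h x y)^*%C &
      forall x, x != 0 -> 0 < h x x].

Variable h : V -> V -> C.
Hypothesis hP : hermitian_posdef h.

Lemma herm_scalar z : linear_for *%R (fun x => h x z).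
Proof. by move=> a x y; case: hP. Qed.

Definition hermL z : {scalar V} := HB.pack (fun x => h x z)
  (GRing.isLinear.Build _ _ _ _ (fun x => h x z) (herm_scalar z)).

Lemma herm_conj x y : h y x = (h x y)^*%C. Proof. by case: hP. Qed.
Lemma herm_gt0 x : x != 0 -> 0 < h x x. Proof. by case: hP => _ _; apply. Qed.
Lemma herm_neq0 x : x != 0 -> h x x != 0.
Proof. by move=> /herm_gt0; rewrite lt0r => /andP[]. Qed.
Lemma herm0l y : h 0 y = 0. Proof. exact: (linear0 (hermL y)). Qed.
Lemma hermDl x y z : h (x + y) z = h x z + h y z. Proof. exact: (linearD (hermL z)). Qed.
Lemma hermBl x y z : h (x - y) z = h x z - h y z. Proof. exact: (linearB (hermL z)). Qed.
Lemma hermNl x z : h (- x) z = - h x z. Proof. exact: (linearN (hermL z)). Qed.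
Lemma hermZl a x z : h (a *: x) z = a * h x z. Proof. exact: (scalarZ (hermL z)). Qed.
Lemma herm_suml (I : Type) (r : seq I) (P : pred I) (w : I -> V) z :
  h (\sum_(i <- r | P i) w i) z = \sum_(i <- r | P i) h (w i) z.
Proof. exact: (linear_sum (hermL z)). Qed.
Lemma herm0r y : h y 0 = 0. Proof. by rewrite herm_conj herm0l conjc0. Qed.
Lemma hermZr a x z : h x (a *: z) = a^*%C * h x z.
Proof. by rewrite herm_conj hermZl rmorphM /= -herm_conj. Qed.
Lemma hermDr x y z : h x (y + z) = h x y + h x z.
Proof. by rewrite herm_conj hermDl rmorphD /= -!herm_conj. Qed.
Lemma hermNr x z : h x (- z) = - h x z.
Proof. by rewrite -scaleN1r hermZr rmorphN rmorph1 mulN1r. Qed.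
Lemma hermBr x y z : h x (y - z) = h x y - h x z.
Proof. by rewrite hermDr hermNr. Qed.
Lemma herm_ge0 x : 0 <= h x x.
Proof. by have [->|/herm_gt0/ltW//] := eqVneq x 0; rewrite herm0l. Qed.
Lemma herm_eq0 x : h x x = 0 -> x = 0.
Proof. by move=> xx; apply/eqP/negPn/negP => /herm_neq0; rewrite xx eqxx. Qed.
Lemma herm_orthC x y : h x y = 0 -> h y x = 0.
Proof. by move=> e; rewrite herm_conj e conjc0. Qed.

Lemma stable_eigenvector f U : (forall x, x \in U -> f x \in U) -> U != 0%VS ->
  exists b a, [/\ b \in U, b != 0 & f b = a *: b].
Proof.
move=> fU U0; pose n := \dim U; pose B := vbasis U.
have BU i : B`_i \in U.
  have [iB|] := ltnP i (size B); first exact: vbasis_mem (mem_nth 0 iB).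
  by move=> /(nth_default 0) ->; exact: mem0v.
pose M := \matrix_(i, j < n) coord B j (f B`_i).
have n0 : (0 < n)%N by rewrite lt0n dimv_eq0.
have [a /eigenvalueP[v vM v0]] := eigenvalue_closed M n0.
exists (\sum_i v 0 i *: B`_i), a; split.
- by apply: memv_suml => i _; apply: memvZ; exact: BU.
- apply: contraNneq v0 => vB0; apply/eqP/rowP => i; rewrite mxE.
  by have /freeP := basis_free (vbasisP U); apply.
rewrite linear_sum scaler_sumr.
transitivity (\sum_j (v *m M) 0 j *: B`_j); last first.
  by apply: eq_bigr => j _; rewrite vM mxE scalerA.
under eq_bigr do rewrite linearZ /= [f _](coord_vbasis (fU _ (BU _))) scaler_sumr.
rewrite exchange_big /=; apply: eq_bigr => j _; rewrite mxE scaler_suml.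
by apply: eq_bigr => i _; rewrite mxE scalerA.
Qed.

Definition orthogonal_expansion U (X : seq V) : Prop :=
  [/\ forall x, x \in X -> x \in U /\ x != 0,
      forall x y, x \in X -> y \in X -> x != y -> h x y = 0,
      uniq X &
      forall x, x \in U -> x = \sum_(b <- X) (h x b / h b b) *: b].

(** The second hypothesis, that [f] preserves the orthogonal complement of each eigenvector, is
    common to self-adjoint and unitary operators, so one induction on the dimension serves both. *)
Lemma orthogonal_eigenbasis f U : (forall x, x \in U -> f x \in U) ->
  (forall b a, b \in U -> f b = a *: b -> forall x, x \in U -> h x b = 0 -> h (f x) b = 0) ->
  exists2 X, orthogonal_expansion U X & forall x, x \in X -> exists a, f x = a *: x.
Proof.
have [n] := ubnP (\dim U); elim: n U => // n IH U dU fU fort.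
have [U0|U0] := eqVneq U 0%VS.
  exists [::] => //; split => // x; rewrite big_nil U0 memv0 => /eqP //.
have [b [a [bU b0 fb]]] := stable_eigenvector fU U0.
pose L : 'Hom(V, C^o) := linfun (fun x => h x b : C^o).
have LE x : L x = h x b.
  have lin : linear (fun x => h x b : C^o) by move=> c u v; exact: herm_scalar.
  pose l' : {linear V -> C^o} := HB.pack (fun x => h x b : C^o)
    (GRing.isLinear.Build _ _ _ _ (fun x => h x b : C^o) lin).
  by rewrite /L -[RHS]/(l' x) -[X in linfun X]/(GRing.Linear.sort l') lfunE.
pose U' := (U :&: lker L)%VS.
have U'P x : (x \in U') = (x \in U) && (h x b == 0).
  by rewrite memv_cap memv_ker LE.
have hb0 := herm_neq0 b0.
have dU' : (\dim U' < n)%N.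
  rewrite -ltnS (leq_trans _ dU)// ltnS.
  rewrite ltn_neqAle dimvS ?capvSl// andbT; apply: contraNneq hb0 => dd.
  have UU : U' = U by apply/eqP; rewrite eqEdim capvSl dd leqnn.
  have : b \in U' by rewrite UU.
  by rewrite U'P => /andP[].
have [| |X [XU' Xo Xu Xe] Xeig] := IH U' dU'.
- move=> x; rewrite !U'P => /andP[xU /eqP xb]; rewrite fU//=.
  by apply/eqP; exact: fort fb _ xU xb.
- move=> c d; rewrite U'P => /andP[cU _] fc x; rewrite U'P => /andP[xU _].
  exact: fort fc _ xU.
have Xb x : x \in X -> h x b = 0 by move=> /XU'[]; rewrite U'P => /andP[_ /eqP].
exists (b :: X); last first.
  by move=> x; rewrite in_cons => /predU1P[->|]; [exists a|exact: Xeig].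
split.
- move=> x; rewrite in_cons => /predU1P[->//|/XU'[]]; rewrite U'P => /andP[].
  by [].
- move=> x y; rewrite !in_cons => /predU1P[->|xX] /predU1P[->|yX] //.
  + by rewrite eqxx.
  + by move=> _; apply: herm_orthC; exact: Xb.
  + by move=> _; exact: Xb.
  + exact: Xo.
- rewrite /= Xu andbT; apply/negP => /Xb /eqP; exact/negP.
move=> x xU; rewrite big_cons; set c := h x b / h b b.
have xU' : x - c *: b \in U'.
  by rewrite U'P rpredB ?memvZ//= hermBl hermZl /c divfK// subrr.
rewrite -{1}[x](subrK (c *: b)) addrC [x - _]Xe//; congr (_ + _).
apply: eq_big_seq => y yX; congr (_ / _ *: _).
rewrite hermBl hermZl (herm_orthC (Xb _ yX)) mulr0 subr0 //.
Qed.

(** A vector of ker f in the image of the adjoint f' is orthogonal to itself. The same for ker f'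
    and the image of f, with rank-nullity, gives the missing dimension inequality. *)
Lemma orthogonal_direct (f f' : 'End(V)) :
  (forall x y, h (f x) y = h x (f' y)) ->
  (lker f :&: limg f' = 0)%VS /\ (lker f + limg f' = fullv)%VS.
Proof.
move=> adj.
have cap0 : (lker f :&: limg f' = 0)%VS.
  apply/eqP; rewrite -subv0; apply/subvP => x; rewrite memv_cap => /andP[].
  rewrite memv_ker => /eqP fx /memv_imgP[y _ xy]; rewrite memv0; apply/eqP.
  by apply: herm_eq0; rewrite {2}xy -adj fx herm0l.
split => //; apply/eqP; rewrite eqEdim subvf /=.
have ker' : (lker f' :&: limg f = 0)%VS.
  apply/eqP; rewrite -subv0; apply/subvP => x; rewrite memv_cap => /andP[].
  rewrite memv_ker => /eqP fx /memv_imgP[y _ xy]; rewrite memv0; apply/eqP.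
  by apply: herm_eq0; rewrite {1}xy adj fx herm0r.
rewrite dimv_disjoint_sum//.
have d1 := limg_ker_dim f fullv; have d2 := limg_ker_dim f' fullv.
rewrite !capfv in d1 d2.
have := dimvS (subvf (lker f' + limg f)); rewrite dimv_disjoint_sum//.
by rewrite -d2; lia.
Qed.
End HermitianForm.

Section ComplexConjugation.
Variable R : realType.
Local Notation C := R[i].
Lemma conjcD (x y : C) : (x + y)^*%C = x^*%C + y^*%C.
Proof. exact: rmorphD. Qed.
Lemma conjcM (x y : C) : (x * y)^*%C = x^*%C * y^*%C.
Proof. exact: rmorphM. Qed.
Lemma conjc_i : ('i%C : C)^*%C = - 'i%C.
Proof. by apply/eqP; rewrite eq_complex /= oppr0 !eqxx. Qed.
End ComplexConjugation.

(** * Real forms, their conjugation, and the hermitian form of a Cartan involution *)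

Section RealForm.
Variables (R : realType) (g : lieAlgType R[i]) (gR : set g).
Local Notation C := R[i].
Implicit Types (x y z u : g).
Hypothesis rf : real_form gR.

Lemma realform0 : gR 0. Proof. by case: rf => -[[]]. Qed.
Lemma realformD x y : gR x -> gR y -> gR (x + y).
Proof. by case: rf => -[[_ h _] _] _; exact: h. Qed.
Lemma realformZ (a : R) x : gR x -> gR (a%:C%C *: x).
Proof. by case: rf => -[[_ _ h] _] _; exact: h. Qed.
Lemma realformN x : gR x -> gR (- x).
Proof. by move=> /(realformZ (-1)); rewrite rmorphN rmorph1 scaleN1r. Qed.
Lemma realformB x y : gR x -> gR y -> gR (x - y).
Proof. by move=> gx gy; apply: realformD => //; exact: realformN. Qed.
Lemma real_lie x y : gR x -> gR y -> gR (lie x y).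
Proof. by case: rf => -[_ h] _; exact: h. Qed.

Lemma real_dec x : exists ab : g * g, [/\ gR ab.1, gR ab.2 & x = ab.1 + 'i%C *: ab.2].
Proof.
case: rf => _ [sT _]; have : [set: g] x by [].
by rewrite sT => -[a ga [_ [b gb <-]] <-]; exists (a, b).
Qed.

Definition rconj x : g := let ab := sval (cid (real_dec x)) in ab.1 - 'i%C *: ab.2.

Lemma i_neq0 : ('i%C : C) != 0.
Proof. by rewrite eq_complex /= oner_eq0 andbF. Qed.
Lemma mulii : ('i%C : C) * 'i%C = -1. Proof. by rewrite -expr2 sqr_i. Qed.

Lemma real_uniq a b a' b' : gR a -> gR b -> gR a' -> gR b' ->
  a + 'i%C *: b = a' + 'i%C *: b' -> a = a' /\ b = b'.
Proof.
move=> ga gb ga' gb' e; case: rf => _ [_ cap].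
have e' : a - a' = 'i%C *: (b' - b).
  by rewrite scalerBr; apply/eqP; rewrite subr_eq addrAC -subr_eq opprK e addrC.
have aa : a - a' = 0.
  have : (gR `&` [set 'i%C *: x | x in gR]) (a - a').
    by split; [exact: realformB|exists (b' - b); [exact: realformB|rewrite e']].
  by rewrite cap.
split; first by apply/eqP; rewrite -subr_eq0 aa.
move: e'; rewrite aa => /esym/eqP; rewrite scaler_eq0 (negPf i_neq0) /= subr_eq0.
by move=> /eqP.
Qed.

Lemma rconjE a b : gR a -> gR b -> rconj (a + 'i%C *: b) = a - 'i%C *: b.
Proof.
move=> ga gb; rewrite /rconj; case: cid => -[a' b'] /= [ga' gb' /(real_uniq ga gb ga' gb')].
by move=> [-> ->].
Qed.

Lemma real_decP x : exists a b, [/\ gR a, gR b, x = a + 'i%C *: b & rconj x = a - 'i%C *: b].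
Proof.
by have [[a b] /= [ga gb ->]] := real_dec x; exists a, b; rewrite rconjE.
Qed.

Lemma rconj_real x : gR x -> rconj x = x.
Proof.
by move=> gx; have := rconjE gx realform0; rewrite scaler0 addr0 subr0.
Qed.

Lemma rconjP x : gR x <-> rconj x = x.
Proof.
split=> [|xx]; first exact: rconj_real.
have [a [b [ga gb xE]]] := real_decP x; rewrite xx {1}xE => /addrI/eqP.
rewrite -subr_eq0 opprK -scalerDr scaler_eq0 (negPf i_neq0) /= -mulr2n -scaler_nat.
by rewrite scaler_eq0 pnatr_eq0 /= => /eqP b0; rewrite xE b0 scaler0 addr0.
Qed.

Lemma rconjK x : rconj (rconj x) = x.
Proof.
have [a [b [ga gb -> ->]]] := real_decP x.
by rewrite -scalerN rconjE ?scalerN ?opprK//; exact: realformN.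
Qed.

Lemma rconjD x y : rconj (x + y) = rconj x + rconj y.
Proof.
have [b [c [gb gc -> ->]]] := real_decP x; have [d [e [gd ge -> ->]]] := real_decP y.
rewrite addrACA -scalerDr rconjE; [|exact: realformD|exact: realformD].
by rewrite scalerDr opprD addrACA.
Qed.

Lemma rconjZr (p : R) x : rconj (p%:C%C *: x) = p%:C%C *: rconj x.
Proof.
have [b [c [gb gc -> ->]]] := real_decP x.
rewrite scalerDr scalerA mulrC -scalerA rconjE; [|exact: realformZ..].
by rewrite scalerBr !scalerA [_ * 'i%C]mulrC.
Qed.

Lemma rconj_i x : rconj ('i%C *: x) = - ('i%C *: rconj x).
Proof.
have [b [c [gb gc -> ->]]] := real_decP x.
rewrite scalerDr scalerA mulii scaleN1r addrC rconjE//; last exact: realformN.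
by rewrite scalerBr scalerA mulii scaleN1r opprK opprD addrC.
Qed.

Lemma rconj_antilinear (a : C) x y : rconj (a *: x + y) = a^*%C *: rconj x + rconj y.
Proof.
rewrite rconjD; congr (_ + _); rewrite [in LHS](complexE a) scalerDl mulrC -scalerA.
rewrite rconjD !rconjZr rconj_i scalerN -scaleNr scalerA -scalerDl; congr (_ *: _).
by case: a => p q; apply/eqP; rewrite eq_complex /= !(mul0r, mulr0, mul1r, mulr1, mulN1r, oppr0, subr0, addr0, add0r, sub0r) !eqxx.
Qed.

Lemma rconjZ (a : C) x : rconj (a *: x) = a^*%C *: rconj x.
Proof. by have := rconj_antilinear a x 0; rewrite (rconj_real realform0) !addr0. Qed.

Lemma rconjN x : rconj (- x) = - rconj x.
Proof. by rewrite -scaleN1r rconjZ rmorphN rmorph1 scaleN1r. Qed.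

Lemma rconjB x y : rconj (x - y) = rconj x - rconj y.
Proof. by rewrite rconjD rconjN. Qed.

Lemma rconj_lie x y : rconj (lie x y) = lie (rconj x) (rconj y).
Proof.
have rl a z : gR a -> rconj (lie a z) = lie a (rconj z).
  move=> ga; have [b [c [gb gc -> ->]]] := real_decP z.
  by rewrite lieDr lieZr rconjE ?lieBr ?lieZr//; exact: real_lie.
have [b [c [gb gc xE xE']]] := real_decP x.
by rewrite xE' {1}xE lieDl lieZl rconjD rconj_i !rl// lieBl lieZl.
Qed.

Lemma rconj_avg x : gR (x + rconj x).
Proof. by apply/rconjP; rewrite rconjD rconjK addrC. Qed.

Lemma conjugate_wrt_rconj x y : conjugate_wrt gR x y -> y = rconj x.
Proof. by move=> [a [b [ga gb -> ->]]]; rewrite rconjE. Qed.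

Variable theta : 'End(g).
Hypothesis theta_aut : lie_automorphism theta.
Hypothesis theta2 : order_two theta.
Hypothesis theta_real : forall x, gR x -> gR (theta x).
Hypothesis cartan : cartan_decomposition gR (gR `&` fixed_part theta)
                          (gR `&` antifixed_part theta).

Lemma thetaK x : theta (theta x) = x.
Proof. by case: theta2 => t2 _; rewrite -comp_lfunE t2 lfunE. Qed.

Lemma theta_lie : lie_morph theta. Proof. by case: theta_aut. Qed.

Lemma theta_rconj x : rconj (theta x) = theta (rconj x).
Proof.
have [b [c [gb gc -> ->]]] := real_decP x.
by rewrite linearD linearZ linearB linearZ /= rconjE//; exact: theta_real.
Qed.

Lemma killing_theta x y : killing (theta x) (theta y) = killing x y.
Proof.
by apply: (killing_morph (psi := theta)) theta_lie _; case: theta2.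
Qed.

Lemma killing_theta_swap x y : killing x (theta y) = killing (theta x) y.
Proof. by rewrite -killing_theta thetaK. Qed.

Lemma cartan_dec x : gR x -> exists k p, [/\ gR k, theta k = k, gR p, theta p = - p & x = k + p].
Proof.
case: cartan => _ [gRE _] _ _ _; rewrite {1}gRE => -[k [gk kk] [p [gp pp] <-]].
by exists k, p.
Qed.

Lemma killing_k_le0 x : gR x -> theta x = x -> killing x x <= 0.
Proof.
case: cartan => _ _ _ neg _ gx tx; have [->|/eqP x0] := eqVneq x 0.
  by rewrite -[0](scale0r x) killingZl mul0r.
by apply/ltW/neg.
Qed.

Lemma killing_p_ge0 x : gR x -> theta x = - x -> 0 <= killing x x.
Proof.
case: cartan => _ _ _ _ pos gx tx; have [->|/eqP x0] := eqVneq x 0.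
  by rewrite -[X in killing X](scale0r x) killingZl mul0r.
by apply/ltW/pos.
Qed.

Lemma killing_k_p x y : theta x = x -> theta y = - y -> killing x y = 0.
Proof.
move=> tx ty; have := killing_theta x y; rewrite tx ty killingNr => /eqP.
by rewrite eq_sym -addr_eq0 -mulr2n -mulr_natl mulf_eq0 pnatr_eq0 => /eqP.
Qed.

(** The sign conditions of the Cartan decomposition say in particular that [killing x x] is real on
    each part; the parts are orthogonal, and polarization does the rest. *)
Lemma killing_real x y : gR x -> gR y -> (killing x y)^*%C = killing x y.
Proof.
have sq z : gR z -> (killing z z)^*%C = killing z z.
  move=> /cartan_dec[k [p [gk tk gp tp ->]]].
  rewrite killingDl !killingDr (killing_k_p tk tp) (killingC p) (killing_k_p tk tp).
  rewrite addr0 add0r rmorphD /=; congr (_ + _).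
    by rewrite -[killing k k]RRe_real ?conjc_real// ler0_real// killing_k_le0.
  by rewrite -[killing p p]RRe_real ?conjc_real// ger0_real// killing_p_ge0.
move=> gx gy; have := sq _ (realformD gx gy).
rewrite killingDl !killingDr (killingC y) !rmorphD /= (sq x gx) (sq y gy).
have gen (A B c' c : C) : A + c' + (c' + B) = A + c + (c + B) -> c' = c.
  move=> e; have : (A + B) + 2 * c' = (A + B) + 2 * c.
    transitivity (A + c' + (c' + B)); first by ring.
    by rewrite e; ring.
  by move=> /addrI; apply: mulfI; rewrite pnatr_eq0.
exact: gen.
Qed.

Lemma killing_rconj x y : killing (rconj x) (rconj y) = (killing x y)^*%C.
Proof.
have [b [c [gb gc -> ->]]] := real_decP x; have [d [e [gd ge -> ->]]] := real_decP y.
rewrite !killingDl !killingDr !killingNl !killingNr !killingZl !killingZr.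
rewrite !(conjcD, conjcM, killing_real) // conjc_i.
by ring.
Qed.

(** On [gR] this follows from definiteness on the two orthogonal parts of the Cartan decomposition.
    In general the radical is stable under [rconj], hence contains the real and imaginary components
    of its elements. *)
Lemma killing_nondeg x : (forall y, killing x y = 0) -> x = 0.
Proof.
have nd z : gR z -> (forall y, killing z y = 0) -> z = 0.
  move=> /cartan_dec[k [p [gk tk gp tp ->]]] h.
  have := h k; rewrite killingDl (killingC p) (killing_k_p tk tp) addr0 => kk.
  have := h p; rewrite killingDl (killing_k_p tk tp) add0r => pp.
  case: cartan => _ _ _ neg pos.
  have -> : k = 0.
    by apply/eqP/negPn/negP => /eqP k0; have := neg k (conj gk tk) k0; rewrite kk ltxx.
  have -> : p = 0; last by rewrite addr0.
  by apply/eqP/negPn/negP => /eqP p0; have := pos p (conj gp tp) p0; rewrite pp ltxx.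
move=> h; have [a [b [ga gb xE cE]]] := real_decP x.
have hc y : killing (rconj x) y = 0.
  by rewrite -[y]rconjK killing_rconj h conjc0.
have a0 : a = 0.
  apply: nd => // y; have -> : a = 2^-1 *: (x + rconj x).
    rewrite cE {1}xE addrACA subrr addr0 -mulr2n -[a *+ 2]scaler_nat.
    by rewrite scalerA mulVf ?scale1r// pnatr_eq0.
  by rewrite killingZl killingDl h hc addr0 mulr0.
have b0 : b = 0.
  apply: nd => // y; move: (h y); rewrite xE a0 add0r killingZl => /eqP.
  by rewrite mulf_eq0 (negPf i_neq0) => /eqP.
by rewrite xE a0 b0 scaler0 addr0.
Qed.

Definition cartan_conj x : g := theta (rconj x).
Local Notation tau := cartan_conj.

Lemma tauD x y : tau (x + y) = tau x + tau y.
Proof. by rewrite /tau rconjD linearD. Qed.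
Lemma tauZ a x : tau (a *: x) = a^*%C *: tau x.
Proof. by rewrite /tau rconjZ linearZ. Qed.
Lemma tauN x : tau (- x) = - tau x.
Proof. by rewrite /tau rconjN linearN. Qed.
Lemma tauB x y : tau (x - y) = tau x - tau y.
Proof. by rewrite tauD tauN. Qed.
Lemma tau_lie x y : tau (lie x y) = lie (tau x) (tau y).
Proof. by rewrite /tau rconj_lie theta_lie. Qed.
Lemma tauK x : tau (tau x) = x.
Proof. by rewrite /tau theta_rconj thetaK rconjK. Qed.
Lemma tau_theta x : tau (theta x) = theta (tau x).
Proof. by rewrite /tau theta_rconj. Qed.
Lemma killing_tau x y : killing (tau x) (tau y) = (killing x y)^*%C.
Proof. by rewrite killing_theta killing_rconj. Qed.

Definition cartan_form x y : C := - killing x (tau y).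
Local Notation hf := cartan_form.

Lemma cartan_form_real a : gR a -> 0 <= hf a a /\ (hf a a = 0 -> a = 0).
Proof.
move=> /[dup] ga /cartan_dec[k [p [gk tk gp tp aE]]].
have -> : hf a a = - killing k k + killing p p.
  rewrite /hf /tau rconj_real// aE linearD /= tk tp killingDl !killingDr !killingNr.
  by rewrite (killingC p k) (killing_k_p tk tp); ring.
have k0 := killing_k_le0 gk tk; have p0 := killing_p_ge0 gp tp.
split; first by rewrite addr_ge0// oppr_ge0.
move=> /eqP; rewrite paddr_eq0 ?oppr_ge0// oppr_eq0 => /andP[/eqP kk /eqP pp].
case: cartan => _ _ _ neg pos; rewrite aE.
have -> : k = 0.
  by apply/eqP/negPn/negP => /eqP kn; have := neg k (conj gk tk) kn; rewrite kk ltxx.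
have -> : p = 0; last by rewrite addr0.
by apply/eqP/negPn/negP => /eqP pn; have := pos p (conj gp tp) pn; rewrite pp ltxx.
Qed.

Lemma cartan_form_posdef : hermitian_posdef hf.
Proof.
split=> [a x y z|x y|x x0].
- by rewrite /hf killingDl killingZl opprD mulrN.
- by rewrite /hf rmorphN /= -killing_tau tauK killingC.
have [a [b [ga gb xE _]]] := real_decP x.
have -> : hf x x = hf a a + hf b b.
  rewrite /hf xE tauD tauZ killingDl !killingDr !killingZl !killingZr.
  have -> : killing b (tau a) = killing a (tau b).
    by rewrite /tau !rconj_real// killing_theta_swap killingC.
  rewrite conjc_i; transitivity (- killing a (tau a) + ('i%C * 'i%C) * killing b (tau b)).
    by ring.
  by rewrite mulii mulN1r.
have [a0 aa] := cartan_form_real ga; have [b0 bb] := cartan_form_real gb.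
rewrite lt0r addr_ge0// andbT paddr_eq0//; apply: contra x0 => /andP[/eqP/aa ea /eqP/bb eb].
by rewrite xE ea eb scaler0 addr0.
Qed.

Lemma cartan_form_lie u x y : hf (lie u x) y = - hf x (lie (tau u) y).
Proof. by rewrite /hf killing_lie tau_lie tauK. Qed.

End RealForm.

(** * Unitary automorphisms *)

Section ComplexCompactness.
Variable R : realType.
Local Notation C := (R[i] : numFieldType).

Lemma compact_square (B : R) :
  compact [set z : C | `|complex.Re z| <= B /\ `|complex.Im z| <= B].
Proof.
pose S : set R := `[- B, B]%classic.
pose f (p : R * R) : C := p.1%:C%C + 'i%C * p.2%:C%C.
rewrite (_ : mkset _ = f @` (S `*` S)); last first.
  apply/seteqP; split=> [z [zr zi]|_ [[a b] [/= Sa Sb] <-]].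
    exists (complex.Re z, complex.Im z); last by rewrite /f /= -complexE.
    by split; rewrite /S /= in_itv /= -ler_norml.
  move: Sa Sb; rewrite /S /= !in_itv /= -!ler_norml => Sa Sb.
  by rewrite /f /= !(mul0r, mulr0, mul1r, subr0, addr0, add0r, sub0r, oppr0).
apply: continuous_compact; last first.
  by apply: compact_setX; exact: segment_compact.
apply: continuous_subspaceT => -[a b].
have rc (h : R * R -> R) : {for (a, b), continuous h} ->
    (fun p => (h p)%:C%C : C) @ (a, b) --> ((h (a, b))%:C%C : C).
  move=> hc; apply/cvgrPdist_lt => -[e e'].
  rewrite ltcE /= => /andP[/eqP -> e0].
  move/cvgrPdist_lt : hc => /(_ e e0); apply: filterS => p hp.
  by rewrite -rmorphB normc_def /= expr0n addr0 sqrtr_sqr ltcR.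
apply: cvgD; first by apply: (rc fst); exact: cvg_fst.
by apply: cvgM; [exact: cvg_cst|apply: (rc snd); exact: cvg_snd].
Qed.

(** Boundedness places [A] in a product of compact squares, and sequential closedness suffices
    because a point of the closure is approached by points of [A] within 1/(k+1). *)
Lemma compact_rV_criterion n (A : set 'rV[C]_n) (B : R) :
  (forall v, A v -> forall j, `|v 0 j| <= B%:C%C) ->
  (forall (u : nat -> 'rV[C]_n) (l : 'rV[C]_n), (forall k, A (u k)) ->
     (forall j, (fun k => u k 0 j) @ \oo --> l 0 j) -> A l) ->
  compact A.
Proof.
move=> AB Acl.
have cB : compact [set v : 'rV[C]_n | forall j,
    [set z : C | `|complex.Re z| <= B /\ `|complex.Im z| <= B] (v 0 j)].
  by apply: (@rV_compact C n (fun=> _)) => _; exact: compact_square.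
apply: subclosed_compact cB _; last first.
  move=> v Av j /=; split; rewrite -lecR (le_trans _ (AB v Av j))//.
    exact: normc_ge_Re.
  exact: normc_ge_Im.
move=> l cl.
have ex k : exists v, A v /\ forall j, `|l 0 j - v 0 j| < k.+1%:R^-1.
  have k0 : 0 < k.+1%:R^-1 :> C by rewrite invr_gt0.
  have [v [Av [_ lv]]] := cl _ (nbhsx_ballx l _ k0).
  by exists v; split => // j; exact: lv.
have [u uP] := choice ex.
apply: (Acl u) => [k|j]; first by case: (uP k).
apply/cvgrPdist_lt => e e0.
have eR : e = (complex.Re e)%:C%C by rewrite RRe_real ?gtr0_real.
have e0' : 0 < complex.Re e by rewrite -ltcR -eR.
near=> k; have [_ /(_ j) /lt_trans] := uP k; apply.
rewrite eR -[k.+1%:R](rmorph_nat (real_complex R)) -fmorphV ltcR.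
by near: k; have := near_infty_natSinv_lt (PosNum e0'); exact.
Unshelve. all: by end_near. Qed.

Lemma euclidean_compact_criterion (V : vectType R[i]) (A : set V) (B : R) :
  (forall v, A v -> forall j, `|vcoord j v| <= B%:C%C) ->
  (forall (u : nat -> V) l, (forall k, A (u k)) ->
     (forall j, (fun k => vcoord j (u k) : C) @ \oo --> (vcoord j l : C)) -> A l) ->
  euclidean_compact A.
Proof.
have cE (v : V) j : coords v 0 j = vcoord j v by rewrite mxE.
have vb : basis_of {:V} (vbasis {:V}) by exact: vbasisP.
move=> AB Acl; apply: (@compact_rV_criterion _ _ B) => [_ [v Av <-] j|u l uA ul].
  by rewrite cE; exact: AB.
exists (vecof (vbasis {:V}) l); last by rewrite /coords vecofK.
pose w k := vecof (vbasis {:V}) (u k).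
have wu k : coords (w k) = u k by rewrite /coords vecofK.
apply: (Acl w) => [k|j].
  by have [v Av vu] := uA k; rewrite /w -vu /coords rVofK.
rewrite -cE (_ : coords _ = l); last by rewrite /coords vecofK.
rewrite (_ : (fun k => _) = fun k => u k 0 j)//.
by apply/funext => k; rewrite -cE wu.
Qed.
End ComplexCompactness.

(** * Arguments of complex numbers near 1 *)

Section Cis.
Variable R : realType.
Local Notation C := (R[i] : numFieldType).

Definition cis (t : R) : R[i] := (cos t +i* sin t)%C.

Lemma cisD s t : cis (s + t) = cis s * cis t.
Proof.
by apply/eqP; rewrite eq_complex /= cosD sinD [sin s * _ + _]addrC !eqxx.
Qed.

Lemma cisN t : cis (- t) * cis t = 1.
Proof. by rewrite -cisD addNr /cis cos0 sin0. Qed.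

Lemma cexp_cis (t : R) : cexp ('i%C * t%:C%C) = cis t.
Proof.
have [_ h] := cexp_sum ('i%C * t%:C%C : R[i]).
apply: (cvg_unique (@norm_hausdorff _ C) h).
have coefE k : ('i%C * t%:C%C : R[i]) ^+ k / k`!%:R =
    (cos_coeff t k)%:C%C + 'i%C * (sin_coeff t k)%:C%C.
  have ik : ('i%C : R[i]) ^+ k = (if odd k then 'i%C else 1) * (-1) ^+ k./2.
    rewrite -{1}(odd_double_half k) exprD -mul2n exprM sqr_i.
    by case: (odd k); rewrite ?expr1 ?expr0.
  rewrite exprMn ik /cos_coeff /sin_coeff /= -[_ ^ _]/((-1) ^+ k./2).
  rewrite !rmorphM !rmorphXn !rmorphN1 !fmorphV !rmorph_nat.
  case: ifP => ok /=; last by rewrite !mul0r mulr0 addr0 !mul1r.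
  have -> : k.-1./2 = k./2 by case: k ok {ik} => //= k ok; rewrite uphalf_half (negPf ok).
  by rewrite !mul0r add0r mul1r !mulrA.
apply/cvg_complexP; split.
  rewrite (_ : (fun n => _) = series (cos_coeff t)) /=; last first.
    apply/funext => n; rewrite /series /= big_mkord; apply: (etrans (Re_sum n (fun k => ('i%C * t%:C%C : R[i]) ^+ k / k`!%:R))).
    apply: eq_bigr => k _.
    by rewrite coefE /= !(mul0r, mulr0, mul1r, mulr1, subr0, addr0, add0r, sub0r, oppr0).
  by rewrite /cis /= unlock; exact: is_cvg_series_cos_coeff.
rewrite (_ : (fun n => _) = series (sin_coeff t)) /=; last first.
  apply/funext => n; rewrite /series /= big_mkord; apply: (etrans (Im_sum n (fun k => ('i%C * t%:C%C : R[i]) ^+ k / k`!%:R))).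
  apply: eq_bigr => k _.
  by rewrite coefE /= !(mul0r, mulr0, mul1r, mulr1, subr0, addr0, add0r, sub0r, oppr0).
by rewrite /cis /= unlock; exact: is_cvg_series_sin_coeff.
Qed.

Lemma cis_eq1 (t : R) : cis t = 1 -> `|t| < 1 -> t = 0.
Proof.
move=> [ct _] t1; apply/eqP; rewrite -normr_eq0; apply/eqP; apply: cos_inj.
- by rewrite in_itv /= normr_ge0 /=; have := pi_ge2 R; lra.
- by rewrite in_itv /= lexx pi_ge0.
by rewrite cos0 -ct; have [//|] := ger0P t; rewrite cosN.
Qed.

(** A number of modulus 1 this close to 1 has an argument below 1/3 in absolute value. A relation
    among three such arguments modulo 2 pi is then an equality, by [cis_eq1]. *)
Definition cis_radius : R := 1 - cos (1 / 3).

Lemma third_in_0pi : (1 / 3 : R) \in `[0, pi].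
Proof.
rewrite in_itv /=; have pi2 := pi_ge2 R.
by apply/andP; split; lra.
Qed.

Lemma cis_radius_gt0 : 0 < cis_radius.
Proof.
have z : (0 : R) \in `[0, pi] by rewrite in_itv /= lexx pi_ge0.
by rewrite subr_gt0 -[X in _ < X]cos0 (ltr_cos z third_in_0pi); lra.
Qed.

Lemma cis_exists (a : R[i]) : a * a^*%C = 1 -> `|a - 1| < cis_radius%:C%C ->
  exists2 t : R, `|t| < 1 / 3 & a = cis t.
Proof.
case: a => c s a1 anear.
have cs : c ^+ 2 + s ^+ 2 = 1.
  by move: a1 => /eqP; rewrite eq_complex /= mulrN opprK -!expr2 => /andP[/eqP].
have c1 : -1 <= c <= 1.
  by have s2 := sqr_ge0 s; apply/andP; split; nra.
have cnear : `|1 - c| < cis_radius.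
  rewrite -ltcR (le_lt_trans _ anear)// distrC.
  by have := normc_ge_Re ((c +i* s)%C - 1).
have c13 : cos (1 / 3) < c.
  by move: cnear; rewrite ltr_norml /cis_radius => /andP[_]; rewrite ltrD2l ltrN2.
have t0 : 0 <= acos c by exact: acos_ge0.
have tpi : acos c \in `[0, pi] by rewrite in_itv /= t0 acos_lepi.
have cc : cos (acos c) = c by rewrite acosK// in_itv.
have t13 : acos c < 1 / 3.
  by rewrite -(ltr_cos tpi third_in_0pi) cc.
have ss : `|s| = sin (acos c).
  by rewrite sin_acos// -cs addrAC subrr add0r sqrtr_sqr.
have [s0|s0] := ler0P s.
  exists (- acos c); first by rewrite normrN ger0_norm.
  by rewrite /cis cosN sinN cc -ss ler0_norm// opprK.
exists (acos c); first by rewrite ger0_norm.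
by rewrite /cis cc -ss gtr0_norm.
Qed.
End Cis.

(** * Logarithms of unitary automorphisms near the identity *)

Section UnitaryLogarithm.
Variables (R : realType) (g : lieAlgType R[i]) (h : g -> g -> R[i]).
Hypothesis hP : hermitian_posdef h.

Lemma cauchy_schwarz (u b : g) : `|h u b| ^+ 2 <= h u u * h b b.
Proof.
have [->|b0] := eqVneq b 0; first by rewrite !(herm0r hP) normr0 expr0n mulr0.
have bb := herm_gt0 hP b0.
have := herm_ge0 hP (u - (h u b / h b b) *: b).
rewrite (hermBl hP) !(hermBr hP) !(hermZl hP) !(hermZr hP).
have -> : h b u = (h u b)^*%C by rewrite (herm_conj hP u b).
have -> : (h u b / h b b)^*%C = (h u b)^*%C / h b b.
  by rewrite conjcM conjc_inv -(herm_conj hP b b).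
rewrite sqr_normc; set c := h u b; set c' := c^*%C; set bt := h b b => h0.
rewrite -subr_ge0 -(pmulr_rge0 _ (x := bt^-1)) ?invr_gt0//.
have -> : bt^-1 * (h u u * bt - c * c') =
  h u u - c' / bt * c - (c / bt * c' - c / bt * (c' / bt * bt)).
  by field; exact: lt0r_neq0.
by [].
Qed.

Lemma parseval (X : seq g) (v : g) : orthogonal_expansion h fullv X ->
  h v v = \sum_(b <- X) `|h v b| ^+ 2 / h b b.
Proof.
move=> [XU _ _ Xe]; rewrite {1}(Xe v (memvf v)) (herm_suml hP).
apply: eq_big_seq => b bX; rewrite (hermZl hP) (herm_conj hP v b) sqr_normc.
by rewrite mulrAC.
Qed.

Variable chi : 'End(g).
Hypothesis chi_morph : lie_morph chi.
Hypothesis chi_unitary : forall x y, h (chi x) (chi y) = h x y.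

Lemma unitary_eigenvalue b a : b != 0 -> chi b = a *: b -> a * a^*%C = 1.
Proof.
move=> b0 cb; have := chi_unitary b b; rewrite cb (hermZl hP) (hermZr hP) mulrA.
by rewrite -[RHS]mul1r => /mulIf; apply; exact: herm_neq0 b0.
Qed.

Lemma unitary_orthogonal_eigenbasis :
  exists2 X, orthogonal_expansion h fullv X & forall x, x \in X -> exists a, chi x = a *: x.
Proof.
apply: (orthogonal_eigenbasis hP) => [x _|b a _ cb x _ xb]; first exact: memvf.
have [->|b0] := eqVneq b 0; first exact: (herm0r hP).
have aa := unitary_eigenvalue b0 cb.
have bE : b = a^*%C *: chi b by rewrite cb scalerA mulrC aa scale1r.
by rewrite bE (hermZr hP) chi_unitary xb mulr0.
Qed.

(** The right-hand side is the squared Hilbert-Schmidt norm of chi - 1. Unitarity gives h (chi y -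
    y, b) = (a - 1) h (y, b), and Cauchy-Schwarz with Parseval concludes. *)
Lemma unitary_eigenvalue_bound (X : seq g) b a :
  orthogonal_expansion h fullv X -> b != 0 -> chi b = a *: b ->
  `|a - 1| ^+ 2 <= \sum_(y <- X) h (chi y - y) (chi y - y) / h y y.
Proof.
move=> XP b0 cb; have bb := herm_gt0 hP b0; have [XU _ _ _] := XP.
rewrite -(ler_pM2r bb) [X in _ * X <= _](parseval b XP) mulr_suml mulr_sumr.
rewrite big_seq [leRHS]big_seq ler_sum// => y yX.
have [_ y0] := XU y yX; have yy := herm_gt0 hP y0.
rewrite mulrA [leRHS]mulrAC ler_pM2r ?invr_gt0// -exprMn.
have aa := unitary_eigenvalue b0 cb.
have bE : b = a^*%C *: chi b by rewrite cb scalerA mulrC aa scale1r.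
have e : h (chi y - y) b = (a - 1) * h y b.
  rewrite (hermBl hP) mulrBl mul1r; congr (_ - _).
  by rewrite {1}bE (hermZr hP) chi_unitary conjcK.
rewrite (_ : `|h b y| = `|h y b|); last by rewrite (herm_conj hP) normcJ.
by rewrite -normrM -e cauchy_schwarz.
Qed.

(** Take D to be diagonal in an orthogonal eigenbasis of chi, with small imaginary logarithms of the
    eigenvalues. If [b, c] has a component along d, the eigenvalues satisfy the multiplicative
    relation, hence their small arguments the additive one: D is a derivation, thus inner. *)
Lemma unitary_inner :
  (forall x : g, (forall y, killing x y = 0) -> x = 0) ->
  (forall b a, b != 0 -> chi b = a *: b -> `|a - 1| < (cis_radius R)%:C%C) ->
  exists d, chi = lfun_exp (ad d).
Proof.
move=> nondeg near1.
have [X XP Xeig] := unitary_orthogonal_eigenbasis; have [XU Xo Xu Xe] := XP.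
have ex b : exists t : R, b \in X -> `|t| < 1 / 3 /\ chi b = cis t *: b.
  have [bX|] := boolP (b \in X); last by exists 0.
  have [_ b0] := XU b bX; have [a cb] := Xeig b bX.
  have [t t3 at'] := cis_exists (unitary_eigenvalue b0 cb) (near1 _ _ b0 cb).
  by exists t => _; rewrite -at'.
have [t tP] := choice ex.
pose s b : R[i] := 'i%C * (t b)%:C%C.
pose F v := \sum_(b <- X) (h v b / h b b) *: (s b *: b).
have lF : linear F.
  move=> a x y; rewrite /F scaler_sumr -big_split; apply: eq_bigr => b _ /=.
  by rewrite (hermDl hP) (hermZl hP) mulrDl scalerDl !scalerA -!mulrA.
pose F' : {linear g -> g} := HB.pack F (GRing.isLinear.Build _ _ _ _ F lF).
pose D : 'End(g) := linfun F'.
have DE v : D v = F v by rewrite lfunE.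
have DX b : b \in X -> D b = s b *: b.
  move=> bX; have [_ b0] := XU b bX; have bn := herm_neq0 hP b0.
  rewrite DE /F (bigD1_seq b)//= divff// scale1r big_seq_cond big1 ?addr0// => c.
  by move=> /andP[cX cb]; rewrite Xo// ?mul0r ?scale0r// eq_sym.
have ext (f f' : 'End(g)) : (forall b, b \in X -> f b = f' b) -> forall v, f v = f' v.
  move=> ff v; rewrite [v]Xe ?memvf// !linear_sum.
  by apply: eq_big_seq => b bX; rewrite !linearZ /= ff.
have derX b c : b \in X -> c \in X -> D (lie b c) = lie (D b) c + lie b (D c).
  move=> bX cX; rewrite (DX b bX) (DX c cX) lieZl lieZr -scalerDl.
  have [tb cb] := tP b bX; have [tc cc] := tP c cX.
  have cbc : chi (lie b c) = cis (t b + t c) *: lie b c.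
    by rewrite chi_morph cb cc lieZl lieZr scalerA -cisD.
  rewrite DE /F [in RHS](Xe (lie b c)) ?memvf// scaler_sumr.
  apply: eq_big_seq => d dX; rewrite scalerA scalerA.
  have [_ d0] := XU d dX; have dn := herm_neq0 hP d0; have [td cd] := tP d dX.
  have [->|g0] := eqVneq (h (lie b c) d) 0; first by rewrite mul0r mul0r mulr0.
  suff : t d = t b + t c by move=> td'; rewrite /s td' mulrC rmorphD mulrDr.
  have dE : d = (cis (t d))^*%C *: chi d.
    by rewrite cd scalerA mulrC (unitary_eigenvalue d0 cd) scale1r.
  have e : cis (t b + t c) = cis (t d).
    apply: (mulIf g0); rewrite -(hermZl hP) -cbc {1}dE (hermZr hP) chi_unitary.
    by rewrite conjcK.
  have /cis_eq1 : cis (t b + t c - t d) = 1 by rewrite cisD e mulrC cisN.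
  move=> h1; apply/esym/eqP; rewrite -subr_eq0; apply/eqP/h1.
  (* Three arguments below 1/3 combine to less than 1, the threshold of [cis_eq1]. *)
  rewrite (le_lt_trans (ler_normB _ _))//.
  rewrite (le_lt_trans (lerD (ler_normD _ _) (lexx _)))//; lra.
have der x y : D (lie x y) = lie (D x) y + lie x (D y).
  have derl b : b \in X -> forall z, D (lie b z) = lie (D b) z + lie b (D z).
    move=> bX z.
    have := ext (D \o ad b)%VF (ad (D b) + (ad b \o D)%VF) _ z.
    rewrite lfunD_E !comp_lfunE !adE; apply=> c cX.
    by rewrite lfunD_E !comp_lfunE !adE derX.
  have := ext (D \o ad x)%VF (ad (D x) + (ad x \o D)%VF) _ y.
  rewrite lfunD_E !comp_lfunE !adE; apply=> c cX.
  rewrite lfunD_E !comp_lfunE !adE (lie_antisym x c) linearN /= derl// opprD addrC.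
  by rewrite -(lie_antisym x) -(lie_antisym (D x)).
have [d Dd] := derivation_inner nondeg der; exists d; rewrite -Dd.
apply/lfunP; apply: ext => b bX; rewrite (lfun_exp_eigen (DX b bX)).
by have [_ ->] := tP b bX; rewrite /s cexp_cis.
Qed.
End UnitaryLogarithm.

(** * Zariski closed sets *)

Section ZariskiTopology.
Variables (F : fieldType) (V : vectType F).

Definition polyfunV (phi : V -> F) : Prop :=
  exists2 psi : ('I_(\dim {:V}) -> F) -> F, polyfun psi &
    forall v, phi v = psi (fun j => vcoord j v).

Lemma polyfunV_cst c : polyfunV (fun=> c).
Proof. by exists (fun=> c) => //; exact: polyfun_cst. Qed.

Lemma polyfunV_scalar (ell : {scalar V}) : polyfunV ell.
Proof.
exists (fun y : 'I_(\dim {:V}) -> F => \sum_(j < \dim {:V}) y j * ell (vbasis {:V})`_j); last exact: scalar_vcoord.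
by apply: polyfun_sum => j; apply: polyfunM; [exact: polyfun_coord|exact: polyfun_cst].
Qed.

Lemma polyfunVD phi psi : polyfunV phi -> polyfunV psi -> polyfunV (fun v => phi v + psi v).
Proof.
move=> [p pp ph] [q qq qh]; exists (fun y => p y + q y); first exact: polyfunD.
by move=> v; rewrite ph qh.
Qed.

Lemma zariski_closed_zero (I : Type) (phi : I -> V -> F) :
  (forall i, polyfunV (phi i)) -> zariski_closed [set v | forall i, phi i v = 0].
Proof.
move=> h; have coordE (v : V) : (fun j => vcoord j v) =1 (rVof (vbasis {:V}) v 0).
  by move=> j; rewrite mxE.
have pE p v : mpoly.meval (rVof (vbasis {:V}) v 0) p = mpoly.meval (fun j => vcoord j v) p.
  by congr (mpoly.meval _ _); apply/funext => j; rewrite coordE.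
have P i : exists p, forall v, phi i v = mpoly.meval (fun j => vcoord j v) p.
  by have [psi [p pp] e] := h i; exists p => v; rewrite e pp.
have [p pP] := choice P.
exists [set q | exists i, q = p i]; apply/seteqP; split=> v /= hv.
  by move=> _ [i ->]; rewrite pE -pP.
by move=> i; rewrite pP -pE; apply: hv; exists i.
Qed.

Lemma zariski_closedP (A : set V) : zariski_closed A ->
  exists P : set (mpoly.mpoly (\dim {:V}) F),
    forall v, A v <-> forall p, P p -> mpoly.meval (fun j => vcoord j v) p = 0.
Proof.
move=> [P ->]; exists P => v /=.
suff -> : rVof (vbasis {:V}) v 0 = (fun j => vcoord j v) by [].
by apply/funext => j; rewrite mxE.
Qed.

End ZariskiTopology.

Section ZariskiLimits.
Variables (R : realType) (V : vectType R[i]).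
Local Notation C := (R[i] : numFieldType).

Definition vcvg (u : nat -> V) (l : V) : Prop :=
  forall j, (fun n => vcoord j (u n) : C) @ \oo --> (vcoord j l : C).

Lemma vcvg_scalar u l (ell : {scalar V}) :
  vcvg u l -> (fun n => ell (u n) : C) @ \oo --> (ell l : C).
Proof.
move=> ul; have [psi pp h] := polyfunV_scalar ell; rewrite h.
rewrite (_ : (fun n => _) = fun n => psi ((fun j => vcoord j (u n)))); last first.
  by apply/funext => n; rewrite h.
exact: (@cvg_polyfun C _ nat eventually _ psi (fun n j => vcoord j (u n)) (fun j => vcoord j l) pp ul).
Qed.

Lemma zariski_closed_lim (A : set V) u l :
  zariski_closed A -> (forall n, A (u n)) -> vcvg u l -> A l.
Proof.
move=> /zariski_closedP[P AP] Au ul; apply/AP => p Pp.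
have pp : @polyfun R[i] _ (fun y => mpoly.meval y p) by exists p.
apply: (@cvg_zero C (fun n => mpoly.meval ((fun j => vcoord j (u n))) p)).
  exact: (@cvg_polyfun C _ nat eventually _ _ (fun n j => vcoord j (u n)) (fun j => vcoord j l) pp ul).
by move=> n; have /AP := Au n; apply.
Qed.

Lemma vcvg_unique u l l' : vcvg u l -> vcvg u l' -> l = l'.
Proof.
move=> ul ul'; apply: vcoordP => j.
exact: (cvg_unique (@norm_hausdorff _ C) (ul j) (ul' j)).
Qed.
End ZariskiLimits.

Section VectorLimits.
Variables (R : realType) (V W : vectType R[i]).
Local Notation C := (R[i] : numFieldType).

Lemma vcvg_linear (f : {linear V -> W}) u l :
  vcvg u l -> vcvg (fun n => f (u n)) (f l).
Proof.
move=> ul j.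
have lf : linear_for *%R (fun v => vcoord j (f v)) by move=> a x y; rewrite !linearP.
pose ell : {scalar V} := HB.pack (fun v => vcoord j (f v))
  (GRing.isLinear.Build _ _ _ _ (fun v => vcoord j (f v)) lf).
exact: (vcvg_scalar (ell := ell) ul).
Qed.

Lemma cvg_conjc (u : nat -> C) (l : C) :
  u @ \oo --> l -> (fun n => (u n)^*%C : C) @ \oo --> (l^*%C : C).
Proof.
move=> /cvg_complexP[ur ui]; apply/cvg_complexP; split.
  rewrite (_ : (fun n => _) = fun n => complex.Re (u n)).
    by rewrite (_ : complex.Re _ = complex.Re l) //; case: (l).
  by apply/funext => n; case: (u n).
rewrite (_ : (fun n => _) = - (fun n => complex.Im (u n))).
  by rewrite (_ : complex.Im _ = - complex.Im l); [exact: cvgN|case: (l)].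
by apply/funext => n; transitivity (- complex.Im (u n)) => //; case: (u n).
Qed.

Lemma vcvg_antilinear (T : V -> V) u l :
  (forall a x y, T (a *: x + y) = a^*%C *: T x + T y) ->
  vcvg u l -> vcvg (fun n => T (u n)) (T l).
Proof.
move=> aT ul j.
have lT : linear_for *%R (fun v => (vcoord j (T v))^*%C).
  by move=> a x y; rewrite aT linearP /= rmorphD rmorphM /= conjcK.
pose ell : {scalar V} := HB.pack (fun v => (vcoord j (T v))^*%C)
  (GRing.isLinear.Build _ _ _ _ (fun v => (vcoord j (T v))^*%C) lT).
have := cvg_conjc (vcvg_scalar (ell := ell) ul); rewrite /= conjcK.
rewrite (_ : (fun n => _) = fun n => vcoord j (T (u n)) : C) //.
by apply/funext => n; rewrite conjcK.
Qed.
End VectorLimits.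

(** Linear identities between vectors are checked coordinatewise, where [ring] applies. *)
Ltac module_ring :=
  apply: vcoordP => ?; rewrite ?(vcoordD, vcoordN, vcoord0, vcoordZ); ring.

(** * Relations in an sl2-triple *)

Section Sl2.
Variables (F : numClosedFieldType) (g : lieAlgType F) (e h f : g).
Hypothesis sl2 : sl2_triple e h f.

Lemma lie_he : lie h e = 2 *: e. Proof. by case: sl2. Qed.
Lemma lie_hf : lie h f = - (2 *: f). Proof. by case: sl2. Qed.
Lemma lie_ef : lie e f = h. Proof. by case: sl2. Qed.
Lemma lie_eh : lie e h = - (2 *: e). Proof. by rewrite lie_antisym lie_he. Qed.
Lemma lie_fh : lie f h = 2 *: f. Proof. by rewrite lie_antisym lie_hf opprK. Qed.
Lemma lie_fe : lie f e = - h. Proof. by rewrite lie_antisym lie_ef. Qed.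

(** Jacobson's lemma for [e = lie e w] with w = - h / 2, as e commutes with itself. *)
Lemma sl2_nilpotent : nilpotent_elt g e.
Proof.
have eE : e = lie e (- (2^-1 *: h)).
  by rewrite lieNr lieZr lie_eh scalerN opprK scalerA mulVf ?scale1r// pnatr_eq0.
by rewrite eE; apply: jacobson_nilpotent; rewrite -eE liexx.
Qed.
End Sl2.

Section HermitianLimits.
Variables (R : realType) (V : vectType R[i]) (h : V -> V -> R[i]).
Hypothesis hP : hermitian_posdef h.
Local Notation C := (R[i] : numFieldType).

Lemma orthogonal_expansion_ex : exists X, orthogonal_expansion h fullv X.
Proof.
have [||X XP _] := @orthogonal_eigenbasis _ _ _ hP \1%VF fullv.
- by move=> x _; exact: memvf.
- by move=> b a _ _ x _; rewrite lfunE.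
by exists X.
Qed.
End HermitianLimits.

Section CompactPart.
Variables (R : realType) (g : lieAlgType R[i]) (gR : set g) (theta : 'End(g)).
Local Notation C := (R[i] : numFieldType).
Hypothesis rf : real_form gR.
Hypothesis theta_aut : lie_automorphism theta.
Hypothesis theta2 : order_two theta.
Hypothesis theta_real : forall x, gR x -> gR (theta x).
Hypothesis cartan : cartan_decomposition gR (gR `&` fixed_part theta)
                          (gR `&` antifixed_part theta).
Local Notation sigma := (rconj rf).
Local Notation tau := (cartan_conj rf theta).
Local Notation hf := (cartan_form rf theta).
Let hP : hermitian_posdef hf.
Proof. exact: cartan_form_posdef. Qed.

Lemma unitary_real_morph (phi psi : 'End(g)) :
  lie_morph phi -> (phi \o psi = \1)%VF ->
  (forall x, sigma (phi x) = phi (sigma x)) ->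
  (forall x, theta (phi x) = phi (theta x)) ->
  forall x y, hf (phi x) (phi y) = hf x y.
Proof.
move=> pm pp ps pt x y; rewrite /cartan_form /cartan_conj ps pt.
by rewrite (killing_morph _ _ pm pp).
Qed.

Lemma vcvg_herm0 (u : nat -> g) : vcvg u 0 -> (fun n => hf (u n) (u n) : C) @ \oo --> (0 : C).
Proof.
move=> u0; have [X XP] := orthogonal_expansion_ex hP.
have : (fun n => \sum_(b <- X) (`|hf (u n) b| ^+ 2 / hf b b : C)) @ \oo -->
    \sum_(b <- X) (0 : C).
  apply: cvg_sum_seq => b.
  have ub : (fun n => hf (u n) b : C) @ \oo --> (0 : C).
    by have := vcvg_scalar (ell := hermL hP b) u0; rewrite linear0.
  have nb : (fun n => `|hf (u n) b| : C) @ \oo --> (`|0 : C|).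
    exact: cvg_norm ub.
  have cb : (fun=> (hf b b)^-1 : C) @ \oo --> ((hf b b)^-1 : C) by exact: cvg_cst.
  have := cvgM (cvgM nb nb) cb; rewrite normr0 !mul0r => H.
  exact: H.
rewrite big1_eq (_ : (fun n => _) = fun n => hf (u n) (u n))//.
by apply/funext => n; rewrite -(parseval hP _ XP).
Qed.

Lemma vcvg_lie (u v : nat -> g) (x y : g) :
  vcvg u x -> vcvg v y -> vcvg (fun n => lie (u n) (v n)) (lie x y).
Proof.
move=> ux vy j; pose b := vbasis {:g}.
have lieE (p q : g) : vcoord j (lie p q) =
    \sum_(k < \dim {:g}) \sum_(l < \dim {:g})
      (vcoord k p * vcoord l q) * vcoord j (lie b`_k b`_l).
  rewrite {1}[p]vcoord_sum lie_suml linear_sum; apply: eq_bigr => k _.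
  rewrite lieZl scalarZ {1}[q]vcoord_sum (linear_sum (lie b`_k)) linear_sum mulr_sumr.
  by apply: eq_bigr => l _; rewrite /= lieZr scalarZ mulrA.
rewrite lieE (_ : (fun n => _) = fun n => \sum_(k < \dim {:g}) (\sum_(l < \dim {:g})
      (vcoord k (u n) * vcoord l (v n)) * vcoord j (lie b`_k b`_l) : C)).
  apply: cvg_sum_seq => k; apply: cvg_sum_seq => l.
  by apply: cvgM; [apply: cvgM; [exact: ux|exact: vy]|exact: cvg_cst].
by apply/funext => n; exact: lieE.
Qed.

Lemma vcvg_eval (V : vectType R[i]) (u : nat -> 'End(V)) (l : 'End(V)) v :
  vcvg u l -> vcvg (fun n => u n v) (l v).
Proof.
have le : linear (fun E : 'End(V) => E v) by move=> a E E'; rewrite lfunD_E lfunZ_E.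
pose ev : {linear 'End(V) -> V} := HB.pack (fun E : 'End(V) => E v)
  (GRing.isLinear.Build _ _ _ _ (fun E : 'End(V) => E v) le).
exact: (vcvg_linear (f := ev)).
Qed.

Lemma unitary_bounded : exists B : R, forall phi : 'End(g),
  (forall x y, hf (phi x) (phi y) = hf x y) -> forall j, `|vcoord j phi| <= B%:C%C.
Proof.
have [X XP] := orthogonal_expansion_ex hP; have [XU _ _ Xe] := XP.
pose n := \dim {:g}.
have lE (k l : 'I_n) : linear (fun v : g => vcoord k v *: (vbasis {:g})`_l).
  by move=> a x y; rewrite linearP scalerDl scalerA.
pose E (k l : 'I_n) : 'End(g) := linfun (HB.pack (fun v : g => vcoord k v *: (vbasis {:g})`_l)
  (GRing.isLinear.Build _ _ _ _ (fun v : g => vcoord k v *: (vbasis {:g})`_l) (lE k l))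
  : {linear g -> g}).
have phiE (phi : 'End(g)) : phi = \sum_(k < n) \sum_(l < n) vcoord l (phi (vbasis {:g})`_k) *: E k l.
  apply/lfunP => v; rewrite sum_lfunE {1}[v]vcoord_sum linear_sum; apply: eq_bigr => k _.
  rewrite sum_lfunE linearZ /= {1}[phi _]vcoord_sum scaler_sumr; apply: eq_bigr => l _.
  by rewrite lfunZ_E lfunE /= !scalerA mulrC.
(* The numerator bounds |hf (phi v) y| through s <= 1 + s^2 and Cauchy-Schwarz, which avoids square
   roots. *)
pose bd (ell : {scalar g}) (v : g) : C :=
  \sum_(y <- X) (1 + hf v v * hf y y) / hf y y * `|ell y|.
have ellb (ell : {scalar g}) (phi : 'End(g)) v :
    (forall x y, hf (phi x) (phi y) = hf x y) -> `|ell (phi v)| <= bd ell v.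
  move=> pu; rewrite [phi v]Xe ?memvf// linear_sum (le_trans (ler_norm_sum _ _ _))//.
  rewrite /bd big_seq [leRHS]big_seq ler_sum// => y yX.
  have [_ y0] := XU y yX; have yy := herm_gt0 hP y0.
  rewrite scalarZ normrM ler_wpM2r// normrM normfV (gtr0_norm yy) ler_wpM2r ?invr_ge0 ?(ltW yy)//.
  have := cauchy_schwarz hP (phi v) y; rewrite pu => cs.
  rewrite (le_trans _ (lerD (lexx _) cs))//.
  have [h1|h1] := real_leP (normr_real (hf (phi v) y)) (real1 R[i]).
    by rewrite (le_trans h1)// lerDl exprn_ge0.
  by rewrite ler_wpDl// expr2 ler_peMl// ltW.
have [B BP] : exists B : 'I_(\dim {:'End(g)}) -> C, forall phi : 'End(g),
    (forall x y, hf (phi x) (phi y) = hf x y) -> forall j, `|vcoord j phi| <= B j.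
  exists (fun j => \sum_(k < n) \sum_(l < n) bd (@vcoord _ _ l) (vbasis {:g})`_k * `|vcoord j (E k l)|).
  move=> phi pu j; rewrite {1}[phi]phiE linear_sum (le_trans (ler_norm_sum _ _ _))//.
  apply: ler_sum => k _; rewrite linear_sum (le_trans (ler_norm_sum _ _ _))//.
  by apply: ler_sum => l _; rewrite scalarZ normrM ler_wpM2r// ellb.
exists (complex.Re (\sum_j `|B j|)) => phi pu j.
rewrite RRe_real ?ger0_real ?sumr_ge0//.
rewrite (bigD1 j)//= (le_trans (BP _ pu j))// (le_trans (real_ler_norm _))//.
  by rewrite ger0_real// (le_trans _ (BP _ pu j)).
by rewrite lerDl sumr_ge0.
Qed.

End CompactPart.

(** * Compactness for distinguished Cayley triples *)

Section CompactCentralizer.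
Variables (R : realType) (g : lieAlgType R[i]) (gR : set g) (theta : 'End(g)).
Local Notation C := (R[i] : numFieldType).
Hypothesis rf : real_form gR.
Hypothesis theta_aut : lie_automorphism theta.
Hypothesis theta2 : order_two theta.
Hypothesis theta_real : forall x, gR x -> gR (theta x).
Hypothesis cartan : cartan_decomposition gR (gR `&` fixed_part theta)
                          (gR `&` antifixed_part theta).
Variables e h f : g.
Hypothesis cayley : complex_cayley_triple theta gR e h f.
Hypothesis distinguished : forall z, theta z = - z ->
  lie z e = 0 -> lie z h = 0 -> lie z f = 0 -> z = 0.
Local Notation sigma := (rconj rf).
Local Notation tau := (cartan_conj rf theta).
Local Notation hf := (cartan_form rf theta).
Let hP : hermitian_posdef hf.
Proof. exact: cartan_form_posdef. Qed.

Let sl2 : sl2_triple e h f. Proof. by case: cayley. Qed.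
Let th : theta h = h. Proof. by case: cayley. Qed.
Let te : theta e = - e. Proof. by case: cayley. Qed.
Let tf : theta f = - f. Proof. by case: cayley. Qed.
Let se : sigma e = f.
Proof. by case: cayley => _ _ _ _ /(conjugate_wrt_rconj rf) ->. Qed.
Let sf : sigma f = e. Proof. by rewrite -se rconjK. Qed.
Let sh : sigma h = - h.
Proof. by rewrite -(lie_ef sl2) rconj_lie se sf (lie_fe sl2) (lie_ef sl2). Qed.

Local Notation e' := (cayley_nilp e h f).
Let h' := e + f.
Let f' : g := ('i%C / 2) *: (h + e - f).

Let conj_i2 : ('i%C / 2 : R[i])^*%C = - ('i%C / 2).
Proof. by rewrite conjcM conjc_i conjc_inv conjc_nat mulNr. Qed.

Let i2_sqr : ('i%C / 2 : R[i]) * ('i%C / 2) = - 4^-1.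
Proof.
transitivity (('i%C * 'i%C) * (2^-1 * 2^-1) : R[i]); first by ring.
by rewrite mulii mulN1r -invfM -natrM.
Qed.

Let e'R : gR e'.
Proof.
apply/(rconjP rf); rewrite /cayley_nilp rconjZ conj_i2 rconjB rconjD rconjN se sf sh.
by module_ring.
Qed.

Let h'R : gR h'.
Proof. by apply/(rconjP rf); rewrite rconjD se sf addrC. Qed.

Let f'R : gR f'.
Proof.
apply/(rconjP rf); rewrite /f' rconjZ conj_i2 rconjB rconjD se sf sh.
by module_ring.
Qed.

Let te' : theta e' = - f'.
Proof.
rewrite /cayley_nilp /f' linearZ linearB linearD linearN /= th te tf.
by module_ring.
Qed.

Let e'f' : lie e' f' = h'.
Proof.
rewrite /cayley_nilp /f' /h' lieZl lieZr scalerA i2_sqr.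
rewrite !(lieDl, lieNl, lieDr, lieNr) !liexx.
rewrite ?(lie_he sl2, lie_hf sl2, lie_eh sl2, lie_ef sl2, lie_fe sl2, lie_fh sl2).
by apply: vcoordP => ?; rewrite ?(vcoordD, vcoordN, vcoord0, vcoordZ); field.
Qed.

Let h'e' : lie h' e' = 2 *: e'.
Proof.
rewrite /cayley_nilp /h' lieZr.
rewrite !(lieDl, lieNl, lieDr, lieNr) !liexx.
rewrite ?(lie_he sl2, lie_hf sl2, lie_eh sl2, lie_ef sl2, lie_fe sl2, lie_fh sl2).
by module_ring.
Qed.

Let tau_e' : tau e' = - f'.
Proof. by rewrite /cartan_conj rconj_real. Qed.
Let tau_f' : tau f' = - e'.
Proof. by apply: (canLR (tauK rf theta2 theta_real)); rewrite tauN tau_e' opprK. Qed.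
Let tau_h' : tau h' = - h'.
Proof. by rewrite /cartan_conj rconj_real// /h' linearD /= te tf opprD. Qed.

Lemma cayley_nilpotent : nilpotent_elt g e'.
Proof.
have eE : e' = lie e' (- (2^-1 *: h')).
  by rewrite lieNr lieZr (lie_antisym e') h'e' scalerN opprK scalerA mulVf ?scale1r// pnatr_eq0.
by rewrite eE; apply: jacobson_nilpotent; rewrite -eE liexx.
Qed.

Definition triple_centralizer : set g :=
  [set y | [/\ gR y, lie y e = 0, lie y h = 0 & lie y f = 0]].
Local Notation r := triple_centralizer.

(** The element y - theta y lies in p and commutes with the triple, so distinguishedness makes it
    zero. *)
Lemma triple_centralizer_theta y : r y -> theta y = y.
Proof.
move=> [gy ye yh yf]; apply/esym/eqP; rewrite -subr_eq0; apply/eqP/distinguished.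
- by rewrite linearB /= thetaK// opprB.
- have : theta (lie y e) = 0 by rewrite ye linear0.
  rewrite (theta_lie theta_aut) te lieNr => /eqP; rewrite oppr_eq0 => /eqP t0.
  by rewrite lieBl ye t0 subr0.
- have : theta (lie y h) = 0 by rewrite yh linear0.
  by rewrite (theta_lie theta_aut) th => t0; rewrite lieBl yh t0 subr0.
- have : theta (lie y f) = 0 by rewrite yf linear0.
  rewrite (theta_lie theta_aut) tf lieNr => /eqP; rewrite oppr_eq0 => /eqP t0.
  by rewrite lieBl yf t0 subr0.
Qed.

Lemma triple_centralizer_real : real_subalgebra r.
Proof.
split; first split.
- by split; [exact: (realform0 rf)|exact: lie0l..].
- move=> x y [gx xe xh xf] [gy ye yh yf]; split.
  + exact: realformD.
  + by rewrite lieDl xe ye addr0.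
  + by rewrite lieDl xh yh addr0.
  + by rewrite lieDl xf yf addr0.
- move=> a x [gx xe xh xf]; split; first exact: realformZ.
  + by rewrite lieZl xe scaler0.
  + by rewrite lieZl xh scaler0.
  + by rewrite lieZl xf scaler0.
move=> x y [gx xe xh xf] [gy ye yh yf].
have cen z : lie x z = 0 -> lie y z = 0 -> lie (lie x y) z = 0.
  by move=> xz yz; have := lie_leibniz x y z; rewrite yz xz !lie0r addr0.
by split; [exact: real_lie|exact: cen..].
Qed.

Lemma triple_centralizer_nil y : r y -> nilpotent_elt g y -> y = 0.
Proof.
move=> ry /killing_nilpotent yy; have ty := triple_centralizer_theta ry.
have [gy _ _ _] := ry; case: cartan => _ _ _ neg _.
apply/eqP/negPn/negP => /eqP y0; have := neg y (conj gy ty) y0.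
by rewrite yy ltxx.
Qed.

Let e'Df' : ('i%C / 2) *: (e' + f') = - (2^-1 *: (e - f)).
Proof.
have -> : e' + f' = 'i%C *: (e - f).
  rewrite /cayley_nilp /f'.
  by apply: vcoordP => ?; rewrite ?(vcoordD, vcoordN, vcoord0, vcoordZ); field.
by rewrite scalerA mulrAC mulii mulN1r scaleNr.
Qed.

Let kills_cayley y : lie e' y = 0 -> lie h' y = 0 -> lie f' y = 0 -> gR y -> r y.
Proof.
move=> ye yh yf gy; split=> //; apply/eqP; rewrite lie_antisym oppr_eq0; apply/eqP.
- have -> : e = 2^-1 *: h' - ('i%C / 2) *: (e' + f').
    rewrite e'Df' /h'.
    by apply: vcoordP => ?; rewrite ?(vcoordD, vcoordN, vcoord0, vcoordZ); field.
  by rewrite lieBl !lieZl [lie (e' + f') y]lieDl yh ye yf addr0 !scaler0 subr0.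
- have -> : h = - 'i%C *: (f' - e').
    rewrite /f' /cayley_nilp -scalerBr scalerA.
    have -> : - 'i%C * ('i%C / 2) = 2^-1 :> R[i] by rewrite mulrA mulNr mulii opprK mul1r.
    by apply: vcoordP => ?; rewrite ?(vcoordD, vcoordN, vcoord0, vcoordZ); field.
  by rewrite lieZl lieBl ye yf subr0 scaler0.
- have -> : f = 2^-1 *: h' + ('i%C / 2) *: (e' + f').
    rewrite e'Df' /h'.
    by apply: vcoordP => ?; rewrite ?(vcoordD, vcoordN, vcoord0, vcoordZ); field.
  by rewrite lieDl !lieZl [lie (e' + f') y]lieDl yh ye yf addr0 !scaler0 addr0.
Qed.

(** As tau h' = - h', ad h' is self-adjoint and diagonalizable on ker (ad e'). Eigenvectors of
    nonzero weight lie in the image of ad e'; those of weight zero commute with the whole triple. *)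
Lemma centralizer_decomposition y : gR y -> lie e' y = 0 ->
  exists2 y0, r y0 & exists w, y = y0 + lie e' w.
Proof.
move=> gy ey; pose U := lker (ad e').
have UP v : (v \in U) = (lie e' v == 0) by rewrite memv_ker adE.
pose P (v : g) := exists v0 w, [/\ lie e' v0 = 0, lie h' v0 = 0 & v = v0 + lie e' w].
have [||X [XU _ _ Xe] Xeig] := @orthogonal_eigenbasis _ _ _ hP (ad h') U.
- move=> v; rewrite !UP adE => /eqP ev; rewrite lie_leibniz ev lie0r addr0.
  by rewrite (lie_antisym e') h'e' lieNl lieZl ev scaler0 oppr0.
- move=> b a bU hb v vU vb; rewrite adE cartan_form_lie// tau_h' lieNl.
  by rewrite -adE hb (hermNr hP) (hermZr hP) vb mulr0 oppr0 oppr0.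
have [v0 [w [ev0 hv0 yE]]] : P y.
  rewrite [y]Xe ?UP ?ey// big_seq; elim/big_ind : _ => [|v v'|b bX].
  - by exists 0, 0; rewrite !lie0r addr0.
  - move=> [v0 [w [ev hv ->]]] [v0' [w' [ev' hv' ->]]]; exists (v0 + v0'), (w + w').
    by rewrite !lieDr ev ev' hv hv' !addr0 addrACA.
  - have [bU _] := XU b bX; move: bU; rewrite UP => /eqP eb.
    have [a hb] := Xeig b bX; rewrite adE in hb.
    set c := _ / _; have [a0|a0] := eqVneq a 0.
      by exists (c *: b), 0; rewrite !lieZr eb hb a0 scale0r !scaler0 lie0r addr0.
    (* Since [e', b] = 0, one has a b = [h', b] = [e', [f', b]]. *)
    exists 0, ((c / a) *: lie f' b); rewrite !lie0r add0r; split=> //.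
    rewrite lieZr lie_leibniz e'f' hb eb lie0r addr0 scalerA divfK//.
(* The adjoint of ad f' is ad e', and [e', [f', v0]] = [h', v0] = 0, so [f', v0] has norm zero. *)
have fv0 : lie f' v0 = 0.
  apply: (herm_eq0 hP); rewrite cartan_form_lie// tau_f' lieNl lie_leibniz e'f'.
  by rewrite hv0 ev0 lie0r addr0 oppr0 (herm0r hP) oppr0.
have sreal v c : sigma c = c -> lie c v = 0 -> lie c (sigma v) = 0.
  by move=> cc cv; have := rconj_lie rf c v; rewrite cv cc (rconj_real rf (realform0 rf)).
have half v : sigma v = v -> gR v by move=> /(rconjP rf).
(* The real part: the decomposition was found over the complex numbers, and e', h', f' are real. *)
pose av v := 2^-1 *: (v + sigma v).
have avR v : gR (av v).
  have -> : av v = ((2^-1 : R)%:C%C) *: (v + sigma v).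
    by rewrite /av fmorphV rmorph_nat.
  by apply: realformZ => //; exact: rconj_avg.
have avk v c : gR c -> lie c v = 0 -> lie c (av v) = 0.
  move=> /(rconj_real rf) cc cv; rewrite /av lieZr lieDr cv (sreal _ _ cc cv).
  by rewrite addr0 scaler0.
exists (av v0).
  by apply: kills_cayley; rewrite ?avk.
exists (av w).
have {1}<- : av y = y.
  by rewrite /av (rconj_real rf gy) -mulr2n -[y *+ 2]scaler_nat scalerA mulVf ?scale1r//.
rewrite /av lieZr lieDr {1 2}yE rconjD rconj_lie (rconj_real rf e'R).
by rewrite -scalerDr addrACA.
Qed.

Local Notation cent := (centralizer_in gR e').

Let r_kills y : r y -> lie e' y = 0.
Proof.
move=> [_ ye yh yf]; rewrite lie_antisym /cayley_nilp lieZr lieBr lieDr lieNr.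
by rewrite ye yh yf !oppr0 !addr0 scaler0 oppr0.
Qed.

Lemma rad_u_image y w : cent y -> y = lie e' w -> rad_u cent y.
Proof.
move=> [gy ey] yE.
exists [set z | cent z /\ exists v, z = lie e' v]; last by split => //; exists w.
split.
- split; first by split; [split; [exact: realform0|exact: lie0r]|exists 0; rewrite lie0r].
  + move=> a b [[ga ea] [v av]] [[gb eb] [v' bv]]; split.
      by split; [exact: realformD|rewrite lieDr ea eb addr0].
    by exists (v + v'); rewrite lieDr av bv.
  + move=> t a [[ga ea] [v av]]; split.
      by split; [exact: realformZ|rewrite lieZr ea scaler0].
    by exists (t%:C%C *: v); rewrite lieZr av.
- by move=> z [].
- move=> z [[_ ez] [v zv]]; rewrite /= zv; apply: jacobson_nilpotent.
  by rewrite -zv.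
move=> a b [ga ea] [[gb eb] [v bv]]; split.
  split; first exact: real_lie.
  by rewrite lie_leibniz ea eb lie0l lie0r addr0.
by exists (lie a v); rewrite bv [RHS]lie_leibniz ea lie0l add0r.
Qed.

Lemma triple_centralizer_levi : reductive_levi cent r.
Proof.
have r_rad y : r y -> rad_u cent y -> y = 0.
  move=> ry [I [_ _ nil _] Iy]; apply: triple_centralizer_nil => //.
  exact: nil.
split; first exact: triple_centralizer_real.
- split.
    apply/seteqP; split=> [y [gy ey]|_ [a ra [b [I [_ Icent _ _] Ib] <-]]].
      have [y0 ry0 [w yE]] := centralizer_decomposition gy ey.
      exists y0 => //; exists (lie e' w); last by rewrite yE.
      apply: (@rad_u_image _ w) => //.
      have [g0 _ _ _] := ry0; have wE : lie e' w = y - y0 by rewrite yE addrC addKr.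
      by rewrite wE; split; [exact: realformB|rewrite lieBr ey r_kills// subr0].
    have [gb eb] := Icent _ Ib; have [ga _ _ _] := ra.
    by split; [exact: realformD|rewrite lieDr eb r_kills// addr0].
  apply/seteqP; split=> [y [ry rady]|_ ->]; first exact: r_rad.
  split; first by case: triple_centralizer_real => -[].
  by apply: (@rad_u_image _ 0); [split; [exact: realform0|exact: lie0r]|rewrite lie0r].
apply/seteqP; split=> [y [I [_ Ir nil _] Iy]|_ ->].
  by apply: triple_centralizer_nil; [exact: Ir|exact: nil].
have r0 : r 0 by case: triple_centralizer_real => -[].
exists [set 0] => //; split.
- by split=> // [x y -> ->|a x ->]; rewrite ?addr0 ?scaler0.
- by move=> _ ->.
- by move=> _ ->; exists 1%N => y; rewrite /= lie0l.
- by move=> x y _ ->; rewrite lie0r.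
Qed.

Definition fixing_maps : set 'End(g) :=
  [set phi | [/\ forall x, phi (theta x) = theta (phi x),
                 phi e = e, phi h = h & phi f = f]].

(* [fixing_maps] is an affine subspace of ['End(g)], hence cut out by the affine
   conditions valid on it. *)
Lemma fixing_maps_closed : zariski_closed fixing_maps.
Proof.
pose I := {p : {scalar 'End(g)} * R[i] | forall phi, fixing_maps phi -> p.1 phi = p.2}.
have lin (ell : 'End(g) -> R[i]) : linear_for *%R ell -> exists l : {scalar 'End(g)},
    (l : 'End(g) -> R[i]) =1 ell.
  move=> le; exists (HB.pack ell (GRing.isLinear.Build _ _ _ _ ell le) : {scalar 'End(g)}).
  by [].
have -> : fixing_maps = [set phi | forall i : I, (sval i).1 phi - (sval i).2 = 0].
  apply/seteqP; split=> [phi Aphi [p /= Ap]|phi Aphi /=].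
    by apply/eqP; rewrite subr_eq0 Ap.
  have use (ell : 'End(g) -> R[i]) c : linear_for *%R ell ->
      (forall psi, fixing_maps psi -> ell psi = c) -> ell phi = c.
    move=> /lin[l le] ec.
    have lc psi : fixing_maps psi -> (l, c).1 psi = (l, c).2 by move=> /ec <-; exact: le.
    by have /eqP := Aphi (exist _ (l, c) lc); rewrite subr_eq0 /= le => /eqP.
  have fixv v : (forall psi, fixing_maps psi -> psi v = v) -> phi v = v.
    move=> fv; apply: vcoordP => j; apply: (use (fun psi => vcoord j (psi v))) => [a x y|psi].
      by rewrite lfunD_E lfunZ_E linearP.
    by move=> /fv ->.
  split; [|by apply: fixv => psi []..].
  move=> x; apply: vcoordP => j; apply/eqP; rewrite -subr_eq0; apply/eqP.
  apply: (use (fun psi => vcoord j (psi (theta x)) - vcoord j (theta (psi x)))) => [a p q|psi].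
    rewrite !lfunD_E !lfunZ_E [theta (_ + _)]linearP /=.
    by rewrite !(vcoordD, vcoordZ); ring.
  by move=> [-> _ _ _]; rewrite subrr.
apply: zariski_closed_zero => -[[l c] lc] /=.
by apply: polyfunVD; [exact: polyfunV_scalar|exact: polyfunV_cst].
Qed.

Definition compact_subgroup : set 'End(g) := adjoint_real_points gR `&` fixing_maps.
Local Notation H := compact_subgroup.

Lemma adgroupT_inv (phi : 'End(g)) : adgroup [set: g] phi ->
  exists2 psi, adgroup [set: g] psi & (phi \o psi = \1)%VF.
Proof. by apply: adgroup_inv. Qed.

Lemma adgroupT_invE (phi psi : 'End(g)) : (phi \o psi = \1)%VF -> (phi^-1)%VF = psi.
Proof.
move=> pp; have pp' := comp_inv_sym pp.
have k0 : lker phi == 0%VS.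
  rewrite -subv0; apply/subvP => x; rewrite memv_ker memv0 => /eqP px.
  by rewrite -[x]id_lfunE -pp' comp_lfunE px linear0.
apply/lfunP => x; apply: (lker0P k0).
by rewrite -!comp_lfunE lker0_compfV// pp.
Qed.

Lemma real_points_rconj (phi : 'End(g)) : (forall x, gR x -> gR (phi x)) ->
  forall x, sigma (phi x) = phi (sigma x).
Proof.
move=> pR x; have [a [b [ga gb -> ->]]] := real_decP rf x.
by rewrite linearD linearZ linearB linearZ /= rconjE//; exact: pR.
Qed.

Lemma rconj_real_points (phi : 'End(g)) : (forall x, sigma (phi x) = phi (sigma x)) ->
  forall x, gR x -> gR (phi x).
Proof. by move=> ps x /(rconj_real rf) sx; apply/(rconjP rf); rewrite ps sx. Qed.

Lemma compact_subgroup_algebraic : real_algebraic_subgroup gR H.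
Proof.
split.
- split; last by split=> *; rewrite !lfunE.
  by split; [exact: adgroup1|move=> x gx; rewrite lfunE].
- move=> phi psi [[ap rp] [tp ep hp fp]] [[aq rq] [tq eq hq fq]]; split.
    split; first exact: adgroup_comp.
    by move=> x gx; rewrite comp_lfunE; apply/rp/rq.
  split; rewrite ?comp_lfunE ?eq ?hq ?fq// => x.
  by rewrite !comp_lfunE tq tp.
- move=> phi [[ap rp] [tp ep hp fp]].
  have [psi aq pp] := adgroupT_inv ap; rewrite (adgroupT_invE pp).
  have qp x : psi (phi x) = x by rewrite -comp_lfunE (comp_inv_sym pp) lfunE.
  have pq x : phi (psi x) = x by rewrite -comp_lfunE pp lfunE.
  split.
    split=> //; apply: rconj_real_points => x.
    by rewrite -{2}[x]pq (real_points_rconj rp) qp.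
  have qv v : phi v = v -> psi v = v by move=> pv; rewrite -{1}pv qp.
  split; [move=> x|exact: qv..].
  by rewrite -{1}[x]pq -tp qp.
by exists fixing_maps; [exact: fixing_maps_closed|].
Qed.

(** Requiring [H] to commute with theta loses nothing on the Lie algebra, because [r] is fixed by
    theta. This extra condition is what makes [H] unitary. *)
Lemma triple_centralizer_group : r = lie_of_group gR H.
Proof.
have ezero (D : 'End(g)) v : D v = 0 -> lfun_exp D v = v.
  move=> Dv; have := @lfun_exp_eigen _ _ D v 0; rewrite scale0r => -> //.
  by rewrite -[0](rmorph0 (real_complex R)) cexp_real expR0 scale1r.
apply/seteqP; split=> [y ry|y [gy Hy]].
  have [gy ye yh yf] := ry; have ty := triple_centralizer_theta ry.
  split=> // t; have gty : gR (t%:C%C *: y) by exact: realformZ.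
  split; first split.
  - exact: adgroup_exp.
  - apply: rconj_real_points => x; apply: (adgroup_antilinear (S := gR)).
    + exact: rconj_antilinear.
    + by move=> a v ga; rewrite rconj_lie (rconj_real rf ga).
    + exact: adgroup_exp.
  split; try by apply: ezero; rewrite adE lieZl ?ye ?yh ?yf scaler0.
  move=> x; apply/esym/lfun_exp_comm => v.
  by rewrite !adE (theta_lie theta_aut) linearZ /= ty.
(* Conversely, differentiate the one-parameter group at 0. *)
have kill v : (forall phi, H phi -> phi v = v) -> lie y v = 0.
  move=> Hv; rewrite -adE; apply: lfun_exp_deriv0 => t.
  by rewrite -adZ; apply/Hv/Hy.
by split=> //; apply: kill => phi [_ []].
Qed.

Lemma compact_subgroup_unitary phi psi : H phi -> (phi \o psi = \1)%VF ->
  forall x y, hf (phi x) (phi y) = hf x y.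
Proof.
move=> [[ap rp] [tp _ _ _]] pp; apply: (unitary_real_morph (psi := psi)) => //.
- exact: adgroup_morph ap.
- exact: real_points_rconj.
Qed.

(** Unitarity gives boundedness. Among the closed conditions only membership in the adjoint group is
    delicate: for n large the limit l is [u n] composed with a unitary automorphism near 1, which
    [unitary_inner] writes as an exponential. *)
Lemma compact_subgroup_compact : euclidean_compact H.
Proof.
have uH phi : H phi -> forall x y, hf (phi x) (phi y) = hf x y.
  move=> Hp; have [[ap _] _] := Hp; have [psi _ pp] := adgroupT_inv ap.
  exact: compact_subgroup_unitary pp.
have [B BP] := unitary_bounded rf theta_aut theta2 theta_real cartan.
apply: (@euclidean_compact_criterion _ _ _ B) => [phi /uH/BP//|u l uA ul'].
have ul : vcvg u l by exact: ul'.
have Al : fixing_maps l.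
  by apply: (zariski_closed_lim fixing_maps_closed _ ul) => n; case: (uA n).
have lm : lie_morph l.
  move=> x y; have := vcvg_eval (v := lie x y) ul.
  have -> : (fun n => u n (lie x y)) = fun n => lie (u n x) (u n y).
    by apply/funext => n; have [[/adgroup_morph]] := uA n.
  move=> h1; apply: (vcvg_unique h1).
  by apply: vcvg_lie; exact: vcvg_eval.
have ls x : sigma (l x) = l (sigma x).
  have := vcvg_antilinear (rconj_antilinear rf) (vcvg_eval (v := x) ul).
  have -> : (fun n => sigma (u n x)) = fun n => u n (sigma x).
    by apply/funext => n; have [[_ /real_points_rconj]] := uA n.
  by move=> h1; apply: (vcvg_unique h1); exact: vcvg_eval.
have lR := rconj_real_points ls.
split=> //; split=> //.
have [X XP] := orthogonal_expansion_ex hP; have [XU _ _ _] := XP.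
(* The squared Hilbert-Schmidt distance between l and [u n], which controls all eigenvalues of [chi]
   at once. *)
pose delta n : C := \sum_(y <- X) hf (l y - u n y) (l y - u n y) / hf y y.
have delta0 : delta @ \oo --> (0 : C).
  have : delta @ \oo --> \sum_(y <- X) (0 : C).
    apply: cvg_sum_seq => y.
    have cy : (fun n => hf (l y - u n y) (l y - u n y) : C) @ \oo --> (0 : C).
      apply: vcvg_herm0 => // j.
      rewrite (_ : (fun n => _) = fun n => (vcoord j (l y) : C) - vcoord j (u n y)).
        rewrite vcoord0 -(subrr (vcoord j (l y))).
        by apply: cvgB; [exact: cvg_cst|exact: (vcvg_eval (v := y) ul)].
      by apply/funext => n; rewrite vcoordD vcoordN.
    have cb : (fun=> (hf y y)^-1 : C) @ \oo --> ((hf y y)^-1 : C) by exact: cvg_cst.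
    by have := cvgM cy cb; rewrite mul0r => H0; exact: H0.
  by rewrite big1_eq.
pose rho : C := (cis_radius R)%:C%C.
have rho0 : 0 < rho by rewrite ltcR cis_radius_gt0.
have [n dn] : exists n, delta n < rho ^+ 2.
  have r2 : 0 < rho ^+ 2 by rewrite exprn_gt0.
  move/cvgrPdist_lt : delta0 => /(_ _ r2) [N _ /(_ N (leqnn N))].
  rewrite sub0r normrN ger0_norm; first by exists N.
  rewrite /delta big_seq sumr_ge0// => y yX.
  by rewrite divr_ge0 ?(herm_ge0 hP).
have Hu := uA n; have [[au _] [tu _ _ _]] := Hu.
have [psi apsi upsi] := adgroupT_inv au.
have pu x : u n (psi x) = x by rewrite -comp_lfunE upsi lfunE.
have up x : psi (u n x) = x by rewrite -comp_lfunE (comp_inv_sym upsi) lfunE.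
have hpsi x y : hf (psi x) (psi y) = hf x y by rewrite -(uH _ Hu) !pu.
(* The [u n] preserve norms, so a vector killed by the limit has norm zero. *)
have l0 : lker l == 0%VS.
  rewrite -subv0; apply/subvP => x; rewrite memv_ker memv0 => /eqP lx.
  have ux : vcvg (fun n => u n x) 0 by rewrite -lx; exact: vcvg_eval.
  have hx := vcvg_herm0 rf theta_aut theta2 theta_real cartan ux.
  apply/eqP/(herm_eq0 hP)/(cvg_unique (@norm_hausdorff _ C) _ hx).
  rewrite (_ : (fun n => _) = fun=> hf x x); first exact: cvg_cst.
  by apply/funext => k; exact: uH.
pose psi' := (l^-1)%VF; have psi'l : (l \o psi' = \1)%VF by exact: lker0_compfV.
pose chi := (psi \o l)%VF.
have chim : lie_morph chi.
  by move=> x y; rewrite !comp_lfunE lm (adgroup_morph apsi).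
have lu x y : hf (l x) (l y) = hf x y.
  have [tl _ _ _] := Al.
  by apply: (unitary_real_morph (psi := psi')) => // z; rewrite tl.
have chiu x y : hf (chi x) (chi y) = hf x y by rewrite !comp_lfunE hpsi lu.
have near1 b a : b != 0 -> chi b = a *: b -> `|a - 1| < rho.
  move=> b0 cb; rewrite -(ltr_pXn2r (n := 2)) ?nnegrE ?(ltW rho0)//.
  rewrite (le_lt_trans _ dn)// (le_trans (unitary_eigenvalue_bound hP chiu XP b0 cb))//.
  rewrite /delta ler_sum// => y _.
  have -> : chi y - y = psi (l y - u n y) by rewrite linearB /= up comp_lfunE.
  by rewrite hpsi.
have [d chiE] := unitary_inner hP chim chiu (killing_nondeg rf theta_aut theta2 cartan) near1.
have -> : l = (u n \o chi)%VF by apply/lfunP => x; rewrite !comp_lfunE pu.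
by apply: adgroup_comp => //; rewrite chiE; exact: adgroup_exp.
Qed.

Theorem cayley_compact : compact_nilp gR e'.
Proof.
split; [exact: e'R|exact: cayley_nilpotent|exists r, H; split].
- exact: triple_centralizer_levi.
- exact: compact_subgroup_algebraic.
- exact: triple_centralizer_group.
- exact: compact_subgroup_compact.
Qed.

End CompactCentralizer.

(** * Contractions and level sets *)

Section DirectionalDerivative.
Variable F : numFieldType.

(** A derivative at 0 with an exact polynomial remainder, valid over any [numFieldType]. *)
Definition dirder (phi : F -> F) (a delta : F) : Prop :=
  exists r : {poly F}, forall t, phi t = a + t * delta + t ^+ 2 * r.[t].

Lemma dirder_ext phi psi a delta : phi =1 psi -> dirder phi a delta -> dirder psi a delta.
Proof. by move=> e [r h]; exists r => t; rewrite -e h. Qed.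

Lemma dirder_affine a delta : dirder (fun t => a + t * delta) a delta.
Proof. by exists 0 => t; rewrite horner0 mulr0 addr0. Qed.

Lemma dirder_cst a : dirder (fun=> a) a 0.
Proof. by apply: dirder_ext (dirder_affine a 0) => t; rewrite mulr0 addr0. Qed.

Lemma dirderD phi psi a b da db : dirder phi a da -> dirder psi b db ->
  dirder (fun t => phi t + psi t) (a + b) (da + db).
Proof.
move=> [r hr] [s hs]; exists (r + s) => t; rewrite hr hs hornerD; ring.
Qed.

Lemma dirderM phi psi a b da db : dirder phi a da -> dirder psi b db ->
  dirder (fun t => phi t * psi t) (a * b) (da * b + a * db).
Proof.
move=> [r hr] [s hs].
exists (a%:P * s + b%:P * r + (da * db)%:P + 'X * (da%:P * s + db%:P * r)
  + 'X ^+ 2 * (r * s)) => t.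
rewrite hr hs !(hornerD, hornerM, hornerC, hornerX, hornerXn); ring.
Qed.

Lemma dirder_sum (I : Type) (r : seq I) phi a da :
  (forall i, dirder (phi i) (a i) (da i)) ->
  dirder (fun t => \sum_(i <- r) phi i t) (\sum_(i <- r) a i) (\sum_(i <- r) da i).
Proof.
move=> h; elim: r => [|i r IH].
  by rewrite !big_nil; apply: dirder_ext (dirder_cst 0) => t; rewrite big_nil.
rewrite !big_cons; apply: dirder_ext (dirderD (h i) IH) => t.
by rewrite big_cons.
Qed.

Lemma dirder_unique phi a da a' da' : dirder phi a da -> dirder phi a' da' -> da = da'.
Proof.
(* The difference of the two expansions vanishes at every natural number, so it is the zero
   polynomial, and its coefficient of degree 1 is da - da'. *)
move=> [r hr] [s hs]; pose p := (a - a')%:P + 'X * ((da - da')%:P + 'X * (r - s)).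
have p0 : p = 0.
  apply/eqP/negPn/negP => pn0.
  have [n] := ubnP (size p); apply/negP; rewrite -leqNgt ltnW//.
  have /max_poly_roots := pn0.
  move=> /(_ [seq i%:R | i <- iota 0 n]); rewrite size_map size_iota.
  apply; last by rewrite map_inj_uniq ?iota_uniq// => i j /eqP; rewrite eqr_nat => /eqP.
  apply/allP => _ /mapP[i _ ->]; rewrite /root /p.
  rewrite !(hornerD, hornerM, hornerC, hornerX, hornerN).
  have := hr i%:R; rewrite hs => e.
  apply/eqP; transitivity ((a + i%:R * da + i%:R ^+ 2 * r.[i%:R]) -
    (a' + i%:R * da' + i%:R ^+ 2 * s.[i%:R])); first by ring.
  by rewrite e subrr.
have := congr1 (fun q : {poly F} => q`_1) p0.
rewrite /p coef0 coefD coefC /= add0r coefXM /= coefD coefC coefXM /= addr0.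
by move=> /eqP; rewrite subr_eq0 => /eqP.
Qed.

Lemma dirder_mpoly d (p : mpoly.mpoly d F) (y v : 'I_d -> F) :
  dirder (fun t => mpoly.meval (fun j => y j + t * v j) p) (mpoly.meval y p)
    (\sum_j v j * mpoly.meval y (mpoly.mderiv j p)).
Proof.
pose S p := dirder (fun t => mpoly.meval (fun j => y j + t * v j) p) (mpoly.meval y p)
    (\sum_j v j * mpoly.meval y (mpoly.mderiv j p)).
have SC a : S (mpoly.mpolyC d a).
  rewrite /S mpoly.mevalC big1 => [|j _]; last by rewrite mpoly.mderivC raddf0 mulr0.
  by apply: dirder_ext (dirder_cst a) => t; rewrite mpoly.mevalC.
have SM p1 p2 : S p1 -> S p2 -> S (p1 * p2).
  move=> S1 S2; rewrite /S rmorphM /=.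
  have -> : \sum_j v j * mpoly.meval y (mpoly.mderiv j (p1 * p2)) =
    (\sum_j v j * mpoly.meval y (mpoly.mderiv j p1)) * mpoly.meval y p2 +
    mpoly.meval y p1 * (\sum_j v j * mpoly.meval y (mpoly.mderiv j p2)).
    rewrite mulr_suml mulr_sumr -big_split; apply: eq_bigr => j _ /=.
    by rewrite mpoly.mderivM raddfD /= !rmorphM /=; ring.
  by apply: dirder_ext (dirderM S1 S2) => t; rewrite rmorphM.
have SD p1 p2 : S p1 -> S p2 -> S (p1 + p2).
  move=> S1 S2; rewrite /S raddfD /=.
  have -> : \sum_j v j * mpoly.meval y (mpoly.mderiv j (p1 + p2)) =
    (\sum_j v j * mpoly.meval y (mpoly.mderiv j p1)) +
    (\sum_j v j * mpoly.meval y (mpoly.mderiv j p2)).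
    rewrite -big_split; apply: eq_bigr => j _ /=.
    by rewrite mpoly.mderivD raddfD /= mulrDr.
  by apply: dirder_ext (dirderD S1 S2) => t; rewrite raddfD.
rewrite -/(S p); elim/mpoly.mpolyind : p => [|a m p _ _ Sp].
  by have := SC 0; rewrite mpoly.mpolyC0.
apply: (SD) => //; rewrite -mpoly.mul_mpolyC; apply: (SM); first exact: SC.
rewrite mpoly.mpolyXE_id; elim/big_ind : _ => [||i _]; [exact: (SC 1)|exact: SM|].
set e := (X in _ ^+ X); elim: e => [|e IH]; first by rewrite expr0; exact: (SC 1).
rewrite exprS; apply: (SM) => //.
rewrite /S mpoly.mevalXU (bigD1 i)//= big1 ?addr0 => [|j ji].
  rewrite mpoly.mderivX mpoly.mnm1E eqxx scale1r.
  rewrite (_ : mpoly.mnm_sub _ _ = mpoly.mnm0); last first.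
    by apply/mpoly.mnmP => k; rewrite mpoly.mnmBE subnn mpoly.mnm0E.
  rewrite mpoly.mpolyX0 rmorph1 mulr1.
  by apply: dirder_ext (dirder_affine (y i) (v i)) => t; rewrite mpoly.mevalXU.
by rewrite mpoly.mderivX mpoly.mnm1E eq_sym (negPf ji) scale0r raddf0 mulr0.
Qed.

(* To first order [A] moves inside a conjugacy class. *)
Lemma dirder_trace_commutator n (A : F -> 'M[F]_n) (A0 B : 'M[F]_n) k :
  (forall t, A t = A0 + t *: (B *m A0 - A0 *m B)) ->
  dirder (fun t => \tr (A t ^+ k)) (\tr (A0 ^+ k)) 0.
Proof.
move=> At.
have h : forall i j, dirder (fun t => (A t ^+ k) i j) ((A0 ^+ k) i j)
    ((B *m A0 ^+ k - A0 ^+ k *m B) i j).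
  elim: k => [|k IH] i j.
    have -> : B *m A0 ^+ 0 - A0 ^+ 0 *m B = 0.
      by have -> : A0 ^+ 0 = 1%:M; rewrite ?expr0 // mulmx1 mul1mx subrr.
    rewrite [X in dirder _ _ X]mxE.
    by apply: dirder_ext (dirder_cst ((1 : 'M[F]_n) i j)) => t; rewrite expr0.
  have hA i1 j1 : dirder (fun t => A t i1 j1) (A0 i1 j1) ((B *m A0 - A0 *m B) i1 j1).
    by apply: dirder_ext (dirder_affine (A0 i1 j1) ((B *m A0 - A0 *m B) i1 j1)) => t; rewrite At !mxE.
  have -> : (B *m A0 ^+ k.+1 - A0 ^+ k.+1 *m B) i j =
     \sum_l ((B *m A0 - A0 *m B) i l * (A0 ^+ k) l j +
             A0 i l * (B *m A0 ^+ k - A0 ^+ k *m B) l j).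
    rewrite big_split /=; set M := (X in X i j).
    transitivity ((((B *m A0 - A0 *m B) *m A0 ^+ k) +
       A0 *m (B *m A0 ^+ k - A0 ^+ k *m B)) i j); last by rewrite !mxE.
    congr (fun_of_matrix _ _ _); rewrite /M exprS -[A0 * _]/(A0 *m _).
    by rewrite mulmxBl mulmxBr !mulmxA addrA subrK.
  have -> : (A0 ^+ k.+1) i j = \sum_l A0 i l * (A0 ^+ k) l j.
    by rewrite exprS -[A0 * _]/(A0 *m _) mxE.
  apply: dirder_ext (dirder_sum _ (fun l => dirderM (hA i l) (IH l j))) => t.
  by rewrite exprS -[_ * _]/(A t *m _) mxE.
have := dirder_sum (index_enum 'I_n) (fun i => h i i).
rewrite (_ : \sum_i (B *m A0 ^+ k - A0 ^+ k *m B) i i = 0) //.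
by rewrite -/(\tr _) raddfB /= mxtrace_mulC subrr.
Qed.
End DirectionalDerivative.

(** * Extrema of polynomial functions on compact sets *)

Section ExtremeValues.
Variable R : realType.
Local Notation C := (R[i] : numFieldType).

Lemma continuous_Re (z : C) : complex.Re x @[x --> z] --> (complex.Re z : R).
Proof.
have FF : Filter (nbhs z) by exact: nbhs_filter.
apply/(@cvgrPdist_lt R R^o C (nbhs z) FF) => eps e0; have e0' : 0 < (eps%:C%C : C) by rewrite ltcR.
have h : nbhs z [set x : C | `|z - x| < eps%:C%C].
  by apply/nbhs_ballP; exists eps%:C%C => // x; rewrite -ball_normE.
apply: (filterS _ h) => x /= zx; rewrite -ltcR -raddfB /=.
exact: le_lt_trans (normc_ge_Re _) zx.
Qed.

Lemma compact_real_min (n : nat) (A : set 'rV[C]_n) (phi : 'rV[C]_n -> C) :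
  A !=set0 -> compact A -> continuous phi -> (forall v, phi v \is Num.real) ->
  exists2 c, A c & forall v, A v -> phi c <= phi v.
Proof.
move=> A0 cA cphi rphi.
have phiE v : phi v = (complex.Re (phi v))%:C%C by rewrite RRe_real.
have [|c /set_mem Ac cmin] := @compact_EVT_min _ R (fun v => complex.Re (phi v)) A A0 cA.
  apply: continuous_subspaceT => v.
  exact: cvg_comp (cphi v) (@continuous_Re _).
exists c => // v Av; rewrite phiE [leRHS]phiE lecR.
by apply: cmin; rewrite inE.
Qed.

Lemma continuous_polyfun n (phi : ('I_n -> C) -> C) : polyfun phi ->
  continuous (fun v : 'rV[C]_n => phi (v 0)).
Proof.
move=> pphi v.
apply: (@cvg_polyfun C n _ (nbhs v) (nbhs_filter v) phi (fun w : 'rV[C]_n => w 0) (v 0) pphi _) => j; exact: coord_continuous. Qed.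

Lemma compact_polyfun_max n (A : set 'rV[C]_n) (phi : ('I_n -> C) -> C) :
  A !=set0 -> compact A -> polyfun phi ->
  exists2 c, A c & forall v, A v -> `|phi (v 0)| <= `|phi (c 0)|.
Proof.
move=> A0 cA /continuous_polyfun cphi.
have [|v|c Ac cmin] := @compact_real_min n A (fun v => - `|phi (v 0)|) A0 cA.
- by move=> v; exact: (cvgN (cvg_norm (cphi v))).
- by rewrite rpredN normr_real.
by exists c => // v /cmin; rewrite lerN2.
Qed.

Lemma compact_polyfun_sum_min n m (A : set 'rV[C]_n) (phi : 'I_m -> ('I_n -> C) -> C) :
  A !=set0 -> compact A -> (forall i, polyfun (phi i)) ->
  exists2 c, A c & forall v, A v -> \sum_i `|phi i (c 0)| <= \sum_i `|phi i (v 0)|.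
Proof.
move=> A0 cA pphi; apply: compact_real_min => // [v|v]; last by apply: rpred_sum => i _; rewrite normr_real.
suff h (r : seq 'I_m) : (fun w : 'rV[C]_n => \sum_(i <- r) `|phi i (w 0)|) @ v -->
    \sum_(i <- r) `|phi i (v 0)| by exact: h.
elim: r => [|i r IH].
  by rewrite big_nil; under eq_fun do rewrite big_nil; exact: (@cvg_cst C 0 _ (nbhs v) (nbhs_filter v)).
rewrite big_cons; under eq_fun do rewrite big_cons.
exact: (cvgD (cvg_norm (continuous_polyfun (pphi i) (x := v))) IH).
Qed.
End ExtremeValues.

Lemma norm_le_sum (K : numDomainType) (I : finType) (y : I -> K) j :
  `|y j| <= \sum_i `|y i|.
Proof. by rewrite (bigD1 j)//= lerDl sumr_ge0. Qed.

(** * Level sets of functions homogeneous under a contraction *)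

Section Contraction.
Variables (R : realType) (d : nat).
Local Notation C := (R[i] : numFieldType).
Variables (c : C) (k : 'I_d -> C).
Hypothesis c0 : 0 < c.
Hypothesis c1 : c < 1.
Hypothesis kP : forall j, 0 < k j <= c.
Implicit Types (y : 'I_d -> C) (n : nat).

Let norm1 y : C := \sum_j `|y j|.
Let scale n y := fun j => k j ^+ n * y j.
(** A common lower bound of the [k j], all of which are at most 1: one contraction cannot shrink
    [norm1] by more than this factor. *)
Let lam : C := \prod_j k j.

Let k0 j : 0 < k j. Proof. by case/andP: (kP j). Qed.
Let k1 j : k j <= 1. Proof. by case/andP: (kP j) => _ kc; exact: le_trans kc (ltW c1). Qed.
Let lam0 : 0 < lam. Proof. by apply: prodr_gt0 => j _; exact: k0. Qed.
Let lam_le j : lam <= k j.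
Proof.
rewrite /lam (bigD1 j)//= ler_piMr ?(ltW (k0 j))//.
by apply: prodr_ile1 => i _; rewrite k1 (ltW (k0 i)).
Qed.
Let lam1 : lam <= 1. Proof. by apply: prodr_ile1 => i _; rewrite k1 (ltW (k0 i)). Qed.
Let norm1_ge0 y : 0 <= norm1 y. Proof. exact: sumr_ge0. Qed.

Let norm1_scale n y : norm1 (scale n y) <= c ^+ n * norm1 y.
Proof.
rewrite /norm1 mulr_sumr; apply: ler_sum => j _.
rewrite normrM normrX (gtr0_norm (k0 j)) ler_wpM2r// lerXn2r ?nnegrE ?(ltW (k0 j)) ?(ltW c0)//.
by case/andP: (kP j).
Qed.

Let norm1_scale_ge n y : lam ^+ n * norm1 y <= norm1 (scale n y).
Proof.
rewrite /norm1 mulr_sumr; apply: ler_sum => j _.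
by rewrite normrM normrX (gtr0_norm (k0 j)) ler_wpM2r// lerXn2r ?nnegrE ?(ltW (k0 j)) ?(ltW lam0)//.
Qed.

Let scaleS n y : scale n.+1 y =1 scale 1 (scale n y).
Proof. by move=> j; rewrite /scale exprS expr1 mulrA. Qed.

Lemma geometric_lt (B eps : C) : 0 <= B -> 0 < eps -> exists n, c ^+ n * B < eps.
Proof.
move=> B0 e0; have toR (x : C) : 0 <= x -> x = (complex.Re x)%:C%C.
  by move=> x0; rewrite RRe_real// ger0_real.
suff h (q b e : R) : 0 < q -> q < 1 -> 0 <= b -> 0 < e -> exists n, q ^+ n * b < e.
  have cR := toR c (ltW c0); have BR := toR B B0; have eR := toR eps (ltW e0).
  have [||||n] := h (complex.Re c) (complex.Re B) (complex.Re eps).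
  - by rewrite -ltcR -cR.
  - by rewrite -ltcR -cR.
  - by rewrite -lecR -BR.
  - by rewrite -ltcR -eR.
  by rewrite -ltcR rmorphM rmorphXn /= -cR -BR -eR => h'; exists n.
move=> q0 q1 b0 {}e0.
have := @cvg_expr R q; rewrite gtr0_norm// => /(_ q1) /cvgrPdist_lt.
have eb : 0 < e / (b + 1) by rewrite divr_gt0// ltr_wpDl.
move=> /(_ _ eb)[N _ /(_ N (leqnn N))] /=.
rewrite sub0r normrN ger0_norm ?exprn_ge0 ?ltW// ltr_pdivlMr ?ltr_wpDl// => h.
exists N; rewrite (le_lt_trans _ h)//.
by apply: ler_wpM2l; rewrite ?exprn_ge0 ?lerDl ?(ltW q0).
Qed.

(** The shell lam <= norm1 <= 2 - lam, written as one norm inequality so that it passes to limits;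
    its lower bound keeps it away from the origin. *)
Let shell : set 'rV[C]_d := [set v | `|norm1 (v 0) - 1| <= 1 - lam].

Let norm1_coord y j : `|y j| <= norm1 y.
Proof. exact: (norm_le_sum y j). Qed.

Let norm1_real y : norm1 y \is Num.real. Proof. exact: ger0_real. Qed.

Let shellP v : shell v <-> lam <= norm1 (v 0) <= 2 - lam.
Proof.
rewrite /shell /= real_ler_norml ?rpredB ?norm1_real ?real1// lerBrDr lerBlDr opprB subrK.
by rewrite (_ : 1 - lam + 1 = 2 - lam) //; ring.
Qed.

Let shell_compact : compact shell.
Proof.
apply: (@compact_rV_criterion R d _ 2) => [v /shellP/andP[_ vS] j|u l uS ul].
  rewrite (le_trans (norm1_coord _ j))// (le_trans vS)// raddfMn /= rmorph1.
  by rewrite lerBlDr lerDl ltW.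
rewrite /shell /=; apply: (@cvg_norm_le C (fun n => norm1 (u n 0)) _ _ _ 0) => [|n _].
  apply: cvg_sum_seq => j; exact: (cvg_norm (ul j)).
exact: uS.
Qed.

(* A point of the level set far from the origin enters the shell after many
   contractions, where homogeneity makes [phi] smaller than its minimum there. *)
Lemma level_set_bounded m (phi : 'I_m -> ('I_d -> C) -> C) (y0 : 'I_d -> C) :
  (forall i, polyfun (phi i)) ->
  (forall i y, phi i (fun j => k j * y j) = c ^+ i.+1 * phi i y) ->
  (forall y, (forall i, phi i y = 0) -> forall j, y j = 0) ->
  exists M : R, forall y, (forall i, phi i y = phi i y0) -> forall j, `|y j| <= M%:C%C.
Proof.
move=> pphi hom zero.
have homn n i y : phi i (scale n y) = c ^+ n ^+ i.+1 * phi i y.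
  elim: n => [|n IH].
    rewrite expr0 expr1n mul1r; congr (phi i _); apply/funext => j.
    by rewrite /scale expr0 mul1r.
  rewrite (_ : scale n.+1 y = fun j => k j * scale n y j); last first.
    by apply/funext => j; rewrite /scale exprS mulrA.
  by rewrite hom IH mulrA -exprMn -exprS.
pose Psi y := \sum_i `|phi i y|.
have Psi_scale n y : Psi (scale n y) <= c ^+ n * Psi y.
  rewrite /Psi mulr_sumr; apply: ler_sum => i _; rewrite homn normrM !normrX (gtr0_norm c0).
  rewrite ler_wpM2r// exprS ler_piMr ?exprn_ge0 ?(ltW c0)//.
  by rewrite exprn_ile1// ?exprn_ge0 ?exprn_ile1 ?(ltW c0) ?(ltW c1).
have enter y : ~~ (norm1 y <= 1) -> exists n, shell (\row_j scale n y j).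
  move=> y1; have [N yN] := geometric_lt (norm1_ge0 y) ltr01.
  have ex : exists n, norm1 (scale n y) <= 1.
    by exists N; rewrite (le_trans (norm1_scale N y))// ltW.
  (* At the first time the norm drops to 1 or below, the preceding norm was at least 1, so the new
     one is at least [lam]. *)
  case: (ex_minnP ex) => -[|n] n1 nmin.
    move: y1 n1; rewrite (_ : scale 0 y = y); first by move=> /negP.
    by apply/funext => j; rewrite /scale expr0 mul1r.
  exists n.+1; apply/shellP.
  rewrite (_ : (\row_j scale n.+1 y j) 0 = scale n.+1 y); last first.
    by apply/funext => j; rewrite mxE.
  rewrite (le_trans n1) ?andbT; last by rewrite lerBrDr -[2]/(1 + 1) lerD.
  have : 1 <= norm1 (scale n y).
    rewrite real_leNgt ?real1//; apply/negP => /ltW /nmin; lia.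
  rewrite (_ : scale n.+1 y = scale 1 (scale n y)); last exact/funext/scaleS.
  move=> h; apply: le_trans (norm1_scale_ge 1 _); rewrite expr1.
  by rewrite ler_peMr// ltW.
have [shell0|shell0] := pselect (shell !=set0); last first.
  exists 1 => y _ j; have [y1|/enter[n sn]] := boolP (norm1 y <= 1).
    by rewrite rmorph1 (le_trans (norm1_coord y j)).
  by case: shell0; exists (\row_j scale n y j).
have [v /shellP/andP[vlam _] vmin] := compact_polyfun_sum_min shell0 shell_compact pphi.
set mn := \sum_i _ in vmin.
have mn0 : 0 < mn.
  rewrite lt_def sumr_ge0// andbT; apply/negP => /eqP /psumr_eq0P Psi0.
  have v0 : forall j, v 0 j = 0.
    by apply: zero => i; apply/eqP; rewrite -normr_eq0 Psi0.
  have := lt_le_trans lam0 vlam; rewrite /norm1 big1 ?ltxx// => j _.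
  by rewrite v0 normr0.
(* After N contractions [Psi] is below its minimum [mn] on the shell, so the shell is entered before
   time N; undoing at most N contractions bounds the norm by 2 / lam^N. *)
have [N cN] := @geometric_lt (Psi y0) mn (sumr_ge0 _ (fun i _ => normr_ge0 _)) mn0.
exists (complex.Re (2 / lam ^+ N)) => y yF j.
have lamN : 0 < lam ^+ N by rewrite exprn_gt0.
rewrite RRe_real; last by rewrite ger0_real// divr_ge0// ltW.
apply: le_trans (norm1_coord y j) _; rewrite ler_pdivlMr//.
have [y1|/enter[n sn]] := boolP (norm1 y <= 1).
  rewrite (le_trans _ (ler1n _ 2))// (le_trans (ler_wpM2r (ltW lamN) y1))// mul1r.
  by rewrite exprn_ile1// ltW.
have rowE : (\row_j scale n y j) 0 = scale n y by apply/funext => i; rewrite mxE.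
have nN : (n < N)%N.
  rewrite ltnNge; apply/negP => Nn.
  have := vmin _ sn; rewrite rowE => /le_trans/(_ (Psi_scale n y)).
  rewrite /Psi; under eq_bigr do rewrite yF.
  rewrite -/(Psi y0) => mnc; have := le_lt_trans mnc; move=> /(_ mn).
  rewrite ltxx => h; have /h : c ^+ n * Psi y0 < mn; last by [].
  apply: le_lt_trans cN; rewrite ler_wpM2r ?sumr_ge0//.
  by rewrite ler_wiXn2l// ltW.
have /shellP/andP[_] := sn; rewrite rowE => n2.
apply: (@le_trans _ _ (lam ^+ n * norm1 y)).
  rewrite mulrC; apply: (ler_wpM2r (norm1_ge0 y)); apply: ler_wiXn2l (ltnW nN) => //.
  exact: ltW.
apply: le_trans (norm1_scale_ge n y) _; apply: le_trans n2 _.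
by rewrite lerBlDr lerDl ltW.
Qed.

Lemma common_zero_ex m (phi : 'I_m -> ('I_d -> C) -> C)
    (xi : 'I_d -> ('I_d -> C) -> C) (y0 : 'I_d -> C) (j0 : 'I_d) :
  (forall i, polyfun (phi i)) -> (forall j, polyfun (xi j)) ->
  (forall i y, phi i (fun j => k j * y j) = c ^+ i.+1 * phi i y) ->
  (forall i y, exists a, dirder (fun t => phi i (fun j => y j + t * xi j y)) a 0) ->
  xi j0 y0 <> 0 ->
  exists2 y, (exists j, y j <> 0) & forall i, phi i y = 0.
Proof.
move=> pphi pxi hom dphi xi0; apply: contrapT => no.
have zero y : (forall i, phi i y = 0) -> forall j, y j = 0.
  by move=> hy j; apply: contrapT => yj; apply: no; exists y => //; exists j.
have [M FM] := level_set_bounded y0 pphi hom zero.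
pose F : set 'rV[C]_d := [set v | forall i, phi i (v 0) = phi i y0].
have cF : compact F.
  apply: (@compact_rV_criterion R d _ M) => [v Fv j|u l Fu ul i]; first exact: FM.
  apply/eqP; rewrite -subr_eq0; apply/eqP.
  apply: (@cvg_zero C (fun n => phi i (u n 0) - phi i y0)); last first.
    by move=> n; rewrite Fu subrr.
  apply: cvgB; last exact: cvg_cst.
  exact: (@cvg_polyfun C _ nat eventually _ (phi i) (fun n => u n 0) (l 0) (pphi i) ul).
have rowE y : (\row_j y j) 0 = y by apply/funext => i; rewrite mxE.
have F0 : F !=set0 by exists (\row_j y0 j) => i; rewrite rowE.
have [v Fv vmax] := compact_polyfun_max F0 cF (pxi j0).
have [p pP] := choice pphi; have [q qP] := choice pxi.
have arch (x : C) : exists n : nat, `|x| <= n%:R.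
  exists (Num.bound (complex.Re `|x|)).
  have -> : `|x| = (complex.Re `|x|)%:C%C by rewrite RRe_real ?normr_real.
  rewrite -(rmorph_nat (real_complex R)) lecR ltW//; apply: archi_boundP.
  by rewrite -ler0c RRe_real ?normr_real.
have v0 : mpoly.meval (v 0) (q j0) = 0.
  apply: (@bounded_level_vfield0 R[i] d (@sum_completeC R) _ p (fun i => phi i y0) q M%:C%C j0 (v 0)) => //.
  - move=> i y; have [a da] := dphi i y.
    rewrite /vfield raddf_sum /=; under eq_bigr do rewrite rmorphM /= -qP.
    have := dirder_mpoly (p i) y (fun j => xi j y).
    move=> h; apply: (dirder_unique h (da' := 0) (a' := a)).
    by apply: dirder_ext da => t; rewrite pP.
  - by move=> y hy; apply: FM => i; rewrite pP.
  - by move=> i; rewrite -pP Fv.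
  - move=> y hy; rewrite -!qP; have := vmax (\row_j y j); rewrite rowE; apply.
    by move=> i; rewrite rowE pP.
apply: xi0; apply/eqP; rewrite -normr_le0.
have := vmax (\row_j y0 j); rewrite rowE (qP j0 (v 0)) v0 normr0; apply.
by move=> i; rewrite rowE.
Qed.
End Contraction.

Lemma mx_exprZ (F : fieldType) n (a : F) (A : 'M[F]_n) i : (a *: A) ^+ i = a ^+ i *: A ^+ i.
Proof.
elim: i => [|i IH]; first by rewrite !expr0 scale1r.
rewrite !exprS IH -[LHS]/((a *: A) *m (a ^+ i *: A ^+ i)).
by rewrite -scalemxAl -scalemxAr scalerA.
Qed.

Lemma mxtrace_exprZ (F : fieldType) n (a : F) (A : 'M[F]_n) i :
  \tr ((a *: A) ^+ i) = a ^+ i * \tr (A ^+ i).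
Proof. by rewrite mx_exprZ mxtraceZ. Qed.

Lemma trace_pow_scale_morph (F : fieldType) (g : lieAlgType F) (phi psi : 'End(g)) a x k :
  lie_morph phi -> (phi \o psi = \1)%VF ->
  \tr (opmx (ad (a *: phi x)) ^+ k) = a ^+ k * \tr (opmx (ad x) ^+ k).
Proof.
by move=> phiM pp; rewrite adZ opmxZ mxtrace_exprZ (trace_pow_morph _ _ phiM pp).
Qed.

Lemma lker_comp_sub (F : fieldType) (U V W : vectType F) (p : 'Hom(U, V)) (q : 'Hom(V, W)) :
  (lker p <= lker (q \o p))%VS.
Proof. by apply/subvP => w; rewrite !memv_ker comp_lfunE => /eqP ->; rewrite linear0. Qed.

Lemma memv_ker_cap (F : fieldType) (U V W : vectType F) (p : 'Hom(U, V)) (q : 'Hom(U, W)) v :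
  (v \in (lker p :&: lker q)%VS) = (p v == 0) && (q v == 0).
Proof. by rewrite memv_cap !memv_ker. Qed.

(** * The slice through a principal nilpotent element *)

Section Slice.
Variables (R : realType) (g : lieAlgType R[i]) (gR : set g) (theta : 'End(g)).
Local Notation C := (R[i] : numFieldType).
Hypothesis rf : real_form gR.
Hypothesis theta_aut : lie_automorphism theta.
Hypothesis theta2 : order_two theta.
Hypothesis theta_real : forall x, gR x -> gR (theta x).
Hypothesis cartan : cartan_decomposition gR (gR `&` fixed_part theta)
                                           (gR `&` antifixed_part theta).
Variables e h f : g.
Hypothesis cayley : complex_cayley_triple theta gR e h f.
Local Notation sigma := (rconj rf).
Local Notation tau := (cartan_conj rf theta).
Local Notation hf := (cartan_form rf theta).
Let hP : hermitian_posdef hf.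
Proof. exact: cartan_form_posdef. Qed.

Let sl2 : sl2_triple e h f. Proof. by case: cayley. Qed.
Let th : theta h = h. Proof. by case: cayley. Qed.
Let te : theta e = - e. Proof. by case: cayley. Qed.
Let tf : theta f = - f. Proof. by case: cayley. Qed.
Let se : sigma e = f.
Proof. by case: cayley => _ _ _ _ /(conjugate_wrt_rconj rf) ->. Qed.
Let taue : tau e = - f. Proof. by rewrite /cartan_conj se tf. Qed.
Let tauf : tau f = - e. Proof. by rewrite /cartan_conj -se rconjK te. Qed.
Let tauh : tau h = - h.
Proof. by rewrite -{1}(lie_ef sl2) tau_lie// taue tauf lieNl lieNr opprK (lie_fe sl2). Qed.

Lemma cartan_form_e x y : hf (lie e x) y = hf x (lie f y).
Proof. by rewrite cartan_form_lie// taue lieNl (hermNr hP) opprK. Qed.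
Lemma cartan_form_f x y : hf (lie f x) y = hf x (lie e y).
Proof. by rewrite cartan_form_lie// tauf lieNl (hermNr hP) opprK. Qed.
Lemma cartan_form_h x y : hf (lie h x) y = hf x (lie h y).
Proof. by rewrite cartan_form_lie// tauh lieNl (hermNr hP) opprK. Qed.

Definition slice : {vspace g} := (lker (ad f) :&: lker (theta + \1%VF)%R)%VS.

Lemma sliceP v : v \in slice <-> lie f v = 0 /\ theta v = - v.
Proof.
rewrite memv_ker_cap lfunD_E id_lfunE adE addr_eq0.
by split=> [/andP[/eqP ? /eqP ?]|[-> ->]]; rewrite ?eqxx.
Qed.

(** ad h is self-adjoint and preserves the slice. Its weights are nonpositive because [f, b] = 0
    gives a |b|^2 = - |[e, b]|^2. *)
Lemma slice_eigenbasis : exists2 X, orthogonal_expansion hf slice X &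
  forall b, b \in X -> exists2 m : R, m <= 0 & lie h b = m%:C%C *: b.
Proof.
have [x /sliceP[fx tx]|b a bS hb x xS xb|X XP Xh] := @orthogonal_eigenbasis _ _ _ hP (ad h) slice.
- apply/sliceP; rewrite adE; split.
    by rewrite lie_leibniz (lie_fh sl2) fx lie0r lieZl fx scaler0 addr0.
  by rewrite theta_lie// th tx lieNr.
- by rewrite adE cartan_form_h -adE hb (hermZr hP) xb mulr0.
exists X => // b bX; have [a] := Xh b bX; rewrite adE => hb.
have [/(_ b bX)[/sliceP[fb _] b0] _ _ _] := XP.
have fe : lie h b = - lie f (lie e b).
  by rewrite lie_leibniz fb lie0r addr0 (lie_fe sl2) lieNl opprK.
have ha : a * hf b b = - hf (lie e b) (lie e b).
  by rewrite -(hermZl hP) -hb fe (hermNl hP) cartan_form_f.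
have bb := herm_gt0 hP b0.
have a0 : a <= 0.
  rewrite -(pmulr_lle0 _ bb) ha oppr_le0; exact: herm_ge0 hP _.
exists (complex.Re a); last by rewrite RRe_real// ler0_real.
by rewrite -lecR RRe_real// ler0_real.
Qed.

Section Coordinates.
Variables (X : seq g) (mu : 'I_(size X) -> R).
Hypothesis XP : orthogonal_expansion hf slice X.
Hypothesis mu_le0 : forall j, mu j <= 0.
Hypothesis muP : forall j : 'I_(size X), lie h X`_j = (mu j)%:C%C *: X`_j.
Local Notation d := (size X).
Implicit Types y : 'I_d -> C.

Definition slice_pt y : g := e + \sum_(j < d) y j *: X`_j.
Definition slice_coord v (j : 'I_d) : C := hf v X`_j / hf X`_j X`_j.

Lemma slice_basis_mem (j : 'I_d) : X`_j \in slice /\ X`_j != 0.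
Proof. by have [h1 _ _ _] := XP; apply/h1/mem_nth. Qed.

Lemma slice_coordP v : v \in slice -> v = \sum_(j < d) slice_coord v j *: X`_j.
Proof.
have [_ _ _ Xe] := XP => /Xe vE.
by rewrite {1}vE (big_nth 0) big_mkord.
Qed.

Lemma slice_coordK y j : slice_coord (\sum_(i < d) y i *: X`_i) j = y j.
Proof.
have [_ Xo Xu _] := XP; have [_ X0] := slice_basis_mem j.
rewrite /slice_coord (herm_suml hP) (bigD1 j)//= (hermZl hP) big1 => [|i ij].
  by rewrite addr0 mulfK// (herm_neq0 hP).
rewrite (hermZl hP) Xo ?mulr0 ?mem_nth//.
by rewrite nth_uniq.
Qed.

Lemma slice_ptD y t w :
  slice_pt (fun j => y j + t * w j) = slice_pt y + t *: \sum_(j < d) w j *: X`_j.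
Proof.
rewrite /slice_pt -addrA; congr (_ + _).
rewrite scaler_sumr -big_split; apply: eq_bigr => j _ /=.
by rewrite scalerDl scalerA.
Qed.

Lemma slice_pt_theta y : theta (slice_pt y) = - slice_pt y.
Proof.
rewrite /slice_pt linearD linear_sum /= te opprD -sumrN; congr (_ + _).
apply: eq_bigr => j _; rewrite linearZ /=; have [/sliceP[_ ->] _] := slice_basis_mem j.
by rewrite scalerN.
Qed.

(** The factor exp (-2) cancels the action of exp (ad h) on e, of weight 2; the slice directions, of
    weight at most 0, shrink at least by this factor. *)
Definition contraction_ratio : C := (expR (- 2))%:C%C.
Definition contraction_coef (j : 'I_d) : C := (expR (mu j - 2))%:C%C.
Local Notation c := contraction_ratio.
Local Notation k := contraction_coef.

Lemma contraction_ratio_gt0 : 0 < c.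
Proof. by rewrite -(rmorph0 (real_complex R)) ltcR expR_gt0. Qed.

Lemma contraction_ratio_lt1 : c < 1.
Proof. by rewrite -(rmorph1 (real_complex R)) ltcR expR_lt1 oppr_lt0. Qed.

Lemma contraction_coefP j : 0 < k j <= c.
Proof.
rewrite -(rmorph0 (real_complex R)) ltcR expR_gt0 lecR ler_expR.
by rewrite gerDr mu_le0.
Qed.

Lemma slice_pt_scale y :
  slice_pt (fun j => k j * y j) = c *: lfun_exp (ad h) (slice_pt y).
Proof.
have cE : c * cexp 2 = 1.
  rewrite -(rmorph_nat (real_complex R)) cexp_real -rmorphM -expRD addrC subrr expR0.
  exact: rmorph1.
rewrite /slice_pt linearD linear_sum /= scalerDr; congr (_ + _).
  rewrite (lfun_exp_eigen (a := 2)) ?adE ?(lie_he sl2)// scalerA cE.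
  by rewrite scale1r.
rewrite scaler_sumr; apply: eq_bigr => j _; rewrite linearZ /=.
rewrite (lfun_exp_eigen (a := (mu j)%:C%C)) ?adE ?muP// cexp_real !scalerA; congr (_ *: _).
by rewrite /k expRD rmorphM; ring.
Qed.

(** The contraction leaves the K-orbit by a scalar factor, which is why cones over orbits are
    considered below. *)
Lemma slice_pt_scale_orbit n y : exists2 psi, adgroup (fixed_part theta) psi &
  slice_pt (fun j => k j ^+ n * y j) = c ^+ n *: psi (slice_pt y).
Proof.
elim: n => [|n [psi Kpsi IH]].
  exists \1%VF; first exact: adgroup1.
  rewrite expr0 scale1r lfunE /=; congr slice_pt; apply/funext => j.
  by rewrite expr0 mul1r.
exists (lfun_exp (ad h) \o psi)%VF; first exact: adgroupM.
rewrite comp_lfunE (_ : (fun j => _) = fun j => k j * (k j ^+ n * y j)); last first.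
  by apply/funext => j; rewrite exprS mulrA.
by rewrite slice_pt_scale IH linearZ scalerA exprS.
Qed.

Lemma contraction_cvg0 y i : (fun n => k i ^+ n * y i : C) @ \oo --> (0 : C).
Proof.
rewrite -[X in _ --> X](mul0r (y i)); apply: cvgM; last exact: cvg_cst.
apply/(@cvgrPdist_lt C C^o) => eps e0.
have /andP[k0 kc] := contraction_coefP i.
have [N cN] := geometric_lt contraction_ratio_gt0 contraction_ratio_lt1 ler01 e0.
exists N => // n /= Nn; rewrite sub0r normrN normrX (gtr0_norm k0).
apply: le_lt_trans cN; rewrite mulr1.
apply: (@le_trans _ _ (c ^+ n)); first by apply: lerXn2r => //; rewrite nnegrE ltW// contraction_ratio_gt0.
by apply: ler_wiXn2l => //; apply: ltW; rewrite ?contraction_ratio_gt0 ?contraction_ratio_lt1.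
Qed.

Lemma ratio_cvg0 a : (fun n => c ^+ n * a : C) @ \oo --> (0 : C).
Proof.
rewrite -[X in _ --> X](mul0r a); apply: cvgM; last exact: cvg_cst.
apply/(@cvgrPdist_lt C C^o) => eps e0.
have [N cN] := geometric_lt contraction_ratio_gt0 contraction_ratio_lt1 ler01 e0.
exists N => // n /= Nn; rewrite sub0r normrN normrX (gtr0_norm contraction_ratio_gt0).
apply: le_lt_trans cN; rewrite mulr1.
by apply: ler_wiXn2l => //; apply: ltW; rewrite ?contraction_ratio_gt0 ?contraction_ratio_lt1.
Qed.

Definition vec_poly (v : ('I_d -> C) -> g) := forall j, polyfun (fun y => vcoord j (v y)).

Lemma slice_pt_poly : vec_poly slice_pt.
Proof.
move=> j; apply: (@polyfun_ext _ _ (fun w => vcoord j e + \sum_(i < d) w i * vcoord j X`_i)).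
  move=> w; rewrite /slice_pt vcoordD linear_sum; congr (_ + _).
  by apply: eq_bigr => i _ /=; rewrite vcoordZ.
apply: polyfunD; first exact: polyfun_cst.
by apply: polyfun_sum => i; apply: polyfunM; [exact: polyfun_coord|exact: polyfun_cst].
Qed.

Lemma slice_pt_cvg y : vcvg (fun n => slice_pt (fun j => k j ^+ n * y j)) e.
Proof.
move=> j; pose ell (w : 'I_d -> C) := vcoord j (slice_pt w).
have pell : polyfun ell by exact: slice_pt_poly.
have -> : vcoord j e = ell (fun=> 0).
  by rewrite /ell /slice_pt big1 ?addr0// => i _; rewrite scale0r.
apply: (@cvg_polyfun C _ nat eventually _ ell (fun n j => k j ^+ n * y j) _ pell) => i.
exact: contraction_cvg0.
Qed.

Definition slice_mx y := opmx (ad (slice_pt y)).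

Lemma slice_mx_poly : polymx slice_mx.
Proof.
have -> : slice_mx = fun y => opmx (ad e) + \sum_(j < d) y j *: opmx (ad X`_j).
  apply/funext => y; rewrite /slice_mx /slice_pt adD opmxD; congr (_ + _).
  rewrite (_ : ad _ = \sum_(j < d) y j *: ad X`_j); last first.
    apply/lfunP => v; rewrite adE lie_suml sum_lfunE; apply: eq_bigr => j _.
    by rewrite lfunZ_E adE lieZl.
  by rewrite /opmx raddf_sum; apply: eq_bigr => j _; exact: opmxZ.
apply: polymxD; first exact: polymx_cst.
by apply: polymx_sum => j; apply: polymxZ; [exact: polyfun_coord|exact: polymx_cst].
Qed.

(** Exponents run from 1 to the dimension of g, the range in which vanishing traces characterize
    nilpotency. *)
Definition slice_trace (i : 'I_(\dim {:g})) y : C := \tr (slice_mx y ^+ i.+1).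

Lemma slice_trace_poly i : polyfun (slice_trace i).
Proof. exact/polyfun_trace/polymxX/slice_mx_poly. Qed.

Lemma slice_trace_scale i y :
  slice_trace i (fun j => k j * y j) = c ^+ i.+1 * slice_trace i y.
Proof.
rewrite /slice_trace /slice_mx slice_pt_scale.
exact: (trace_pow_scale_morph c _ _ (lfun_exp_ad_morph h) (lfun_exp_adN h)).
Qed.

Lemma slice_trace_nilpotent y : nilpotent_elt g (slice_pt y) <-> forall i, slice_trace i y = 0.
Proof.
rewrite nilpotent_traceP; split=> [t0 i|t0 [|i]//= iD]; first by apply: t0; rewrite /= ltn_ord.
exact: (t0 (Ordinal iD)).
Qed.

Let vb : basis_of {:g} (vbasis {:g}). Proof. exact: vbasisP. Qed.
Let vcoordE (v : g) j : vcoord j v = rVof (vbasis {:g}) v 0 j. Proof. by rewrite mxE. Qed.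

Lemma ker_img_direct : (lker (ad e) :&: limg (ad f) = 0)%VS /\
  (lker (ad e) + limg (ad f) = fullv)%VS.
Proof. by apply: (orthogonal_direct hP) => v w; rewrite !adE cartan_form_e. Qed.

Lemma ker_img_eq0 v w : lie e v = 0 -> v = lie f w -> v = 0.
Proof.
move=> ev vw; have [cap0 _] := ker_img_direct.
apply/eqP; rewrite -memv0 -cap0 memv_cap memv_ker adE ev eqxx /= vw -adE.
exact: memv_img (memvf w).
Qed.

Definition ker_proj := daddv_pi (lker (ad e)) (limg (ad f)).

Lemma ker_projP v : lie e (ker_proj v) = 0 /\ exists w, v - ker_proj v = lie f w.
Proof.
have [cap0 full] := ker_img_direct; split.
  by apply/eqP; rewrite -adE -memv_ker memv_pi.
have vin : v \in (lker (ad e) + limg (ad f))%VS by rewrite full memvf.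
have := daddv_pi_add cap0 vin; rewrite -/ker_proj => vE.
have /memv_imgP[w _] := memv_pi (limg (ad f)) (lker (ad e)) v.
by rewrite adE => wE; exists w; rewrite -wE -{1}vE addrC addKr.
Qed.

(* Invertible at the origin.  It agrees with [ad f \o ad (slice_pt y)] modulo
   [ker_proj], so preimages of [ker (ad e)] solve [f, [x, v]] = 0. *)
Definition slice_op y : 'End(g) := (ad f \o ad (slice_pt y))%VF + ker_proj.

Lemma slice_opP y v a : lie e a = 0 -> slice_op y v = a ->
  [/\ lie f (lie (slice_pt y) v) = 0, ker_proj v = a & exists w, v - a = lie f w].
Proof.
move=> ea; rewrite lfunD_E comp_lfunE !adE => Nv.
have [eP [w vw]] := ker_projP v.
have aP : a - ker_proj v = lie f (lie (slice_pt y) v) by rewrite -Nv addrK.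
have aP0 : a - ker_proj v = 0 by apply: (ker_img_eq0 _ aP); rewrite lieBr ea eP subr0.
have Pa : ker_proj v = a by apply/esym/eqP; rewrite -subr_eq0 aP0.
by split => //; [rewrite -aP|exists w; rewrite -Pa].
Qed.

(** A kernel vector v has [f, [e, v]] = 0, so [e, v] = 0 by adjointness, and it lies in the image of
    ad f, which meets ker (ad e) only in 0. *)
Lemma slice_op_det0 : \det (opmx (slice_op (fun=> 0))) != 0.
Proof.
apply/det0P => -[r r0 rN]; pose v := vecof (vbasis {:g}) r.
have v0 : v != 0 by rewrite /v vecof_eq0.
have Nv : slice_op (fun=> 0) v = 0.
  by apply/eqP; rewrite -(rVof_eq0 vb) (rVof_app _ vb) /v vecofK// rN.
have [fxv _ [w]] := slice_opP (lie0r e) Nv; rewrite subr0 => vw.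
move: fxv; rewrite /slice_pt big1 ?addr0 => [fev|j _]; last by rewrite scale0r.
have ev : lie e v = 0 by apply: (herm_eq0 hP); rewrite cartan_form_e fev (herm0r hP).
by move: v0; rewrite (ker_img_eq0 ev vw) eqxx.
Qed.

Lemma slice_op_poly : polymx (fun y => opmx (slice_op y)).
Proof.
rewrite (_ : (fun y => _) = fun y => slice_mx y *m opmx (ad f) + opmx ker_proj); last first.
  by apply/funext => y; rewrite /slice_op opmxD opmx_comp.
apply: polymxD; last exact: polymx_cst.
by apply: polymxM; [exact: slice_mx_poly|exact: polymx_cst].
Qed.

Lemma slice_op_det_eventually y : exists N, forall n, (N <= n)%N ->
  \det (opmx (slice_op (fun j => k j ^+ n * y j))) != 0.
Proof.
have pd := polyfun_det slice_op_poly.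
apply: (@cvg_eventually_neq0 C (fun n => \det (opmx (slice_op (fun j => k j ^+ n * y j))))
  (\det (opmx (slice_op (fun=> 0))))); last exact: slice_op_det0.
apply: (@cvg_polyfun C _ nat eventually _ _ (fun n j => k j ^+ n * y j) _ pd) => i.
exact: contraction_cvg0.
Qed.

Lemma vec_poly_scalar v (ell : {scalar g}) : vec_poly v -> polyfun (fun y => ell (v y)).
Proof.
move=> pv; apply: (polyfun_ext (phi := fun y => \sum_j vcoord j (v y) * ell (vbasis {:g})`_j)).
  by move=> y; rewrite -scalar_vcoord.
by apply: polyfun_sum => j; apply: polyfunM; [exact: pv|exact: polyfun_cst].
Qed.

Lemma vec_poly_lin v (T : 'End(g)) : vec_poly v -> vec_poly (fun y => T (v y)).
Proof.
move=> pv j; have lT : linear_for *%R (fun v => vcoord j (T v)) by move=> a x y; rewrite !linearP.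
pose ell : {scalar g} := HB.pack (fun v => vcoord j (T v))
  (GRing.isLinear.Build _ _ _ _ (fun v => vcoord j (T v)) lT).
exact: (vec_poly_scalar ell pv).
Qed.

Lemma vec_polyD v w : vec_poly v -> vec_poly w -> vec_poly (fun y => v y + w y).
Proof.
move=> pv pw j; apply: (polyfun_ext (phi := fun y => vcoord j (v y) + vcoord j (w y))).
  by move=> y; rewrite vcoordD.
by apply: polyfunD.
Qed.

Lemma vec_poly_lie v w : vec_poly v -> vec_poly w -> vec_poly (fun y => lie (v y) (w y)).
Proof.
move=> pv pw j; pose b := vbasis {:g}.
apply: (polyfun_ext (phi := fun y => \sum_(i < \dim {:g}) \sum_(l < \dim {:g})
      (vcoord i (v y) * vcoord l (w y)) * vcoord j (lie b`_i b`_l))).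
  move=> y; rewrite [in RHS](vcoord_sum (v y)) lie_suml linear_sum; apply: eq_bigr => i _.
  rewrite lieZl scalarZ {2}[w y]vcoord_sum (linear_sum (lie b`_i)) linear_sum mulr_sumr.
  by apply: eq_bigr => l _; rewrite /= lieZr scalarZ mulrA.
apply: polyfun_sum => i; apply: polyfun_sum => l; apply: polyfunM; last exact: polyfun_cst.
by apply: polyfunM; [exact: pv|exact: pw].
Qed.

(** * Polynomial vector fields on the slice *)

Section VectorField.
Variable w0 : g.
Hypothesis ew0 : lie e w0 = 0.
Hypothesis tw0 : theta w0 = w0.

(* Cramer's rule: the solution of [slice_op y v = w0] with the denominator cleared. *)
Definition lift_vec y : g :=
  vecof (vbasis {:g}) (rVof (vbasis {:g}) w0 *m \adj (opmx (slice_op y))).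

Lemma lift_vecE y : slice_op y (lift_vec y) = \det (opmx (slice_op y)) *: w0.
Proof.
apply: (can_inj (rVofK vb)); rewrite (rVof_app _ vb) /lift_vec vecofK// -mulmxA mul_adj_mx.
by rewrite mul_mx_scalar linearZ.
Qed.

(** Symmetrizing puts the generator in k, so its bracket with a point of p stays in p. The image
    under theta solves the same equation, as theta negates both f and the slice point. *)
Definition field_gen y : g := lift_vec y + theta (lift_vec y).
(* Tangent to the slice because [f, [x, lift_vec y]] = 0, and to the adjoint orbit
   because it is a bracket with [x]. *)
Definition slice_field y : g := lie (field_gen y) (slice_pt y).

Lemma lift_vecP y : lie f (lie (slice_pt y) (lift_vec y)) = 0 /\
  exists w, lift_vec y - \det (opmx (slice_op y)) *: w0 = lie f w.
Proof. by have [] := slice_opP _ (lift_vecE y); rewrite ?lieZr ?ew0 ?scaler0. Qed.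

Lemma field_gen_theta y : theta (field_gen y) = field_gen y.
Proof. by rewrite /field_gen linearD /= thetaK// addrC. Qed.

Lemma slice_field_slice y : slice_field y \in slice.
Proof.
have [fw _] := lift_vecP y; apply/sliceP; split; last first.
  by rewrite theta_lie// field_gen_theta slice_pt_theta lieNr.
have ftw : lie f (lie (slice_pt y) (theta (lift_vec y))) = 0.
  have := congr1 theta fw; rewrite linear0 theta_lie// tf theta_lie// slice_pt_theta.
  by rewrite !lieNl lieNr opprK.
by rewrite /slice_field [lie (field_gen y) _]lie_antisym lieNr /field_gen lieDr lieDr fw ftw addr0 oppr0.
Qed.

(** Modulo the image of ad f the generator is always this multiple of w0. If it commutes with e, the
    difference lies in ker (ad e) as well, hence is zero. *)
Lemma slice_field_gen0 y : lie e (field_gen y) = 0 ->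
  field_gen y = (2 * \det (opmx (slice_op y))) *: w0.
Proof.
have [_ [w wE]] := lift_vecP y => eu.
have twE : theta (lift_vec y) - \det (opmx (slice_op y)) *: w0 = lie f (- theta w).
  by rewrite -{1}tw0 -linearZ -linearB /= wE theta_lie// tf lieNl lieNr.
apply/eqP; rewrite -subr_eq0; apply/eqP.
apply: (@ker_img_eq0 _ (w - theta w)); first by rewrite lieBr eu lieZr ew0 scaler0 subr0.
rewrite lieDr -wE -twE /field_gen; module_ring.
Qed.

Lemma lift_vec_poly : vec_poly lift_vec.
Proof.
move=> j; apply: (polyfun_ext (phi := fun y =>
    (rVof (vbasis {:g}) w0 *m \adj (opmx (slice_op y))) 0 j)).
  by move=> y; rewrite vcoordE /lift_vec vecofK.
apply: polymxM; first exact: polymx_cst.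
exact/polymx_adj/slice_op_poly.
Qed.

Lemma slice_field_poly j : polyfun (fun y => slice_coord (slice_field y) j).
Proof.
have pf : vec_poly slice_field.
  apply: vec_poly_lie; last exact: slice_pt_poly.
  by apply: vec_polyD; [|apply: vec_poly_lin]; exact: lift_vec_poly.
apply: (polyfun_ext (phi := fun y => (hf X`_j X`_j)^-1 * hermL hP X`_j (slice_field y))).
  by move=> y; rewrite mulrC.
by apply: polyfunZ; exact: vec_poly_scalar.
Qed.

Lemma slice_trace_field i y : exists a,
  dirder (fun t => slice_trace i (fun j => y j + t * slice_coord (slice_field y) j)) a 0.
Proof.
exists (\tr (slice_mx y ^+ i.+1)); rewrite /slice_trace.
(* The sign is due to [opmx] reversing compositions. *)
apply: (dirder_trace_commutator (B := - opmx (ad (field_gen y)))) => t.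
rewrite /slice_mx slice_ptD -slice_coordP ?slice_field_slice// adD adZ opmxD opmxZ.
rewrite /slice_field ad_lie opmxD opmxN !opmx_comp mulNmx mulmxN opprK.
by rewrite [- _ + _]addrC.
Qed.

End VectorField.

Let tau0 : tau 0 = 0.
Proof. by rewrite -{1}(subrr (0 : g)) tauB subrr. Qed.

(** The condition tau z' = - z' makes ad z' self-adjoint. Take z - tau z, or i z when tau z = z. *)
Lemma centralizing_tau z : theta z = - z -> lie z e = 0 -> lie z f = 0 -> z <> 0 ->
  exists z', [/\ z' <> 0, theta z' = - z', tau z' = - z', lie z' e = 0 & lie z' f = 0].
Proof.
move=> tz ze zf z0.
have ttz : theta (tau z) = - tau z by rewrite -tau_theta// tz tauN.
have tze : lie (tau z) e = 0.
  by rewrite -[e]opprK -tauf lieNr -tau_lie// zf tau0 oppr0.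
have tzf : lie (tau z) f = 0.
  by rewrite -[f]opprK -taue lieNr -tau_lie// ze tau0 oppr0.
have [z1|z1] := pselect (z - tau z = 0); last first.
  exists (z - tau z); split => //; rewrite ?lieBl ?ze ?tze ?zf ?tzf ?subrr//.
    have -> : theta (z - tau z) = theta z - theta (tau z) by exact: linearB.
    by rewrite tz ttz opprB opprK addrC.
    by rewrite tauB tauK// opprB.
have zt : tau z = z by apply/esym/eqP; rewrite -subr_eq0 z1.
exists ('i%C *: z); split; rewrite ?lieZl ?ze ?zf ?scaler0//.
- by move/eqP; rewrite scaler_eq0 (negPf (i_neq0 R)) /= => /eqP.
- by rewrite linearZ /= tz scalerN.
- by rewrite tauZ zt conjc_i scaleNr.
Qed.

(** * A nilpotent point of the slice obtained from a centralizing element *)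

Section Centralizing.
Variable z : g.
Hypothesis z0 : z <> 0.
Hypothesis tz : theta z = - z.
Hypothesis tauz : tau z = - z.
Hypothesis ze : lie z e = 0.
Hypothesis zf : lie z f = 0.

Let hf_z (x y : g) : hf (lie z x) y = hf x (lie z y).
Proof. by rewrite cartan_form_lie// tauz lieNl (hermNr hP) opprK. Qed.

Let comm_ze v : lie z (lie e v) = lie e (lie z v).
Proof. by rewrite lie_leibniz ze lie0l add0r. Qed.

Let comm_iter n v : lie z (iter n (lie e) v) = iter n (lie e) (lie z v).
Proof. by elim: n => //= n IH; rewrite comm_ze IH. Qed.

(** ad z is self-adjoint and nonzero, since [hf z z] is a trace form in ad z, so it has a nonzero
    eigenvalue. Its eigenspace is stable under the nilpotent ad e; take the last nonzero iterate. *)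
Lemma centralizing_eigenvector : exists a u, [/\ a != 0, u != 0, lie z u = a *: u & lie e u = 0].
Proof.
have [x _|b a bS hb x xS xb|X' X'P X'z] := @orthogonal_eigenbasis _ _ _ hP (ad z) fullv.
  exact: memvf.
  by rewrite adE hf_z -adE hb (hermZr hP) xb mulr0.
have [b [a [bX a0 zb]]] : exists b a, [/\ b \in X', a != 0 & ad z b = a *: b].
  apply: contrapT => no; have z00 : ad z = 0.
    apply/lfunP => v; have [_ _ _ /(_ v (memvf v)) ->] := X'P.
    rewrite [RHS]lfunE linear_sum /=; apply: big1_seq => b /= bX; rewrite linearZ /=.
    have [a zb] := X'z b bX; have [a0|a0] := eqVneq a 0; first by rewrite zb a0 scale0r scaler0.
    by case: no; exists b, a.
  have : hf z z = 0.
    by rewrite /cartan_form tauz killingE z00 -(scale0r (0 : 'End(g))) opmxZ scale0r mulmx0 mxtrace0 oppr0.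
  by move/(herm_eq0 hP).
have b0 : b != 0 by have [/(_ b bX)[]] := X'P.
have [n en] := sl2_nilpotent sl2.
have ex : exists n, iter n (lie e) b == 0 by exists n; rewrite en.
case: (ex_minnP ex) => -[|m]; first by rewrite /= (negPf b0).
move=> /eqP em mmin; exists a, (iter m (lie e) b); split => //.
- by apply/negP => /mmin; rewrite ltnn.
- rewrite comm_iter -adE zb; elim: (m) => //= p ->; exact: lieZr.
Qed.

(** On this kernel ad e is - s (ad z), so a power of ad z kills v; being self-adjoint, ad z itself
    kills v. *)
Lemma centralizing_ker s v : s != 0 -> lie (e + s *: z) v = 0 -> lie e v = 0 /\ lie z v = 0.
Proof.
move=> s0 ev; have E1 w : lie (e + s *: z) w = 0 -> lie e w = - s *: lie z w.
  by rewrite lieDl lieZl scaleNr => /eqP; rewrite addr_eq0 => /eqP.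
have Ezv : forall n, lie (e + s *: z) (iter n (lie z) v) = 0.
  elim=> //= n IH; rewrite lieDl lieZl -comm_ze -lieZr.
  by rewrite -lieDr -[X in lie z X]/(lie e _ + s *: lie z _) -lieZl -lieDl IH lie0r.
have En n : iter n (lie e) v = (- s) ^+ n *: iter n (lie z) v.
  elim: n => [|n IH]; first by rewrite scale1r.
  by rewrite iterS IH lieZr E1// scalerA -exprSr iterS.
have [n en] := sl2_nilpotent sl2.
have zn : exists n, iter n.+1 (lie z) v == 0.
  exists n; have /eqP := En n; rewrite en eq_sym scaler_eq0 expf_eq0 oppr_eq0 (negPf s0) andbF /=.
  by move=> /eqP zn; rewrite zn lie0r.
case: (ex_minnP zn) => -[|m] /eqP zm mmin.
  by move: zm => /= zm; rewrite E1 ?zm ?scaler0.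
have : iter m.+1 (lie z) v = 0.
  by apply: (herm_eq0 hP); rewrite {1}iterS hf_z -iterS zm (herm0r hP).
by move/eqP/mmin; rewrite ltnn.
Qed.

Lemma slice_nilpotent_ex : exists2 y : 'I_d -> C, (exists j, y j <> 0) & nilpotent_elt g (slice_pt y).
Proof.
have [a [u [a0 u0 zu eu]]] := centralizing_eigenvector.
pose w0 := u + theta u.
have ew0 : lie e w0 = 0.
  have := congr1 theta eu; rewrite theta_lie// te linear0 lieNl => /eqP.
  by rewrite oppr_eq0 => /eqP etu; rewrite /w0 lieDr eu etu addr0.
have tw0 : theta w0 = w0 by rewrite /w0 linearD /= thetaK// addrC.
(* As z is in p, theta u has eigenvalue - a, so [z, w0] = a (u - theta u). If this were zero, u
   would be an eigenvector for both a and - a. *)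
have zw0 : lie z w0 != 0.
  have ztu : lie z (theta u) = - (a *: theta u).
    have := congr1 theta zu; rewrite theta_lie// tz lieNl linearZ /= => /eqP.
    by rewrite eqr_oppLR => /eqP.
  rewrite /w0 lieDr zu ztu -scalerBr scaler_eq0 (negPf a0) /= subr_eq0.
  apply/negP => /eqP tu; move: ztu; rewrite -tu zu => /eqP; rewrite -addr_eq0.
  by rewrite -mulr2n -scaler_nat !scaler_eq0 (negPf a0) (negPf u0) pnatr_eq0.
have zS : z \in slice by apply/sliceP; split => //; rewrite lie_antisym zf oppr0.
pose y1 s := fun j => s * slice_coord z j.
have y1E s : slice_pt (y1 s) = e + s *: z.
  rewrite {1}(slice_coordP zS) /slice_pt scaler_sumr; congr (_ + _).
  by apply: eq_bigr => j _; rewrite scalerA.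
(* The determinant is nonzero at e, hence also for s a high power of the contraction ratio. *)
have [s s0 sdet] : exists2 s : C, s != 0 & \det (opmx (slice_op (y1 s))) != 0.
  have pd := polyfun_det slice_op_poly.
  have [N hN] : exists N, forall n, (N <= n)%N ->
      \det (opmx (slice_op (y1 (contraction_ratio ^+ n)))) != 0.
    apply: (@cvg_eventually_neq0 C _ (\det (opmx (slice_op (fun=> 0)))));
      last exact: slice_op_det0.
    apply: (@cvg_polyfun C _ nat eventually _ _ (fun n => y1 (contraction_ratio ^+ n)) _ pd) => i.
    exact: ratio_cvg0.
  exists (contraction_ratio ^+ N); last exact: hN.
  by rewrite expf_neq0// gt_eqF// contraction_ratio_gt0.
have [j0 xi0] : exists j, slice_coord (slice_field w0 (y1 s)) j <> 0.
  (* A zero field at e + s z makes the generator commute with e and z; it is then a nonzero multiple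
     of w0, which does not commute with z. *)
  apply: contrapT => no; have xi0 : slice_field w0 (y1 s) = 0.
    rewrite (slice_coordP (slice_field_slice ew0 (y1 s))) big1// => j _.
    have [->|/eqP h'] := eqVneq (slice_coord (slice_field w0 (y1 s)) j) 0; first by rewrite scale0r.
    by case: no; exists j.
  have [] := @centralizing_ker s (field_gen w0 (y1 s)) s0.
    by rewrite -y1E lie_antisym -[lie _ _]/(slice_field w0 (y1 s)) xi0 oppr0.
  move=> /(slice_field_gen0 ew0 tw0) -> /eqP; rewrite lieZr scaler_eq0 (negPf zw0) orbF.
  by rewrite mulf_eq0 pnatr_eq0 (negPf sdet).
have [y y0 hy] := @common_zero_ex R d contraction_ratio contraction_coef
  contraction_ratio_gt0 contraction_ratio_lt1 contraction_coefP _ slice_trace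
  (fun j y => slice_coord (slice_field w0 y) j) (y1 s) j0
  slice_trace_poly (slice_field_poly w0) slice_trace_scale (slice_trace_field ew0) xi0.
by exists y => //; apply/slice_trace_nilpotent.
Qed.
End Centralizing.

(** On the kernel of (ad f)(ad x) the operator [slice_op y] coincides with [ker_proj], which is
    therefore injective there, with values in ker (ad e). *)
Lemma slice_op_ker_dim y : \det (opmx (slice_op y)) != 0 ->
  (\dim (lker (ad f \o ad (slice_pt y))%VF) <= \dim (lker (ad e)))%N.
Proof.
move=> N0; set U := lker _.
have PU : (U :&: lker ker_proj = 0)%VS.
  apply/eqP; rewrite -subv0; apply/subvP => v.
  rewrite [X in is_true X -> _]memv_ker_cap => /andP[/eqP Lv /eqP Pv]; rewrite memv0 -(rVof_eq0 vb); apply/negPn/negP => v0.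
  have Nv : slice_op y v = 0 by rewrite lfunD_E Lv Pv addr0.
  case/negP: N0; apply/det0P; exists (rVof (vbasis {:g}) v) => //.
  by rewrite /opmx -(rVof_app _ vb) Nv linear0.
rewrite -(limg_dim_eq PU); apply: dimvS; apply/subvP => _ /memv_imgP[v _ ->].
by rewrite memv_ker adE; have [-> _] := ker_projP v.
Qed.

(* [x = slice_pt y] satisfies [h / 2 - chi h / 2, x] = v in the slice, so [f] kills
   it; by dimension the kernel of [ad f \o ad x] is that of [ad x], whence [v = 0]. *)
Lemma slice_orbit_eq y (chi psi : 'End(g)) : \det (opmx (slice_op y)) != 0 ->
  lie_morph chi -> (chi \o psi = \1)%VF -> slice_pt y = chi e -> forall j, y j = 0.
Proof.
move=> N0 chiM chipsi ye j; pose u := 2^-1 *: (h - chi h).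
pose v := \sum_(i < d) ((mu i)%:C%C / 2 - 1) * y i *: X`_i.
have hy : lie h (slice_pt y) = 2 *: slice_pt y + 2 *: v.
  rewrite /slice_pt lieDr (lie_he sl2) scalerDr -addrA; congr (_ + _).
  rewrite (linear_sum (lie h)) !scaler_sumr -big_split; apply: eq_bigr => i _ /=.
  rewrite lieZr muP !scalerA -scalerDl; congr (_ *: _).
  by field.
have cy : lie (chi h) (slice_pt y) = 2 *: slice_pt y.
  by rewrite ye -chiM (lie_he sl2) linearZ.
have xu : lie (slice_pt y) u = - v.
  rewrite lie_antisym /u lieZl lieBl hy cy addrAC subrr add0r scalerA mulVf ?scale1r //.
have vS : v \in slice.
  by apply: memv_suml => i _; apply: memvZ; have [] := slice_basis_mem i.
have xu0 : lie (slice_pt y) u = 0.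
  have KL : (lker (ad (slice_pt y)) <= lker (ad f \o ad (slice_pt y))%VF)%VS by exact: lker_comp_sub.
  have chi_inj : (lker (ad e) :&: lker chi = 0)%VS.
    apply/eqP; rewrite -subv0; apply/subvP => w.
    rewrite [X in is_true X -> _]memv_ker_cap memv0 => /andP[_ /eqP cw]; have := comp_inv_sym chipsi => /lfunP/(_ w).
    by rewrite comp_lfunE cw linear0 id_lfunE => <-.
  have : (\dim (lker (ad e)) <= \dim (lker (ad (slice_pt y))))%N.
    rewrite -(limg_dim_eq chi_inj); apply: dimvS; apply/subvP => _ /memv_imgP[w ew ->].
    by move: ew; rewrite !memv_ker !adE ye -chiM => /eqP ->; rewrite linear0.
  move=> /(leq_trans (slice_op_ker_dim N0)) dKL.
  have /eqP KE : (lker (ad (slice_pt y)) == lker (ad f \o ad (slice_pt y))%VF)%VS.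
    by rewrite eqEdim dKL KL.
  apply/eqP; rewrite -adE -memv_ker KE memv_ker comp_lfunE !adE xu lieNr oppr_eq0.
  by have /sliceP[-> _] := vS.
have : slice_coord v j = 0.
  by move/eqP: xu0; rewrite xu oppr_eq0 => /eqP ->; rewrite /slice_coord (herm0l hP) mul0r.
rewrite slice_coordK => /eqP; rewrite mulf_eq0 => /orP[|/eqP//].
(* The factor mu j / 2 - 1 vanishes only for weight 2, excluded by the nonpositive weights. *)
rewrite subr_eq0 => /eqP mu2; have := mu_le0 j; rewrite -lecR rmorph0.
have -> : (mu j)%:C%C = 2 :> C by rewrite -[LHS](divfK (_ : 2 != 0)) ?mu2 ?mul1r// pnatr_eq0.
by rewrite lern0.
Qed.

End Coordinates.
End Slice.

(** * Zariski closures and irreducibility *)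

Section ZariskiClosure.
Variables (R : realType) (V : vectType R[i]).
Local Notation C := (R[i] : numFieldType).
Implicit Types (S A : set V).
Local Notation peval p v := (mpoly.meval (rVof (vbasis {:V}) v 0) p).

Definition zariski_closure S : set V :=
  [set v | forall p, (forall s, S s -> peval p s = 0) -> peval p v = 0].

Lemma zariski_closure_closed S : zariski_closed (zariski_closure S).
Proof. by exists [set p | forall s, S s -> peval p s = 0]. Qed.

Lemma sub_zariski_closure S : S `<=` zariski_closure S.
Proof. by move=> s Ss p; exact. Qed.

Lemma zariski_closure_min S A : zariski_closed A -> S `<=` A -> zariski_closure S `<=` A.
Proof. by move=> [P ->] SA v vS p Pp; apply: vS => s /SA; exact. Qed.

Lemma peval_entire p (gam : C -> V) : (forall j, @entire R[i] (fun t => vcoord j (gam t))) ->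
  @entire R[i] (fun t => peval p (gam t)).
Proof.
move=> eg; have pp : @polyfun R[i] _ (fun y => mpoly.meval y p) by exists p.
apply: (@entire_ext R[i] (fun t => mpoly.meval (fun j => vcoord j (gam t)) p)).
  by move=> t; congr (mpoly.meval _ _); apply/funext => j; rewrite mxE.
exact: (@entire_poly R[i] (@sum_completeC R) _ _ (fun j t => vcoord j (gam t)) pp eg).
Qed.

(** If two closed sets cover the closure but neither contains it, choose an equation of each that
    fails at some point of S and join the two points by an entire curve. The product of the
    equations vanishes along it, contrary to [entire_mul_eq0]. *)
Lemma zariski_closure_irreducible S : S !=set0 ->
  (forall s s', S s -> S s' -> exists gam : C -> V,
     [/\ gam 0 = s, gam 1 = s', forall t, S (gam t) &
         forall j, @entire R[i] (fun t => vcoord j (gam t))]) ->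
  zariski_irreducible (zariski_closure S).
Proof.
move=> [s0 Ss0] path; split; first by exists s0; exact: sub_zariski_closure.
move=> _ _ [P ->] [Q ->] cov.
have sep (P' : set (mpoly.mpoly (\dim {:V}) R[i])) :
    ~ (zariski_closure S `<=` [set v | forall p, P' p -> peval p v = 0]) ->
    exists p s, [/\ P' p, S s & peval p s <> 0].
  move=> nsub; apply: contrapT => no; apply: nsub => v vS p Pp; apply: vS => s Ss.
  by apply: contrapT => ps; apply: no; exists p, s.
apply: contrapT => /not_orP[/sep[p [s [Pp Ss ps]]] /sep[q [s' [Qq Ss' qs']]]].
have [gam [g0 g1 Sg eg]] := path _ _ Ss Ss'.
have [t|p0|q0] := @entire_mul_eq0 R[i] (@sum_completeC R) _ _ (peval_entire p eg) (peval_entire q eg).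
- have [/(_ p Pp) ->|/(_ q Qq) ->] := cov _ (sub_zariski_closure (Sg t)); first exact: mul0r.
  exact: mulr0.
- by apply: ps; rewrite -g0.
- by apply: qs'; rewrite -g1.
Qed.
End ZariskiClosure.

(** * Nilpotent elements of p and cones over K-orbits *)

Section NilpotentCone.
Variables (R : realType) (g : lieAlgType R[i]) (theta : 'End(g)).
Local Notation C := (R[i] : numFieldType).

Lemma nilp_p_closed : zariski_closed (nilp_p theta).
Proof.
pose phi (i : 'I_(\dim {:g}) + 'I_(\dim {:g})) (v : g) : R[i] :=
  match i with
  | inl i => \tr (opmx (ad v) ^+ i.+1)
  | inr j => vcoord j (theta v + v)
  end.
have -> : nilp_p theta = [set v | forall i, phi i v = 0].
  apply/seteqP; split=> v /=.
    move=> [/nilpotent_traceP nv tv] [i|j] /=; first by apply: nv; rewrite /= ltn_ord.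
    by rewrite tv addNr vcoord0.
  move=> h; split.
    by apply/nilpotent_traceP => -[//|i] /= iD; exact: (h (inl (Ordinal iD))).
  apply/eqP; rewrite -addr_eq0; apply/eqP; apply: vcoordP => j.
  by rewrite vcoord0; exact: (h (inr j)).
apply: zariski_closed_zero => -[i|j].
  pose A (y : 'I_(\dim {:g}) -> R[i]) := \sum_j y j *: opmx (ad (vbasis {:g})`_j).
  exists (fun y => \tr (A y ^+ i.+1)).
    apply/polyfun_trace/polymxX/polymx_sum => j.
    by apply: polymxZ; [exact: polyfun_coord|exact: polymx_cst].
  move=> v; rewrite /phi /A {1}[v]vcoord_sum.
  congr (\tr (_ ^+ _)); rewrite (_ : ad _ = \sum_j vcoord j v *: ad (vbasis {:g})`_j).
    by rewrite /opmx raddf_sum; apply: eq_bigr => j _; exact: opmxZ.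
  apply/lfunP => w; rewrite adE lie_suml sum_lfunE; apply: eq_bigr => j _.
  by rewrite lfunZ_E adE lieZl.
have lT : linear_for *%R (fun v => vcoord j (theta v + v)).
  by move=> a x y; rewrite linearP !vcoordD !vcoordZ /=; ring.
pose ell : {scalar g} := HB.pack (fun v => vcoord j (theta v + v))
  (GRing.isLinear.Build _ _ _ _ (fun v => vcoord j (theta v + v)) lT).
exact: (polyfunV_scalar ell).
Qed.

(** The scalar may be 0, so interpolating affinely between two scalars stays inside the cone. *)
Definition orbit_cone (x : g) : set g :=
  [set v | exists a psi, adgroup (fixed_part theta) psi /\ v = a *: psi x].

Lemma orbit_cone_irreducible x : zariski_irreducible (zariski_closure (orbit_cone x)).
Proof.
apply: zariski_closure_irreducible.
  by exists x, 1, \1%VF; rewrite scale1r id_lfunE; split => //; exact: adgroup1.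
move=> _ _ [a [psi [Kpsi ->]]] [b [chi [Kchi ->]]].
have KN v : fixed_part theta v -> fixed_part theta (- v).
  by rewrite /fixed_part /= linearN => {2}<-.
have KZ t v : fixed_part theta v -> fixed_part theta (t *: v).
  by rewrite /fixed_part /= linearZ /= => {2}<-.
have [psi' Kpsi' pp] := adgroup_inv KN Kpsi.
have [Phi [P0 P1 KP eP]] := adgroup_path KZ (adgroup_comp Kchi Kpsi').
exists (fun t => (a + t * (b - a)) *: Phi t (psi x)); split.
- by rewrite mul0r addr0 P0 id_lfunE.
- rewrite mul1r addrC subrK P1 comp_lfunE; congr (_ *: chi _).
  by rewrite -comp_lfunE (comp_inv_sym pp) id_lfunE.
- move=> t; exists (a + t * (b - a)), (Phi t \o psi)%VF; split; last by rewrite comp_lfunE.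
  exact: adgroup_comp.
move=> j; apply: (@entire_ext R[i] (fun t => (a + t * (b - a)) * vcoord j (Phi t (psi x)))).
  by move=> t; rewrite vcoordZ.
apply: entireM; [exact: sum_completeC|exact: entire_affine|exact: eP].
Qed.

Lemma orbit_cone_nilp x : nilp_p theta x -> lie_automorphism theta ->
  zariski_closure (orbit_cone x) `<=` nilp_p theta.
Proof.
move=> [nx tx] [_ tM]; apply: zariski_closure_min nilp_p_closed _.
move=> _ [a [psi [Kpsi ->]]]; split.
  apply/nilpotent_traceP => i i0.
  have KN v : fixed_part theta v -> fixed_part theta (- v).
    by rewrite /fixed_part /= linearN => {2}<-.
  have [psi' _ pp] := adgroup_inv KN Kpsi.
  rewrite (trace_pow_scale_morph a _ _ (adgroup_morph Kpsi) pp).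
  by move/nilpotent_traceP: nx => /(_ i i0) ->; rewrite mulr0.
have tpsi : theta (psi x) = psi (theta x).
  by apply: adgroup_fix Kpsi => k v Kk; rewrite tM Kk.
by rewrite /antifixed_part /= linearZ /= tpsi tx linearN scalerN.
Qed.

End NilpotentCone.

(** * Principal elements and the slice *)

Section Principal.
Variables (R : realType) (g : lieAlgType R[i]) (gR : set g) (theta : 'End(g)).
Local Notation C := (R[i] : numFieldType).
Hypothesis rf : real_form gR.
Hypothesis theta_aut : lie_automorphism theta.
Hypothesis theta2 : order_two theta.
Hypothesis theta_real : forall x, gR x -> gR (theta x).
Hypothesis cartan : cartan_decomposition gR (gR `&` fixed_part theta)
                                           (gR `&` antifixed_part theta).
Variables e h f : g.
Hypothesis cayley : complex_cayley_triple theta gR e h f.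
Hypothesis principal : principal_nilp_p theta e.
Local Notation hf := (cartan_form rf theta).

Let KN v : fixed_part theta v -> fixed_part theta (- v).
Proof. by rewrite /fixed_part /= linearN => {2}<-. Qed.

Lemma principal_slice X mu : orthogonal_expansion hf (slice theta f) X ->
  (forall j : 'I_(size X), mu j <= 0) ->
  (forall j : 'I_(size X), lie h X`_j = (mu j)%:C%C *: X`_j) ->
  forall y : 'I_(size X) -> R[i], nilpotent_elt g (slice_pt e y) -> forall j, y j = 0.
Proof.
move=> XP mu0 muP y ny.
pose xn n := slice_pt e (fun j => contraction_coef mu j ^+ n * y j).
have tx : theta (slice_pt e y) = - slice_pt e y by exact: (slice_pt_theta cayley XP).
have xn_cvg : vcvg xn e by exact: (@slice_pt_cvg R g e X mu mu0 y).
have [N1 hN1] : exists N, forall n, (N <= n)%N ->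
    \det (opmx (slice_op e f (fun j => contraction_coef mu j ^+ n * y j))) != 0.
  exact: (slice_op_det_eventually rf theta_aut theta2 theta_real cartan cayley mu0 y).
pose S := orbit_cone theta (slice_pt e y).
have Sxn n psi : adgroup (fixed_part theta) psi -> S (psi (xn n)).
  move=> Kpsi; have [chi Kchi xE] := slice_pt_scale_orbit cayley muP n y.
  exists (contraction_ratio R ^+ n), (psi \o chi)%VF; split; first exact: adgroup_comp.
  by rewrite /xn xE linearZ comp_lfunE.
pose Z' := zariski_closure S.
have Z'irr : zariski_irreducible Z' by exact: orbit_cone_irreducible.
have Z'nil : Z' `<=` nilp_p theta by apply: orbit_cone_nilp.
(* The contracted points lie in the cone and converge to e, and Zariski closed sets contain such
   limits. *)
have Z'e psi : adgroup (fixed_part theta) psi -> Z' (psi e).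
  move=> Kpsi; apply: (@zariski_closed_lim R g Z' (fun n => psi (xn n))).
  - exact: zariski_closure_closed.
  - by move=> n; apply: sub_zariski_closure; exact: Sxn.
  - exact: vcvg_linear.
have [Z [O [[Znil Zirr Zmax] [x1 _ OE] [A Acl OA] Oe]]] := principal.
have [phi1 Kphi1 e1] : exists2 phi, adgroup (fixed_part theta) phi & phi x1 = e.
  by have [phi Kphi] : adorbit (fixed_part theta) x1 e; [rewrite -OE|exists phi].
have [psi1 Kpsi1 pp1] := adgroup_inv KN Kphi1.
have Oconj v : O v -> exists2 chi, adgroup (fixed_part theta) chi & v = chi e.
  rewrite OE => -[phi Kphi <-]; exists (phi \o psi1)%VF; first exact: adgroup_comp.
  by rewrite comp_lfunE -e1 -[psi1 _]comp_lfunE (comp_inv_sym pp1) id_lfunE.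
have [Ze nAe] : Z e /\ ~ A e by move: Oe; rewrite OA.
(* Z is covered by Z' and A, since its part outside A is the K-orbit of e. It is irreducible and not
   inside A, so it lies in Z'. *)
have ZZ' : Z `<=` Z'.
  have [_ /(_ Z' A (zariski_closure_closed _) Acl)] := Zirr; case=> // [v Zv|].
    have [Av|nAv] := pselect (A v); [by right|left].
    have [|chi Kchi ->] := Oconj v; first by rewrite OA.
    exact: Z'e.
  by move=> /(_ e Ze).
have Z'Z := Zmax Z' Z'nil Z'irr ZZ'.
(* A polynomial separating e from A stays nonzero on the contracted points from some n on; by Z' = Z
   they then lie in the open orbit O. *)
have [p Ap pe] : exists2 p : mpoly.mpoly (\dim {:g}) R[i],
    forall v, A v -> mpoly.meval (fun j => vcoord j v) p = 0 &
    mpoly.meval (fun j => vcoord j e) p != 0.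
  have [P AP] := zariski_closedP Acl; apply: contrapT => no; apply: nAe; apply/AP => p Pp.
  apply: contrapT => /eqP pe; apply: no; exists p => // v /AP; exact.
have [N2 hN2] : exists N, forall n, (N <= n)%N ->
    mpoly.meval (fun j => vcoord j (xn n)) p != 0.
  have pp : @polyfun R[i] _ (fun y => mpoly.meval y p) by exists p.
  apply: (@cvg_eventually_neq0 C (fun n => mpoly.meval (fun j => vcoord j (xn n)) p) _ _ pe).
  exact: (@cvg_polyfun C _ nat eventually _ _ (fun n j => vcoord j (xn n)) _ pp xn_cvg).
pose n := maxn N1 N2.
have Oxn : O (xn n).
  rewrite OA; split; last by move=> /Ap /eqP; apply/negP; apply: hN2; exact: leq_maxr.
  rewrite -Z'Z; apply: sub_zariski_closure; rewrite -[xn n]id_lfunE.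
  by apply: Sxn; exact: adgroup1.
have [chi Kchi xchi] := Oconj _ Oxn.
have [psi _ cp] := adgroup_inv KN Kchi.
have := slice_orbit_eq theta_aut theta2 theta_real cartan cayley XP mu0 muP
  (hN1 n (leq_maxl _ _)) (adgroup_morph Kchi) cp xchi.
move=> y0 j; have /eqP := y0 j; rewrite mulf_eq0 expf_eq0 => /orP[|/eqP//].
have /andP[k0 _] := contraction_coefP mu0 j.
by rewrite (gt_eqF k0) andbF.
Qed.

Lemma principal_distinguished z : theta z = - z ->
  lie z e = 0 -> lie z h = 0 -> lie z f = 0 -> z = 0.
Proof.
move=> tz ze _ zf; apply: contrapT => z0.
have [X XP Xh] := slice_eigenbasis rf theta_aut theta2 theta_real cartan cayley.
have mu_ex (j : 'I_(size X)) : exists m : R, m <= 0 /\ lie h X`_j = m%:C%C *: X`_j.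
  by have [m m0 hm] := Xh _ (mem_nth 0 (ltn_ord j)); exists m.
have [mu muP] := choice mu_ex.
have [z' [z'0 tz' tauz' z'e z'f]] := centralizing_tau rf theta_aut theta2 theta_real cayley tz ze zf z0.
have [y [j yj] ny] := slice_nilpotent_ex theta_aut theta2 theta_real cartan cayley XP
  (fun j => (muP j).1) (fun j => (muP j).2) z'0 tz' tauz' z'e z'f.
by apply: yj; exact: (principal_slice XP (fun j => (muP j).1) (fun j => (muP j).2) ny).
Qed.

End Principal.

(** * Conjugation by the adjoint group *)

Section Transport.
Variables (R : realType) (g : lieAlgType R[i]) (gR : set g).
Hypothesis rf : real_form gR.

Lemma adgroup_real_points (phi : 'End(g)) x : adgroup gR phi -> gR x -> gR (phi x).
Proof.
move=> Gphi /(rconjP rf) xR; apply/(rconjP rf).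
have rr : forall y v, gR y -> rconj rf (lie y v) = lie y (rconj rf v).
  by move=> y v /(rconjP rf) yR; rewrite rconj_lie yR.
by rewrite (adgroup_antilinear _ (rconj_antilinear rf) rr Gphi) xR.
Qed.

Variables phi psi : 'End(g).
Hypothesis phiM : lie_morph phi.
Hypothesis psiM : lie_morph psi.
Hypothesis phiR : forall x, gR x -> gR (phi x).
Hypothesis psiR : forall x, gR x -> gR (psi x).
Hypothesis phipsi : (phi \o psi = \1)%VF.

Let phiK x : phi (psi x) = x. Proof. by rewrite -comp_lfunE phipsi id_lfunE. Qed.
Let psiphi : (psi \o phi = \1)%VF. Proof. exact: comp_inv_sym. Qed.
Let psiK x : psi (phi x) = x. Proof. by rewrite -comp_lfunE psiphi id_lfunE. Qed.

Lemma real_subspace_preimage S : real_subspace S -> real_subspace (psi @^-1` S).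
Proof.
move=> [S0 SD SZ]; split=> [|x y Sx Sy|a x Sx]; rewrite /preimage /= ?linear0//.
  by rewrite linearD; exact: SD.
by rewrite linearZ; exact: SZ.
Qed.

Lemma cartan_decomposition_preimage kR pR : cartan_decomposition gR kR pR ->
  cartan_decomposition gR (psi @^-1` kR) (psi @^-1` pR).
Proof.
move=> [[ks ps] [gE kp0] [kk kp pp] kneg ppos].
have psi_neq0 x : x <> 0 -> psi x <> 0.
  by move=> x0 px; apply: x0; rewrite -[x]phiK px linear0.
split.
- by split; exact: real_subspace_preimage.
- split; apply/seteqP; split=> x /=.
  + move=> /psiR; rewrite gE => -[a ka [b pb ab]].
    exists (phi a); first by rewrite /preimage /= psiK.
    exists (phi b); first by rewrite /preimage /= psiK.
    by rewrite -linearD /= ab phiK.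
  + move=> [a ka [b pb <-]]; rewrite -[a + b]phiK; apply: phiR; rewrite gE.
    by exists (psi a) => //; exists (psi b) => //; rewrite linearD.
  + move=> [kx px]; have : (kR `&` pR) (psi x) by [].
    by rewrite kp0 => /= px0; rewrite -[x]phiK px0 linear0.
  + by move=> ->; have : (kR `&` pR) 0; [rewrite kp0|rewrite /preimage /= linear0].
- split=> x y; rewrite /preimage /= psiM; [exact: kk|exact: kp|exact: pp].
- by move=> x kx /psi_neq0 x0; rewrite -(killing_morph x x psiM psiphi); exact: kneg.
by move=> x px /psi_neq0 x0; rewrite -(killing_morph x x psiM psiphi); exact: ppos.
Qed.

Variable theta : 'End(g).
Hypothesis theta_aut : lie_automorphism theta.
Hypothesis theta2 : order_two theta.
Hypothesis theta_real : forall x, gR x -> gR (theta x).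
Hypothesis cartan : cartan_decomposition gR (gR `&` fixed_part theta)
                                           (gR `&` antifixed_part theta).
Variables e h f : g.
Hypothesis cayley : complex_cayley_triple theta gR e h f.
Hypothesis distinguished : forall z, theta z = - z ->
  lie z e = 0 -> lie z h = 0 -> lie z f = 0 -> z = 0.

(** Rather than the Levi factor and its group, the involution and the triple are transported: phi
    (e, h, f) is a distinguished Cayley triple for phi theta phi^-1, and [cayley_compact] applies
    again. *)
Lemma cayley_compact_conj : compact_nilp gR (phi (cayley_nilp e h f)).
Proof.
pose theta' : 'End(g) := (phi \o (theta \o psi))%VF.
have tE x : theta' x = phi (theta (psi x)) by rewrite /theta' !comp_lfunE.
have gRpsi x : gR (psi x) <-> gR x by split=> [/phiR|/psiR]; rewrite ?phiK.
have fixE : gR `&` fixed_part theta' = psi @^-1` (gR `&` fixed_part theta).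
  apply/seteqP; split=> x [/gRpsi gx]; rewrite /fixed_part /= ?tE => tx; split => //.
    by rewrite -{2}tx psiK.
  by rewrite tx phiK.
have antiE : gR `&` antifixed_part theta' = psi @^-1` (gR `&` antifixed_part theta).
  apply/seteqP; split=> x [/gRpsi gx]; rewrite /antifixed_part /= ?tE => tx; split => //.
    by rewrite -[theta _]psiK tx linearN.
  by rewrite tx linearN /= phiK.
have t'K x : theta' (theta' x) = x by rewrite !tE psiK (thetaK theta2) phiK.
have aut' : lie_automorphism theta'.
  split; first by exists theta' => x; exact: t'K.
  by move=> x y; rewrite !tE psiM (theta_lie theta_aut) phiM.
have two' : order_two theta'.
  split; first by apply/lfunP => x; rewrite comp_lfunE t'K id_lfunE.
  move=> t1; case: theta2 => _; apply; apply/lfunP => x; rewrite id_lfunE.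
  by have /lfunP/(_ (phi x)) := t1; rewrite tE psiK id_lfunE => /(can_inj psiK).
have real' x : gR x -> gR (theta' x).
  by move=> gx; rewrite tE; apply/phiR/theta_real/psiR.
have cartan' : cartan_decomposition gR (gR `&` fixed_part theta') (gR `&` antifixed_part theta').
  by rewrite fixE antiE; exact: cartan_decomposition_preimage.
have cayley' : complex_cayley_triple theta' gR (phi e) (phi h) (phi f).
  have [[he hf ef] th te tf [a [b [ga gb eE fE]]]] := cayley.
  split; rewrite /fixed_part /antifixed_part /= ?tE ?psiK.
  - by split; rewrite -phiM ?he ?hf ?ef ?linearN ?linearZ.
  - by rewrite th.
  - by rewrite te linearN.
  - by rewrite tf linearN.
  exists (phi a), (phi b); split; [exact: phiR|exact: phiR| |].
    by rewrite eE linearD linearZ.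
  by rewrite fE linearB linearZ.
have -> : phi (cayley_nilp e h f) = cayley_nilp (phi e) (phi h) (phi f).
  by rewrite /cayley_nilp linearZ linearB linearD linearN.
apply: (cayley_compact rf aut' two' real' cartan' cayley') => z.
rewrite tE => tz ze zh zf; rewrite -[z]phiK; apply/eqP.
rewrite (_ : psi z = 0) ?linear0//; apply: distinguished.
- by rewrite -[theta _]psiK tz linearN.
- by rewrite -[e]psiK -psiM ze linear0.
- by rewrite -[h]psiK -psiM zh linear0.
- by rewrite -[f]psiK -psiM zf linear0.
Qed.
End Transport.

Theorem theorem6 (R : realType) (g : lieAlgType R[i]) (theta : 'End(g))
    (gR : set g) :
  lie_semisimple g ->
  lie_automorphism theta -> order_two theta ->
  real_form gR ->
  (forall x : g, gR x -> gR (theta x)) ->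
  cartan_decomposition gR (gR `&` fixed_part theta)
                          (gR `&` antifixed_part theta) ->
  forall O : set g, K_orbit_nilp_p theta O -> O `<=` principal_nilp_p theta ->
  forall O' : set g, kostant_sekiguchi theta gR O O' ->
  forall x : g, O' x -> compact_nilp gR x.
Proof.
move=> _ theta_aut theta2 rf theta_real cartan O _ Opr O'.
move=> [_ _ [e [h [f [cayley /Opr principal ->]]]]] _ [phi Gphi <-].
have [psi Gpsi pp] := adgroup_inv (realformN rf) Gphi.
apply: (cayley_compact_conj rf (adgroup_morph Gphi) (adgroup_morph Gpsi) _ _ pp
  theta_aut theta2 theta_real cartan cayley).
- by move=> x; exact: adgroup_real_points.
- by move=> x; exact: adgroup_real_points.
exact: (principal_distinguished rf theta_aut theta2 theta_real cartan cayley principal).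
Qed.
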